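(* Let $\nu$ be an absolutely continuous probability measure on $\mathbb{R}^p$ with compact support $\mathcal{S}\subset\mathbb{R}^p$, and let $w$ be a weight function on $\mathbb{R}^p$. For each $n$ let $m=m_n$ be a positive integer and $N=n+m$, and let $\{\mathcal{G}_N\}$ be a sequence of grids in $\mathcal{S}$, $\mathcal{G}_N$ consisting of $N$ points, such that the uniform measure on $\mathcal{G}_N$ converges weakly to $\nu$ as $n\to\infty$. Let $n/m\to\lambda\in(0,\infty)$ as $n\to\infty$. Let $\boldsymbol X_1,\dots,\boldsymbol X_n$ be a random sample from an absolutely continuous distribution on $\mathbb{R}^p$ with distribution function $F_{\boldsymbol X}$, and let $\boldsymbol X_1^{(0)},\dots,\boldsymbol X_m^{(0)}$ be a random sample, independent of the first one, from the absolutely continuous distribution with distribution function $F_0$. Then under the null hypothesis $\mathcal{H}_0:F_{\boldsymbol X}\equiv F_0$, $$D_{n,m}\stackrel{\mathcal D}{\to}\int_{\mathbb{R}^p}Z^2(\boldsymbol t)\,w(\boldsymbol t)\,\mathrm{d}\boldsymbol t\qquad\text{as } n\to\infty,$$ where $\{Z(\boldsymbol t),\boldsymbol t\in\mathbb{R}^p\}$ is a centered Gaussian process with covariance function $$R(\boldsymbol t_1,\boldsymbol t_2)=\mathsf{E}\,Z(\boldsymbol t_1)Z(\boldsymbol t_2)=\mathrm{cov}\big(\cos(\boldsymbol t_1^\top\boldsymbol Y)+\sin(\boldsymbol t_1^\top\boldsymbol Y),\ \cos(\boldsymbol t_2^\top\boldsymbol Y)+\sin(\boldsymbol t_2^\top\boldsymbol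 Y)\big),$$ and $\boldsymbol Y$ is a random vector with distribution $\nu$.
   Context: Weight function: $w:\mathbb{R}^p\to[0,\infty)$ is measurable with $w(\boldsymbol t)=w(-\boldsymbol t)$ and $\int_{\mathbb{R}^p}w(\boldsymbol t)\,\mathrm{d}\boldsymbol t<\infty$. Empirical optimal transport and multivariate ranks: for the pooled sample $\mathcal{Z}_N=\{\boldsymbol X_1,\dots,\boldsymbol X_n,\boldsymbol X^{(0)}_1,\dots,\boldsymbol X^{(0)}_m\}=\{\boldsymbol Z_1,\dots,\boldsymbol Z_N\}$ and the (non-random) grid $\mathcal{G}_N$ of $N$ points, the map $\widehat{\boldsymbol G}_N$ is a minimizer of $\sum_{i=1}^N\|\boldsymbol G(\boldsymbol Z_i)-\boldsymbol Z_i\|^2$ over all bijections $\boldsymbol G:\mathcal{Z}_N\to\mathcal{G}_N$. The multivariate ranks are $\boldsymbol R_i=\widehat{\boldsymbol G}_N(\boldsymbol X_i)$, $i=1,\dots,n$, and $\boldsymbol R^{(0)}_j=\widehat{\boldsymbol G}_N(\boldsymbol X^{(0)}_j)$, $j=1,\dots,m$. Test statistic: $$D_{n,m}=\frac{nm}{n+m}\int_{\mathbb{R}^p}\big|\widehat\phi_n(\boldsymbol t)-\widehat\phi^{(0)}_m(\boldsymbol t)\big|^2 w(\boldsymbol t)\,\mathrm{d}\boldsymbol t,$$ where $\widehat\phi_n(\boldsymbol t)=\frac1n\sum_{j=1}^n\exp(\mathrm{i}\,\boldsymbol t^\top\boldsymbol R_j)$ and $\widehat\phi^{(0)}_m(\boldsymbol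 t)=\frac1m\sum_{j=1}^m\exp(\mathrm{i}\,\boldsymbol t^\top\boldsymbol R^{(0)}_j)$. The symbol $\stackrel{\mathcal D}{\to}$ denotes convergence in distribution. *)

(* Defs.v *)
From HB Require Import structures.
From mathcomp Require Import all_boot all_order all_algebra.
From mathcomp Require Import all_classical all_reals all_analysis.
From mathcomp Require Import measurable_realfun complex.

Set Implicit Arguments.
Unset Strict Implicit.
Unset Printing Implicit Defensive.
Import Order.TTheory GRing.Theory Num.Theory.
Import numFieldNormedType.Exports.
Local Open Scope classical_set_scope.
Local Open Scope ring_scope.

(* R^p is the type ['rV[R]_p] of row vectors. Its library topology is that of
   the sup norm, hence the usual one; the instance below adds the Borel
   sigma-algebra. *)

Section borel_rV.
Variables (R : realType) (p : nat).
Let borel := <<s (@open 'rV[R]_p) >>.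

Let borel0 : borel set0. Proof. exact: sigma_algebra0. Qed.
Let borelC A : borel A -> borel (~` A). Proof. exact: sigma_algebraC. Qed.
Let borel_bigcup (F : (set 'rV[R]_p)^nat) :
  (forall i, borel (F i)) -> borel (\bigcup_i F i).
Proof. exact: sigma_algebra_bigcup. Qed.

HB.instance Definition _ := @isMeasurable.Build
  (sigma_display (@open 'rV[R]_p)) 'rV[R]_p borel borel0 borelC borel_bigcup.
End borel_rV.

Section measurable_rV.
Context (R : realType) (p : nat).

Lemma measurable_rVE : measurable = <<s (@open 'rV[R]_p) >>.
Proof. by []. Qed.

Lemma measurable_coord (i : 'I_p) :
  measurable_fun setT (fun x : 'rV[R]_p => x ord0 i).
Proof.
apply: (measurability _ (RGenOpens.measurableE R)) => _ [_ [a [b ->]] <-].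
rewrite setTI; apply: sub_sigma_algebra.
apply: open_comp; last exact: interval_open.
by move=> x _; exact: coord_continuous.
Qed.

Lemma measurable_fun_rV d (T : measurableType d) (f : T -> 'rV[R]_p) :
  (forall i, measurable_fun setT (fun x => f x ord0 i)) ->
  measurable_fun setT f.
Proof.
move=> mf; apply: (measurability _ measurable_rVE) => _ [U oU <-]; rewrite setTI.
pose box (q : 'rV[rat]_p * rat) : set 'rV[R]_p :=
  [set x | forall i, `|ratr (q.1 ord0 i) - x ord0 i| < ratr q.2].
pose F q : set T := if asbool (box q `<=` U) then f @^-1` box q else set0.
have -> : f @^-1` U = \bigcup_q F q.
  apply/seteqP; split => [x Ufx|x [q _]]; last first.
    by rewrite /F; case: asboolP => // qU /qU.
  have [e e0 eU] : exists2 e : R, 0 < e & ball (f x) e `<=` U.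
    have /nbhs_ballP[e /= e0 eU] := open_nbhs_nbhs (conj oU Ufx).
    by exists e.
  have [r] : exists r : rat, ratr r \in `]0, (e / 2)[%R.
    by apply: rat_in_itvoo; rewrite divr_gt0.
  rewrite in_itv/= => /andP[r0 re].
  have /choice[q qP] : forall i, exists q : rat,
      ratr q \in `](f x ord0 i - ratr r), (f x ord0 i + ratr r)[%R.
    by move=> i; apply: rat_in_itvoo; rewrite ltrD2l gtrN.
  have qr i : `|ratr (q i) - f x ord0 i| < ratr r.
    by rewrite ltr_distl; have := qP i; rewrite in_itv.
  exists (\row_i q i, r) => //; rewrite /F; case: asboolP => [_|].
    by move=> i /=; rewrite mxE.
  case=> y /= yq; apply: eU; split => // i j; rewrite (ord1 i).
  have := yq j; rewrite mxE => yqj.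
  rewrite /ball/= -(subrKA (ratr (q j))).
  rewrite (le_lt_trans (ler_normD _ _))// [ltRHS]splitr.
  by apply: ltrD; rewrite (lt_trans _ re)// distrC.
apply: countable_bigcupT_measurable => // q.
rewrite /F; case: asboolP => // _.
have -> : f @^-1` box q = \bigcap_(i in [set: 'I_p])
    ((fun x => `|ratr (q.1 ord0 i) - f x ord0 i|) @^-1` `]-oo, ratr q.2[).
  apply/seteqP; split => [x fx i _|x fx i] /=; first by rewrite in_itv/=.
  by have := fx i Logic.I; rewrite /= in_itv.
apply: fin_bigcap_measurable => // i _.
rewrite -[X in measurable X]setTI.
suff : measurable_fun setT (fun x => `|ratr (q.1 ord0 i) - f x ord0 i|).
  by move=> m; exact: m.
by apply: measurableT_comp => //; exact: measurable_funB.
Qed.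

End measurable_rV.

Section lebesgue_rV.
Context (R : realType).

Definition cons_rV n (x : measurableTypeR R * 'rV[R]_n) : 'rV[R]_n.+1 :=
  row_mx (\row_(_ < 1) x.1) x.2.

Definition uncons_rV n (v : 'rV[R]_n.+1) : measurableTypeR R * 'rV[R]_n :=
  (v ord0 ord0, @rsubmx R 1 1 n v).

Lemma cons_rVK n : cancel (@cons_rV n) (@uncons_rV n).
Proof.
move=> [x v]; rewrite /uncons_rV /cons_rV/= row_mxKr; congr pair.
rewrite (_ : (ord0 : 'I_n.+1) = @lshift 1 n ord0); last exact/val_inj.
by rewrite [LHS](@row_mxEl R 1 1 n) mxE.
Qed.

Lemma measurable_cons_rV n : measurable_fun setT (@cons_rV n).
Proof.
apply: measurable_fun_rV => i; rewrite /cons_rV.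
case: (split_ordP (i : 'I_(1 + n))) => j ->.
  under eq_fun do rewrite (@row_mxEl R 1 1 n) mxE.
  exact: measurable_fst.
under eq_fun do rewrite (@row_mxEr R 1 1 n).
by apply: (measurableT_comp (measurable_coord j)); exact: measurable_snd.
Qed.

Lemma measurable_uncons_rV n : measurable_fun setT (@uncons_rV n).
Proof.
apply/measurable_fun_pairP; split; first exact: measurable_coord.
apply: measurable_fun_rV => i /=.
by under eq_fun do rewrite mxE; exact: measurable_coord.
Qed.

Section step.
Variables (n : nat) (mu : {sigma_finite_measure set 'rV[R]_n -> \bar R}).

Definition lebesgue_step : set 'rV[R]_n.+1 -> \bar R :=
  pushforward (@lebesgue_measure R \x mu)%E (@cons_rV n).

Let mcons A : measurable A -> measurable (@cons_rV n @^-1` A).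
Proof.
by move=> mA; rewrite -[X in measurable X]setTI; exact: measurable_cons_rV.
Qed.

Let mu0 : lebesgue_step set0 = 0%E.
Proof. by rewrite /lebesgue_step /pushforward preimage_set0 measure0. Qed.

Let mu_ge0 A : (0 <= lebesgue_step A)%E.
Proof. by rewrite /lebesgue_step /pushforward measure_ge0. Qed.

Let mu_sigma_additive : semi_sigma_additive lebesgue_step.
Proof.
move=> F mF tF mUF; rewrite /lebesgue_step /pushforward preimage_bigcup.
apply: measure_semi_sigma_additive.
- by move=> i; exact: mcons.
- apply/trivIsetP => /= i j _ _ ij; rewrite -preimage_setI.
  by move/trivIsetP : tF => /(_ _ _ _ _ ij) ->//; rewrite preimage_set0.
- by rewrite -preimage_bigcup; exact: mcons.
Qed.

HB.instance Definition _ := isMeasure.Build _ _ _ lebesgue_step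
  mu0 mu_ge0 mu_sigma_additive.

Let mu_sigma_finite : sigma_finite setT lebesgue_step.
Proof.
have /sigma_finiteP[F [TF ndF Foo]] := sigma_finiteT (@lebesgue_measure R).
have /sigma_finiteP[G [TG ndG Goo]] := sigma_finiteT mu.
exists (fun i => @uncons_rV n @^-1` (F i `*` G i)).
  rewrite -preimage_bigcup; suff -> : \bigcup_i (F i `*` G i) = setT.
    by rewrite preimage_setT.
  apply/seteqP; split => // -[x y] _.
  have : [set: R] x by []. rewrite TF => -[k _ Fkx].
  have : [set: 'rV[R]_n] y by []. rewrite TG => -[l _ Gly].
  exists (maxn k l) => //; split => /=.
  - by move: x Fkx; exact/subsetPset/ndF/leq_maxl.
  - by move: y Gly; exact/subsetPset/ndG/leq_maxr.
move=> i; have [mF Fioo] := Foo i; have [mG Gioo] := Goo i; split.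
  rewrite -[X in measurable X]setTI; apply: measurable_uncons_rV => //.
  exact: measurableX.
rewrite /lebesgue_step /pushforward -comp_preimage.
rewrite (_ : _ \o _ = id); last by apply/funext => x; exact: cons_rVK.
by rewrite preimage_id product_measure1E// lte_mul_pinfty// ge0_fin_numE.
Qed.

HB.instance Definition _ := Measure_isSigmaFinite.Build _ _ _ lebesgue_step
  mu_sigma_finite.

End step.

Fixpoint lebesgue_rV p : {sigma_finite_measure set 'rV[R]_p -> \bar R} :=
  match p with
  | 0 => @dirac _ 'rV[R]_0 0 R
  | n.+1 => lebesgue_step (lebesgue_rV n)
  end.

Lemma lebesgue_rV_box p (a b : 'I_p -> R) : (forall i, a i <= b i) ->
  lebesgue_rV p [set x | forall i, x ord0 i \in `]a i, b i]] =
  (\prod_i (b i - a i))%:E.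
Proof.
elim: p => [|n IHn] in a b * => ab.
  rewrite /= diracE big_ord0 mem_set//.
  by case.
rewrite /= /lebesgue_step /pushforward.
pose B := [set y : 'rV[R]_n | forall i,
  y ord0 i \in `]a (lift ord0 i), b (lift ord0 i)]].
rewrite (_ : _ @^-1` _ = `]a ord0, b ord0] `*` B); last first.
  have E0 (x : measurableTypeR R * 'rV[R]_n) : cons_rV x ord0 ord0 = x.1.
    by have /(congr1 fst) := cons_rVK x.
  have ES (x : measurableTypeR R * 'rV[R]_n) i :
      cons_rV x ord0 (lift ord0 i) = x.2 ord0 i.
    transitivity ((uncons_rV (cons_rV x)).2 ord0 i); last by rewrite cons_rVK.
    rewrite /uncons_rV; move: (cons_rV x) => v /=; rewrite mxE.
    by rewrite (_ : lift ord0 i = rshift 1 i)//; exact/val_inj.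
  apply/seteqP; split => x /=.
    move=> xab; split; first by rewrite -E0; exact: xab.
    by move=> i; rewrite -ES; exact: xab.
  move=> [x1 x2] i; case: (unliftP ord0 i) => [j ->|->]; last by rewrite E0.
  by rewrite ES; exact: x2.
have mB : measurable B.
  rewrite (_ : B = \bigcap_(i in [set: 'I_n])
      ((fun y : 'rV[R]_n => y ord0 i) @^-1`
        `]a (lift ord0 i), b (lift ord0 i)])).
    apply: fin_bigcap_measurable => // i _.
    by rewrite -[X in measurable X]setTI; exact: measurable_coord.
  by apply/seteqP; split => [y By i _|y By i]; [exact: By|exact: (By i Logic.I)].
rewrite product_measure1E//= IHn// lebesgue_measure_itv/= lte_fin.
rewrite big_ord_recl EFinM; congr (_ * _)%E.
case: ltP => // ba; suff -> : a ord0 = b ord0 by rewrite subrr.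
by apply/eqP; rewrite eq_le ab.
Qed.

End lebesgue_rV.

Section measures_on_rV.
Context (R : realType) (p : nat).
Implicit Types (mu : {measure set 'rV[R]_p -> \bar R}) (s : seq 'rV[R]_p).

Definition msupport mu : set 'rV[R]_p :=
  [set x | forall U, open U -> U x -> (0 < mu U)%E].

Definition df mu (x : 'rV[R]_p) : \bar R :=
  mu [set y | forall i, y ord0 i <= x ord0 i].

Definition uniform_on s : {measure set 'rV[R]_p -> \bar R} :=
  mscale ((size s)%:R^-1 : R)%:nng
    (msum (fun k => \d_(s`_k) : {measure set 'rV[R]_p -> \bar R}) (size s)).

Definition weak_cvg (mu_ : nat -> {measure set 'rV[R]_p -> \bar R}) mu :=
  forall f : 'rV[R]_p -> R, continuous f -> bounded_fun f ->
    \int[mu_ n]_x f x @[n --> \oo] --> \int[mu]_x f x.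

Definition weight_function (w : 'rV[R]_p -> R) :=
  [/\ measurable_fun setT w, forall t, 0 <= w t, forall t, w (- t) = w t &
      (\int[lebesgue_rV R p]_t (w t)%:E < +oo)%E].

End measures_on_rV.

Section probability_notions.
Context (R : realType).

(* Taking some of the [B i] to be [setT] yields the product rule for every
   subfamily. *)
Definition mutually_independent d d' (Omega : measurableType d)
    (T : measurableType d') (P : probability Omega R) (I : finType)
    (X : I -> Omega -> T) :=
  forall B : I -> set T, (forall i, measurable (B i)) ->
    P (\bigcap_i (X i @^-1` B i)) = (\prod_i P (X i @^-1` B i))%E.

Definition has_law d d' (Omega : measurableType d) (T : measurableType d')
    (P : probability Omega R) (X : Omega -> T) (mu : set T -> \bar R) :=
  measurable_fun setT X /\
  forall A, measurable A -> P (X @^-1` A) = mu A.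

Definition cvg_in_law (d_ : nat -> measure_display)
    (Omega_ : forall n, measurableType (d_ n))
    (P_ : forall n, probability (Omega_ n) R) (X_ : forall n, Omega_ n -> R)
    d (Omega : measurableType d) (P : probability Omega R) (X : Omega -> R) :=
  forall f : R -> R, continuous f -> bounded_fun f ->
    ('E_(P_ n)[f \o X_ n] @[n --> \oo] --> 'E_P[f \o X])%E.

(* [normal_prob m 0] is not the degenerate normal distribution. *)
Definition gaussian_law (m s : R) (A : set (measurableTypeR R)) : \bar R :=
  if s == 0 then \d_m A else normal_prob m s A.

Definition gaussian_process d (Omega : measurableType d)
    (P : probability Omega R) (I : Type) (Z : I -> Omega -> R) :=
  forall (k : nat) (t : 'I_k -> I) (a : 'I_k -> R),
    exists m s, has_law P (fun om => \sum_j a j * Z (t j) om)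
                          (gaussian_law m s).

End probability_notions.

Section rank_statistic.
Context (R : realType) (p : nat).
Local Notation V := 'rV[R]_p.

Definition dotp (x y : V) : R := \sum_i x ord0 i * y ord0 i.

(* Squared Euclidean norm; the library norm [`|x|] on ['rV_p] is the sup norm. *)
Definition sqnorm (x : V) : R := dotp x x.

(* Only the values of [G] on [range z] matter. There is no bijection when the
   points [z i] are not distinct, so that the predicate is then false. *)
Definition optimal_transport (I : finType) (z : I -> V) (grid : set V)
    (G : V -> V) :=
  set_bij (range z) grid G /\
  forall H : V -> V, set_bij (range z) grid H ->
    \sum_i sqnorm (G (z i) - z i) <= \sum_i sqnorm (H (z i) - z i).

Definition pooled T n m (x : 'I_n -> T) (y : 'I_m -> T) (i : 'I_n + 'I_m) : T :=
  match i with inl j => x j | inr j => y j end.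

Definition expi (x : R) : R[i] := (cos x +i* sin x)%C.

Definition ecf n (r : 'I_n -> V) (t : V) : R[i] :=
  n%:R^-1 * \sum_j expi (dotp t (r j)).

Definition rank_stat (w : V -> R) n m (r : 'I_n -> V) (r0 : 'I_m -> V) : R :=
  (n * m)%:R / (n + m)%:R *
  \int[lebesgue_rV R p]_t
    (ComplexField.Normc.normc (ecf r t - ecf r0 t) ^+ 2 * w t).

Definition cos_plus_sin (t y : V) : R := cos (dotp t y) + sin (dotp t y).

End rank_statistic.

(* Main.v *)
(** Under the null hypothesis the pooled sample is exchangeable, and almost surely
    the optimal assignment of its points to the grid is unique, because a tie
    between two assignments is a nontrivial affine equation satisfied by an
    absolutely continuous vector. The ranks are therefore a uniformly random
    arrangement of the grid, and the common distribution of the sample disappears.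

    As the weight is even, the cross terms of the squared modulus of the difference
    of the empirical characteristic functions integrate to zero, and the statistic
    is the integral [D] of [U t ^+ 2 * w t], where [U t] is the normalized difference
    of the two sample means of [cos_plus_sin t] at the ranks. For a finite linear
    combination [v] of the functions [cos_plus_sin t], Stein's method with a random
    transposition as exchangeable pair shows that the normalized difference of means
    of [v] has characteristic function close to that of a centered normal law whose
    variance is that of [v] under the uniform measure on the grid; by weak convergence
    this variance tends to the one of [v] under [nu]. Hence the finite-dimensional
    laws of [U] converge to those of [Z].

    To pass to [D], replace [t] by a quantized version of [t]; since the increments of
    [U] and [Z] are bounded by those of [t] in quadratic mean, uniformly in [n], this
    changes [D] by little in mean, and turns it into a finite sum of terms
    [c * U t ^+ 2] with [0 <= c]. The Hubbard-Stratonovich identity, which writes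
    [expR (- c * x ^+ 2)] as a normal average of [cos (xi * x)], expresses the Laplace
    transform of such a sum through the characteristic functions of linear
    combinations of the [U t], so that the Laplace transform of [D] converges
    pointwise to that of the limit. By the Weierstrass theorem this
    implies convergence in law. *)

Require Import Defs.
From HB Require Import structures.
From mathcomp Require Import all_boot all_order all_algebra all_fingroup.
From mathcomp Require Import all_classical all_reals all_analysis.
From mathcomp Require Import measurable_realfun complex ring lra.
Set Implicit Arguments.
Unset Strict Implicit.
Unset Printing Implicit Defensive.
Import Order.TTheory GRing.Theory Num.Theory.
Import numFieldNormedType.Exports.
Local Open Scope classical_set_scope.
Local Open Scope ring_scope.

(** * Mean value inequalities and elementary bounds for sine and cosine *)

Section calculus.
Context {R : realType}.
Implicit Types (f df g : R -> R) (a b x y : R).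

Lemma is_derive_continuous f df : (forall x, is_derive x 1 f (df x)) -> continuous f.
Proof.
by move=> fdf x; apply: differentiable_continuous; apply/derivable1_diffP; case: (fdf x).
Qed.

Lemma is_derive_cstM f (c d x : R) : is_derive x 1 f d ->
  is_derive x 1 (fun x => c * f x) (c * d).
Proof.
by move=> fd; exact: is_deriveZ.
Qed.

Lemma is_derive_mulf f g (df dg : R) x : is_derive x 1 f df -> is_derive x 1 g dg ->
  is_derive x 1 (fun x => f x * g x) (df * g x + f x * dg).
Proof.
move=> fd gd; have -> : (fun x => f x * g x) = f * g by [].
by apply: is_derive_eq; rewrite /GRing.scale/= addrC mulrC.
Qed.

Lemma is_derive_bigsum (I : Type) (r : seq I) (f df : I -> R -> R) x :
  (forall i, is_derive x 1 (f i) (df i x)) ->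
  is_derive x 1 (fun x => \sum_(i <- r) f i x) (\sum_(i <- r) df i x).
Proof.
move=> fdf; elim: r => [|i r IH].
  by rewrite big_nil; under eq_fun do rewrite big_nil; exact: is_derive_cst.
by rewrite big_cons; under eq_fun do rewrite big_cons; exact: is_deriveD.
Qed.

Lemma derive_le_norm f df a b K : (forall x, is_derive x 1 f (df x)) ->
  a <= b -> (forall x, a <= x <= b -> `|df x| <= K) -> `|f b - f a| <= K * (b - a).
Proof.
move=> fdf ab dfK.
have [c] := MVT_segment ab (fun x _ => fdf x)
  (continuous_subspaceT (is_derive_continuous fdf)).
rewrite in_itv/= => cab ->; rewrite normrM [`|b - a|]ger0_norm ?subr_ge0//.
by rewrite ler_wpM2r ?subr_ge0// dfK.
Qed.

Lemma derive_lipschitz f df K x y : (forall x, is_derive x 1 f (df x)) ->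
  (forall x, `|df x| <= K) -> `|f x - f y| <= K * `|x - y|.
Proof.
move=> fdf dfK; wlog xy : x y / y <= x.
  move=> H; have [/H//|/ltW /H] := leP y x.
  by rewrite distrC [in leRHS]distrC.
by rewrite [X in _ * X]ger0_norm ?subr_ge0// (derive_le_norm fdf).
Qed.

Lemma norm_cos_le1 x : `|cos x| <= 1.
Proof. by rewrite ler_norml cos_geN1 cos_le1. Qed.

Lemma norm_sin_le1 x : `|sin x| <= 1.
Proof. by rewrite ler_norml sin_geN1 sin_le1. Qed.

Lemma cos_lipschitz x y : `|cos x - cos y| <= `|x - y|.
Proof.
rewrite -[leRHS]mul1r; apply: derive_lipschitz => z; rewrite normrN.
exact: norm_sin_le1.
Qed.

Lemma sin_lipschitz x y : `|sin x - sin y| <= `|x - y|.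
Proof. by rewrite -[leRHS]mul1r; apply: derive_lipschitz; exact: norm_cos_le1. Qed.

(** As a function of [y], the remainder has derivative [cos (x + y) - cos x], at most [|y|] in
    modulus; the mean value bound on the segment between [0] and [y] then gives the square. *)
Lemma sin_taylor1 x y : `|sin (x + y) - sin x - y * cos x| <= y ^+ 2.
Proof.
have h (z : R) : is_derive z 1 (fun z => sin (x + z) - z * cos x) (cos (x + z) - cos x).
  by apply: is_derive_eq; rewrite /GRing.scale/=; ring.
suff : `|(fun z => sin (x + z) - z * cos x) y - (fun z => sin (x + z) - z * cos x) 0|
    <= y ^+ 2.
  rewrite addr0 mul0r subr0; congr (`|_| <= _); ring.
have aux z : `|cos (x + z) - cos x| <= `|z|.
  by rewrite (le_trans (cos_lipschitz _ _))// addrAC subrr add0r.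
rewrite -real_normK ?num_real// expr2.
have [y0|/ltW y0] := leP 0 y.
  rewrite [in X in _ <= _ * X]ger0_norm// -[X in _ <= _ * X]subr0.
  apply: (derive_le_norm h) => // z /andP[z0 zy].
  by rewrite (le_trans (aux _))// !ger0_norm.
rewrite distrC [in X in _ <= _ * X]ler0_norm// -[X in _ <= _ * X]sub0r.
apply: (derive_le_norm h) => // z /andP[z0 zy].
by rewrite (le_trans (aux _))// !ler0_norm// lerN2.
Qed.

End calculus.

Lemma measurable_preimage d1 d2 (T1 : measurableType d1) (T2 : measurableType d2)
    (f : T1 -> T2) (A : set T2) :
  measurable_fun setT f -> measurable A -> measurable (f @^-1` A).
Proof. by move=> mf mA; rewrite -[X in measurable X]setTI; exact: mf. Qed.

(** * The dot product of row vectors, compared with the sup norm *)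

Section dot_product.
Context {R : realType} {p : nat}.
Implicit Types x y z : 'rV[R]_p.

Lemma dotpC x y : dotp x y = dotp y x.
Proof. by apply: eq_bigr => i _; rewrite mulrC. Qed.

Lemma dotpDl x y z : dotp (x + y) z = dotp x z + dotp y z.
Proof. by rewrite -big_split/=; apply: eq_bigr => i _; rewrite mxE mulrDl. Qed.

Lemma dotpNl x y : dotp (- x) y = - dotp x y.
Proof. by rewrite -sumrN; apply: eq_bigr => i _; rewrite mxE mulNr. Qed.

Lemma dotpBl x y z : dotp (x - y) z = dotp x z - dotp y z.
Proof. by rewrite dotpDl dotpNl. Qed.

Lemma dotpBr x y z : dotp x (y - z) = dotp x y - dotp x z.
Proof. by rewrite dotpC dotpBl !(dotpC x). Qed.

Lemma sqnormB x y : sqnorm (x - y) = sqnorm x - 2 * dotp x y + sqnorm y.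
Proof. by rewrite /sqnorm dotpBl !dotpBr (dotpC y x); ring. Qed.

Lemma norm_coord_le x i : `|x ord0 i| <= `|x|.
Proof.
by rewrite [leRHS]/Num.Def.normr /= mx_normrE; apply/bigmax_geP; right; exists (ord0, i).
Qed.

Lemma dotp_le x y : `|dotp x y| <= p%:R * (`|x| * `|y|).
Proof.
rewrite (le_trans (ler_norm_sum _ _ _))//.
have -> : p%:R * (`|x| * `|y|) = \sum_(i < p) `|x| * `|y|.
  by rewrite sumr_const card_ord mulr_natl.
by apply: ler_sum => i _; rewrite normrM ler_pM// norm_coord_le.
Qed.

Lemma measurable_dotp d (T : measurableType d) (f g : T -> 'rV[R]_p) :
  measurable_fun setT f -> measurable_fun setT g ->
  measurable_fun setT (fun t => dotp (f t) (g t)).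
Proof.
move=> mf mg; apply: measurable_sum => i; apply: measurable_funM.
- exact: measurableT_comp (measurable_coord i) mf.
- exact: measurableT_comp (measurable_coord i) mg.
Qed.

End dot_product.

(** * Lebesgue measure on R^p: hyperplanes and reflection *)

Section lebesgue_rV_lemmas.
Context {R : realType}.

Lemma cons_rVE n (x : measurableTypeR R * 'rV[R]_n) :
  (cons_rV x ord0 ord0 = x.1) * (forall i, cons_rV x ord0 (lift ord0 i) = x.2 ord0 i).
Proof.
split; first by have /(congr1 fst) := cons_rVK x.
move=> i; transitivity ((uncons_rV (cons_rV x)).2 ord0 i); last by rewrite cons_rVK.
rewrite /uncons_rV; move: (cons_rV x) => v /=; rewrite mxE.
by rewrite (_ : lift ord0 i = rshift 1 i)//; exact/val_inj.
Qed.

Lemma dotp_cons_rV n (x : measurableTypeR R * 'rV[R]_n) (b : 'rV[R]_n.+1) :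
  dotp (cons_rV x) b = x.1 * b ord0 ord0 + dotp x.2 (\row_i b ord0 (lift ord0 i)).
Proof.
rewrite /dotp big_ord_recl !cons_rVE; congr (_ + _).
by apply: eq_bigr => i _; rewrite cons_rVE mxE.
Qed.

(** Induction on the dimension, splitting off the first coordinate. If the rest [b'] of the normal
    vector is nonzero, every section at a fixed first coordinate is a hyperplane of lower dimension;
    if it is zero, the set is a single first coordinate times the whole space, and the null factor
    annihilates the product. *)
Lemma lebesgue_rV_hyperplane p (b : 'rV[R]_p) (s : R) : b != 0 ->
  lebesgue_rV R p [set v | dotp v b = s] = 0%E.
Proof.
elim: p => [|n IHn] in b s * => b0.
  by move: b0; rewrite [b]thinmx0 eqxx.
rewrite /= /lebesgue_step /pushforward.
set b' := \row_i b ord0 (lift ord0 i).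
have mS : measurable ((@cons_rV R n) @^-1` [set v | dotp v b = s]).
  apply: measurable_preimage; first exact: measurable_cons_rV.
  apply: (@measurable_preimage _ _ _ _ (fun v => dotp v b) [set s]) => //.
  exact: measurable_dotp.
have [b'0|b'0] := eqVneq b' 0; last first.
  rewrite /product_measure1 integral0_eq// => x _ /=.
  rewrite -[RHS](IHn b' (s - x * b ord0 ord0) b'0); congr (lebesgue_rV R n _).
  apply/seteqP; split => y; rewrite /xsection/= inE/= dotp_cons_rV/=.
    by move=> <-; rewrite addrC addKr.
  by move=> ->; rewrite addrC subrK.
have b00 : b ord0 ord0 != 0.
  apply: contra b0 => /eqP b00; apply/eqP/rowP => i; rewrite mxE.
  case: (unliftP ord0 i) => [j ->|->//].
  by move/rowP : b'0 => /(_ j); rewrite !mxE.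
rewrite (_ : _ @^-1` _ = [set s / b ord0 ord0] `*` setT); last first.
  apply/seteqP; split => -[x y]/=; rewrite dotp_cons_rV/= -/b' b'0.
    rewrite dotpC (_ : dotp 0 y = 0) ?addr0; last first.
      by rewrite /dotp big1// => i _; rewrite mxE mul0r.
    by move=> <-; rewrite mulfK.
  move=> [-> _]; rewrite divfK// dotpC (_ : dotp 0 y = 0) ?addr0//.
  by rewrite /dotp big1// => i _; rewrite mxE mul0r.
rewrite product_measure1E//.
by rewrite [X in (X * _)%E](lebesgue_measure_set1 (s / b ord0 ord0)) mul0e.
Qed.

Lemma measurable_oppV p : measurable_fun setT (-%R : 'rV[R]_p -> 'rV[R]_p).
Proof.
apply: measurable_fun_rV => i; under eq_fun do rewrite mxE.
by apply: measurable_funN; exact: measurable_coord.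
Qed.

(** By induction, the image of the product measure under reflection has the right values on
    rectangles, which determine a product of sigma-finite measures. *)
Lemma lebesgue_rVN p (A : set 'rV[R]_p) : measurable A ->
  lebesgue_rV R p (-%R @^-1` A) = lebesgue_rV R p A.
Proof.
elim: p => [|n IHn] in A * => mA.
  rewrite /= !diracE (_ : (_ \in -%R @^-1` A) = (0 \in A))//.
  by apply/idP/idP; rewrite !inE/= oppr0.
rewrite /= /lebesgue_step /pushforward.
pose phi (x : measurableTypeR R * 'rV[R]_n) : measurableTypeR R * 'rV[R]_n := (- x.1, - x.2).
have mphi : measurable_fun setT phi.
  apply/measurable_fun_pairP; split.
    rewrite [X in measurable_fun _ X](_ : _ = -%R \o fst)//.
    by apply: measurableT_comp; [exact: oppr_measurable|exact: measurable_fst].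
  rewrite [X in measurable_fun _ X](_ : _ = -%R \o snd)//.
  by apply: measurableT_comp; [exact: measurable_oppV|exact: measurable_snd].
set B := @cons_rV R n @^-1` A.
have mB : measurable B by apply: measurable_preimage => //; exact: measurable_cons_rV.
have -> : @cons_rV R n @^-1` (-%R @^-1` A) = phi @^-1` B.
  apply/seteqP; split => x; rewrite /B/= (_ : - cons_rV x = cons_rV (phi x))//.
  - apply/rowP => i; case: (unliftP ord0 i) => [j ->|->]; by rewrite mxE !cons_rVE//= mxE.
  - apply/rowP => i; case: (unliftP ord0 i) => [j ->|->]; by rewrite mxE !cons_rVE//= mxE.
pose phim : {mfun _ >-> _} := HB.pack phi (isMeasurableFun.Build _ _ _ _ _ mphi).
symmetry; apply: (product_measure_unique (m' := [the measure _ _ of pushforward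
  (@lebesgue_measure R \x lebesgue_rV R n)%E phim])) => // A1 A2 mA1 mA2.
  rewrite /= /pushforward (_ : phi @^-1` (A1 `*` A2) = (-%R @^-1` A1) `*` (-%R @^-1` A2))//.
  rewrite product_measure1E//; last 2 first.
  - by apply: measurable_preimage => //; exact: oppr_measurable.
  - by apply: measurable_preimage => //; exact: measurable_oppV.
  by congr (_ * _)%E; [exact: (lebesgue_measureN mA1)|exact: IHn].
Qed.

Lemma ge0_integral_rVN p (f : 'rV[R]_p -> \bar R) : measurable_fun setT f ->
  (forall x, 0 <= f x)%E ->
  (\int[lebesgue_rV R p]_x f (- x)%R = \int[lebesgue_rV R p]_x f x)%E.
Proof.
move=> mf f0.
rewrite -[LHS]/(\int[lebesgue_rV R p]_(x in -%R @^-1` setT) (f \o -%R) x)%E.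
rewrite -(ge0_integral_pushforward (@measurable_oppV p))//=.
by apply: eq_measure_integral => [|? A mA _]; [exact: measurable_oppV|exact: lebesgue_rVN].
Qed.

(** Reflection exchanges the positive and negative parts, so both have the same integral [a], and
    [fine (a - a)] is [0] even for infinite [a]. *)
Lemma integral_odd_eq0 p (f : 'rV[R]_p -> R) : measurable_fun setT f ->
  (forall x, f (- x) = - f x) -> \int[lebesgue_rV R p]_x f x = 0.
Proof.
move=> mf fN; rewrite /Rintegral integralE.
have mEf : measurable_fun setT (EFin \o f) by exact/measurable_EFinP.
rewrite -(ge0_integral_rVN (f := ((EFin \o f)^\-)%E))//; last exact: measurable_funeneg.
have -> : (fun x => ((EFin \o f)^\- (- x)%R)%E) = ((EFin \o f)^\+)%E.
  by apply/funext => x; rewrite funenegE funeposE/= fN opprK.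
set a := integral _ _ _.
by case: a => [r| |]//=; rewrite subrr.
Qed.

End lebesgue_rV_lemmas.

(** * Uniform permutations and a two-sample combinatorial central limit theorem *)

Section perm_average.
Context {R : realType} {I : finType}.
Implicit Types (F G : {perm I} -> R).

Definition perm_avg F : R := (#|{perm I}|%:R)^-1 * \sum_s F s.

Let cardR0 : #|{perm I}|%:R != 0 :> R.
Proof. by rewrite pnatr_eq0 -lt0n; apply/card_gt0P; exists 1%g. Qed.

Lemma perm_avg_cst c : perm_avg (fun=> c) = c.
Proof. by rewrite /perm_avg sumr_const -(mulr_natl c) mulKf. Qed.

Lemma perm_avgD F G : perm_avg (fun s => F s + G s) = perm_avg F + perm_avg G.
Proof. by rewrite /perm_avg big_split/= mulrDr. Qed.

Lemma perm_avgZ c F : perm_avg (fun s => c * F s) = c * perm_avg F.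
Proof. by rewrite /perm_avg -mulr_sumr mulrCA. Qed.

Lemma perm_avgB F G : perm_avg (fun s => F s - G s) = perm_avg F - perm_avg G.
Proof. by rewrite /perm_avg sumrB mulrBr. Qed.

Lemma le_perm_avg F G : (forall s, F s <= G s) -> perm_avg F <= perm_avg G.
Proof. by move=> FG; rewrite ler_wpM2l ?invr_ge0// ler_sum. Qed.

Lemma ler_norm_perm_avg F : `|perm_avg F| <= perm_avg (fun s => `|F s|).
Proof.
by rewrite normrM ger0_norm ?invr_ge0// ler_wpM2l ?invr_ge0// ler_norm_sum.
Qed.

Lemma eq_perm_avg F G : F =1 G -> perm_avg F = perm_avg G.
Proof. by move=> FG; congr (_ * _); exact: eq_bigr. Qed.

End perm_average.

(** The error in [perm_clt], for values bounded by [B] and [k] the inverse of the scale. The term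
    [4 * B ^+ 3] comes from the Taylor remainder, the others from the fluctuation of the conditional
    variance. For fixed [B] it vanishes with [k]. *)
Definition clt_error (R : realType) (B k : R) : R :=
  k * ((1 + B ^+ 4 / 2) / 4 + B * (1 + 2 * B ^+ 2) / 2 + k * (2 * B ^+ 2) + 4 * B ^+ 3).

Section two_sample_permutation.
Context (R : realType) (n m : nat).
Hypotheses (n0 : (0 < n)%N) (m0 : (0 < m)%N).
Local Notation I := ('I_n + 'I_m)%type.
Local Notation N := (n + m)%N.
Implicit Types (s : {perm I}) (v : I -> R).

Definition two_sample_scale : R := Num.sqrt ((n * m)%:R / N%:R).
Local Notation k := two_sample_scale.

Definition mean_diff v : R :=
  k * (n%:R^-1 * \sum_i v (inl i) - m%:R^-1 * \sum_j v (inr j)).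

Local Notation T v s := (mean_diff (v \o (s : {perm I}))).

(** The factor by which an exchange of one value of each sample moves the statistic; by [sqr_kap]
    the squares of the [n * m] possible moves add up to order [N]. *)
Let swap_step : R := k * (n%:R^-1 + m%:R^-1).
Local Notation kap := swap_step.

Let D v s (ij : 'I_n * 'I_m) := kap * (v (s (inr ij.2)) - v (s (inl ij.1))).

Let nR0 : n%:R != 0 :> R. Proof. by rewrite pnatr_eq0 -lt0n. Qed.
Let mR0 : m%:R != 0 :> R. Proof. by rewrite pnatr_eq0 -lt0n. Qed.
Let NR0 : N%:R != 0 :> R. Proof. by rewrite pnatr_eq0 -lt0n addn_gt0 n0. Qed.
Let NRE : n%:R + m%:R != 0 :> R. Proof. by rewrite -natrD. Qed.

Lemma two_sample_scale_gt0 : 0 < k.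
Proof. by rewrite sqrtr_gt0 divr_gt0// ltr0n ?muln_gt0 ?addn_gt0 n0. Qed.

Let kV_ge0 : 0 <= k^-1.
Proof. by rewrite invr_ge0 ltW ?two_sample_scale_gt0. Qed.

Lemma sqr_two_sample_scale : k ^+ 2 = (n * m)%:R / N%:R.
Proof. by rewrite sqr_sqrtr// divr_ge0. Qed.

Let kap_ge0 : 0 <= kap.
Proof. by rewrite mulr_ge0 ?addr_ge0 ?invr_ge0// ltW// two_sample_scale_gt0. Qed.

Let sqr_kap : (n * m)%:R * kap ^+ 2 = N%:R.
Proof.
rewrite /kap exprMn sqr_two_sample_scale natrM natrD; field.
by rewrite nR0 mR0.
Qed.

Let kapE : kap = k^-1.
Proof.
have k0 : k != 0 by rewrite gt_eqF ?two_sample_scale_gt0.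
apply: (mulfI k0); rewrite divff// /kap mulrA -expr2 sqr_two_sample_scale.
by rewrite natrM natrD; field; rewrite NRE nR0 mR0.
Qed.

Let swap (ij : 'I_n * 'I_m) : {perm I} := tperm (inl ij.1) (inr ij.2).

Let swapL ij i : swap ij (inl i) = if i == ij.1 then inr ij.2 else inl i.
Proof.
rewrite /swap; case: eqP => [->|/eqP ne]; first by rewrite tpermL.
by rewrite tpermD// eq_sym.
Qed.

Let swapR ij j : swap ij (inr j) = if j == ij.2 then inl ij.1 else inr j.
Proof.
rewrite /swap; case: eqP => [->|/eqP ne]; first by rewrite tpermR.
by rewrite tpermD// eq_sym.
Qed.

Let T_swap v s ij : T v (swap ij * s)%g = T v s + D v s ij.
Proof.
rewrite /mean_diff /D /=.
under eq_bigr do rewrite permM swapL.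
under [in X in _ - X]eq_bigr do rewrite permM swapR.
rewrite (bigD1 ij.1)//= eqxx (bigD1 ij.2)//= eqxx.
rewrite [in RHS](bigD1 ij.1)//= [in X in _ = _ * (_ - _ * X) + _](bigD1 ij.2)//=.
under eq_bigr => i /negbTE ni do rewrite ni.
under [in X in _ - X]eq_bigr => i /negbTE ni do rewrite ni.
rewrite /kap; ring.
Qed.

Let D_swap v s ij : D v (swap ij * s)%g ij = - D v s ij.
Proof. by rewrite /D !permM swapL swapR !eqxx -mulrN opprB. Qed.

(** Summed over all exchanges, the increments pull the statistic back towards zero: this is the
    linear regression condition of Stein's method. *)
Let sumD v s : \sum_ij D v s ij = - N%:R * T v s.
Proof.
rewrite -(pair_big xpredT xpredT (fun i j => D v s (i, j)))/= /D/=.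
under eq_bigr do rewrite -mulr_sumr sumrB sumr_const card_ord.
rewrite -mulr_sumr sumrB sumr_const card_ord /mean_diff/= /kap.
rewrite natrD -[in X in _ * X]mulr_natl.
have -> : \sum_(i < n) v (s (inl i)) *+ m = m%:R * \sum_(i < n) v (s (inl i)).
  by rewrite mulr_sumr; apply: eq_bigr => i _; rewrite mulr_natl.
move: nR0 mR0 => n' m'.
by field; rewrite n' m'.
Qed.

(* Exchangeable pairs: composing [s] with a transposition of the two samples preserves the
   uniform law of [s], adds [D v s ij] to [T v s], and changes the sign of [D v s ij]; the
   average of [D v s ij] over [ij] is proportional to [T v s]. *)
Lemma perm_stein v (h : R -> R) :
  perm_avg (fun s => T v s * h (T v s)) =
  (2 * N%:R)^-1 *
  perm_avg (fun s => \sum_ij D v s ij * (h (T v s + D v s ij) - h (T v s))).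
Proof.
rewrite /perm_avg mulrCA; congr (_ * _).
rewrite exchange_big/=.
have E ij : \sum_s D v s ij * (h (T v s + D v s ij) - h (T v s)) =
    - 2 * \sum_s D v s ij * h (T v s).
  (* Left translation by the transposition is a bijection under which [D] changes sign and [T]
     becomes [T + D]. *)
  have : \sum_s D v s ij * h (T v s) = - \sum_s D v s ij * h (T v s + D v s ij).
    rewrite (reindex_inj (mulgI (swap ij)))/= -sumrN.
    by apply: eq_bigr => s _; rewrite D_swap T_swap mulNr.
  move=> AB; under eq_bigr do rewrite mulrBr.
  rewrite sumrB; move: AB; set B := \sum_s _ * h (_ + _); set A := \sum_s _.
  by move=> AB; rewrite AB; ring.
under [in RHS]eq_bigr do rewrite E.
rewrite -mulr_sumr exchange_big/=.
under [in RHS]eq_bigr do rewrite -mulr_suml sumD.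
rewrite !mulr_sumr; apply: eq_bigr => s _.
by move: NR0 => N'; field.
Qed.

(** Stein's identity with [h] the identity leaves the mean of the squares of [D]. Each of the
    [n * m] squares is at most [kap ^+ 2 * B ^+ 2], and [n * m * kap ^+ 2 = N] against the prefactor
    [1 / (2 N)] leaves one half. *)
Lemma perm_avg_sqr_le v (B : R) : (forall a b, `|v a - v b| <= B) ->
  perm_avg (fun s => T v s ^+ 2) <= B ^+ 2 / 2.
Proof.
move=> vB; rewrite (eq_perm_avg (G := fun s => T v s * id (T v s)))//.
rewrite (perm_stein v id) -(@perm_avg_cst R I (B ^+ 2 / 2)) -perm_avgZ; apply: le_perm_avg => s.
rewrite ler_pdivrMl ?mulr_gt0 ?ltr0n ?addn_gt0 ?n0//.
have -> : 2 * N%:R * (B ^+ 2 / 2) = \sum_(ij : 'I_n * 'I_m) kap ^+ 2 * B ^+ 2.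
  by rewrite sumr_const card_prod !card_ord -[RHS]mulr_natl [RHS]mulrA sqr_kap; field.
apply: ler_sum => ij _; rewrite addrAC subrr add0r -expr2 /D exprMn.
rewrite ler_wpM2l ?sqr_ge0// -real_normK ?num_real//.
by rewrite ler_pXn2r ?nnegrE// (le_trans _ (vB (s (inr ij.2)) (s (inl ij.1)))).
Qed.

Definition avg v : R := N%:R^-1 * \sum_a v a.

Let M1 v s := n%:R^-1 * \sum_i v ((s : {perm I}) (inl i)).
Let M2 v s := m%:R^-1 * \sum_j v ((s : {perm I}) (inr j)).

Let avg_split v s : avg v = N%:R^-1 * (n%:R * M1 v s + m%:R * M2 v s).
Proof.
rewrite /avg /M1 /M2 !mulVKf//; congr (_ * _).
rewrite (reindex_inj (@perm_inj _ s))/=.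
by rewrite big_sumType.
Qed.

(** The second-order term of Stein's identity, which takes the place of the variance; [W_le] shows
    that it is close to the variance of [v] over all labels. *)
Let W v s := (2 * N%:R)^-1 * \sum_ij D v s ij ^+ 2.

Let WE v s : W v s = (M1 (fun a => v a ^+ 2) s + M2 (fun a => v a ^+ 2) s) / 2 -
  M1 v s * M2 v s.
Proof.
rewrite /W.
have -> : \sum_ij D v s ij ^+ 2 = kap ^+ 2 *
    (n%:R * m%:R * (M1 (fun a => v a ^+ 2) s + M2 (fun a => v a ^+ 2) s
      - 2 * (M1 v s * M2 v s))).
  rewrite -(pair_big xpredT xpredT (fun i j => D v s (i, j) ^+ 2))/= /D/=.
  set a := fun i => v (s (inl i)); set b := fun j => v (s (inr j)).
  transitivity (kap ^+ 2 * \sum_i (\sum_j b j ^+ 2 + (- 2 * a i) * \sum_j b j +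
      m%:R * a i ^+ 2)).
    rewrite mulr_sumr; apply: eq_bigr => i _.
    have -> : m%:R * a i ^+ 2 = \sum_(j < m) a i ^+ 2.
      by rewrite sumr_const card_ord mulr_natl.
    rewrite (mulr_sumr _ _ _ (- 2 * a i)) -!big_split mulr_sumr/=.
    by apply: eq_bigr => j _; rewrite /a /b; ring.
  rewrite !big_split/= sumr_const card_ord -mulr_suml -!mulr_sumr.
  rewrite -(mulr_natl (\sum_j _)) /M1 /M2 -/a -/b; congr (_ * _).
  by move: nR0 mR0 => n' m'; field; rewrite n' m'.
have := sqr_kap; rewrite natrM => e.
have -> : kap ^+ 2 = N%:R / (n%:R * m%:R).
  by rewrite -e mulrAC divff ?mul1r// mulf_neq0.
by rewrite natrD; move: nR0 mR0 NRE => n' m' N'; field; rewrite n' m' N'.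
Qed.

Let avg_norm u (B : R) : (forall a, `|u a| <= B) -> `|avg u| <= B.
Proof.
move=> uB; rewrite /avg normrM ger0_norm ?invr_ge0// ler_pdivrMl ?ltr0n ?addn_gt0 ?n0//.
rewrite (le_trans (ler_norm_sum _ _ _))//.
rewrite (le_trans (ler_sum _ (fun a _ => uB a)))// sumr_const card_sum !card_ord.
by rewrite mulr_natl.
Qed.

(** The pooled mean is the weighted mean of the two sample means, and the difference of these is
    [T / k]; hence the deviation of [W] from the variance carries a factor [k^-1]. *)
Let W_avg v s : W v s - (avg (fun a => v a ^+ 2) - avg v ^+ 2) =
  k^-1 * ((m%:R - n%:R) / N%:R * (T (fun a => v a ^+ 2) s / 2 - avg v * T v s)
          + k^-1 * (m%:R * n%:R / N%:R ^+ 2 * T v s ^+ 2)).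
Proof.
have k0 : k != 0 by rewrite gt_eqF ?two_sample_scale_gt0.
have TE u : T u s = k * (M1 u s - M2 u s) by [].
rewrite WE !(avg_split _ s) !TE natrD.
move: NRE => N'; by field; rewrite N' k0.
Qed.

Let abs_le_sqr (x : R) : `|x| <= (1 + x ^+ 2) / 2.
Proof. by have := sqr_ge0 (`|x| - 1); rewrite sqrrB1 real_normK ?num_real//; lra. Qed.

(** By [abs_le_sqr], first absolute moments are replaced by second moments, which [perm_avg_sqr_le]
    controls. *)
Let W_le v s (B : R) : (forall a, `|v a| <= B) ->
  `|W v s - (avg (fun a => v a ^+ 2) - avg v ^+ 2)| <=
  k^-1 * ((1 + T (fun a => v a ^+ 2) s ^+ 2) / 4 + B * ((1 + T v s ^+ 2) / 2)
          + k^-1 * T v s ^+ 2).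
Proof.
move=> vB; have k0 := two_sample_scale_gt0.
have B0 : 0 <= B by rewrite (le_trans _ (vB (inl (Ordinal n0)))).
rewrite W_avg normrM (gtr0_norm (x := k^-1)) ?invr_gt0// ler_wpM2l ?kV_ge0//.
have N0 : 0 < N%:R :> R by rewrite ltr0n addn_gt0 n0.
rewrite (le_trans (ler_normD _ _))// lerD//.
  rewrite normrM -[leRHS]mul1r ler_pM//.
    rewrite normrM normfV (gtr0_norm N0) ler_pdivrMr// mul1r natrD.
    rewrite (le_trans (ler_normB _ _))// !ger0_norm//.
    by rewrite addrC.
  rewrite (le_trans (ler_normB _ _))// lerD//.
    rewrite normrM [X in _ * X]ger0_norm//.
    by have := abs_le_sqr (T (fun a => v a ^+ 2) s); lra.
  by rewrite normrM ler_pM// avg_norm.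
rewrite normrM (gtr0_norm (x := k^-1)) ?invr_gt0// ler_wpM2l ?kV_ge0//.
rewrite normrM [X in _ * X]ger0_norm ?sqr_ge0// -[leRHS]mul1r ler_wpM2r ?sqr_ge0//.
rewrite ger0_norm ?divr_ge0 ?mulr_ge0 ?sqr_ge0// ler_pdivrMr ?exprn_gt0// mul1r.
rewrite expr2 ler_pM// ler_nat ?leq_addl ?leq_addr//.
Qed.

Let c1 (B : R) : R := (1 + B ^+ 4 / 2) / 4 + B * (1 + 2 * B ^+ 2) / 2.

(** The values of [v] and of its square oscillate by at most [2 * B] and [B ^+ 2], so
    [perm_avg_sqr_le] bounds the mean squares of their statistics by [2 * B ^+ 2] and
    [B ^+ 4 / 2]. *)
Let avg_W_le v (B : R) : (forall a, `|v a| <= B) ->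
  perm_avg (fun s => `|W v s - (avg (fun a => v a ^+ 2) - avg v ^+ 2)|) <=
  k^-1 * (c1 B + k^-1 * (2 * B ^+ 2)).
Proof.
move=> vB; have k0 := two_sample_scale_gt0.
have B0 : 0 <= B by rewrite (le_trans _ (vB (inl (Ordinal n0)))).
rewrite (le_trans (le_perm_avg (fun s => W_le s vB)))//.
rewrite perm_avgZ ler_wpM2l ?kV_ge0// perm_avgD perm_avgZ lerD//; last first.
  rewrite ler_wpM2l ?kV_ge0//.
  have := @perm_avg_sqr_le v (2 * B); rewrite exprMn => h.
  rewrite (le_trans (h _))//; last by lra.
  move=> a b; rewrite (le_trans (ler_normB _ _))//.
  by have := vB a; have := vB b; lra.
rewrite perm_avgD lerD//.
  rewrite (eq_perm_avg (G := fun s => 4^-1 * (1 + T (fun a => v a ^+ 2) s ^+ 2))); last first.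
    by move=> s; rewrite mulrC.
  rewrite perm_avgZ perm_avgD perm_avg_cst.
  have := @perm_avg_sqr_le (fun a => v a ^+ 2) (B ^+ 2) => h.
  have {h} : perm_avg (fun s => T (fun a => v a ^+ 2) s ^+ 2) <= (B ^+ 2) ^+ 2 / 2.
    apply: h => a b.
    have sq c : 0 <= v c ^+ 2 <= B ^+ 2.
      rewrite sqr_ge0/= -real_normK ?num_real//.
      by rewrite ler_pXn2r ?nnegrE.
    rewrite ler_norml; have /andP[? ?] := sq a; have /andP[? ?] := sq b.
    by apply/andP; split; lra.
  by rewrite -exprM; lra.
rewrite perm_avgZ -mulrA ler_wpM2l//.
rewrite (eq_perm_avg (G := fun s => 2^-1 * (1 + T v s ^+ 2))); last first.
  by move=> s; rewrite mulrC.
rewrite perm_avgZ perm_avgD perm_avg_cst.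
have := @perm_avg_sqr_le v (2 * B); rewrite exprMn => h.
have {h} : perm_avg (fun s => T v s ^+ 2) <= 2 ^+ 2 * B ^+ 2 / 2.
  apply: h => a b; rewrite (le_trans (ler_normB _ _))//.
  by have := vB a; have := vB b; lra.
lra.
Qed.

(** By Stein's identity for the sine, the mean [psi x] of [cos (x * T)] satisfies
    [psi' = - x * S2 * psi] on [[0, 1]] up to an error [eta]. After multiplication by the
    integrating factor [expR (x ^+ 2 * S2 / 2)], comparing the values at [0] and [1] gives the
    Gaussian value with the same error. *)
Lemma perm_clt v (B : R) : (forall a, `|v a| <= B) ->
  `|perm_avg (fun s => cos (T v s)) -
    expR (- ((avg (fun a => v a ^+ 2) - avg v ^+ 2) / 2))| <=
  clt_error B k^-1.
Proof.
move=> vB; have k0 := two_sample_scale_gt0.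
have B0 : 0 <= B by rewrite (le_trans _ (vB (inl (Ordinal n0)))).
set S2 := avg _ - _; set eta := clt_error B _.
pose psi (x : R) := perm_avg (fun s => cos (x * T v s)).
pose dpsi (x : R) := - perm_avg (fun s => T v s * sin (x * T v s)).
have psiE (x : R) : is_derive x 1 psi (dpsi x).
  rewrite /psi /dpsi /perm_avg -mulrN -sumrN.
  apply: is_derive_eq.
    apply: is_derive_cstM.
    apply: (@is_derive_bigsum _ _ _ _ (fun s x => - T v s * sin (x * T v s))) => s.
    by apply: is_derive_eq; rewrite /GRing.scale/=; ring.
  congr (_ * _).
  by apply: eq_bigr => s _; rewrite mulNr.
have dpsi_le x : 0 <= x <= 1 -> `|dpsi x + x * S2 * psi x| <= eta.
  move=> /andP[x0 x1].
  (* The Taylor remainder of the sine along the increments; the first-order term turns into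
     [x * cos (x * T) * W]. *)
  pose E1 s := (2 * N%:R)^-1 * \sum_ij D v s ij *
    (sin (x * (T v s + D v s ij)) - sin (x * T v s) - x * D v s ij * cos (x * T v s)).
  have -> : dpsi x + x * S2 * psi x =
      - (perm_avg E1 + x * perm_avg (fun s => (W v s - S2) * cos (x * T v s))).
    rewrite /dpsi (perm_stein v (fun y => sin (x * y))) -perm_avgZ -!perm_avgZ.
    rewrite -perm_avgD -[LHS]opprK opprD opprK -perm_avgB; congr (- _).
    apply: eq_perm_avg => s; rewrite /E1 /W.
    have -> : \sum_ij D v s ij * (sin (x * (T v s + D v s ij)) - sin (x * T v s)) =
      \sum_ij D v s ij * (sin (x * (T v s + D v s ij)) - sin (x * T v s)
          - x * D v s ij * cos (x * T v s)) +
      x * cos (x * T v s) * \sum_ij D v s ij ^+ 2.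
      by rewrite mulr_sumr -big_split/=; apply: eq_bigr => ij _; ring.
    ring.
  rewrite normrN (le_trans (ler_normD _ _))//.
  have -> : eta = k^-1 * (4 * B ^+ 3) + k^-1 * (c1 B + k^-1 * (2 * B ^+ 2)).
    by rewrite /eta /clt_error /c1; ring.
  rewrite lerD//; last first.
    rewrite normrM ger0_norm// -[leRHS]mul1r ler_pM//.
    rewrite (le_trans (ler_norm_perm_avg _))// (le_trans _ (avg_W_le vB))//.
    apply: le_perm_avg => s; rewrite normrM -[leRHS]mulr1 ler_wpM2l//.
    exact: norm_cos_le1.
  rewrite (le_trans (ler_norm_perm_avg _))// -[leRHS](@perm_avg_cst R I).
  apply: le_perm_avg => s; rewrite /E1 normrM ger0_norm ?invr_ge0//.
  rewrite ler_pdivrMl ?mulr_gt0 ?ltr0n ?addn_gt0 ?n0//.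
  rewrite (le_trans (ler_norm_sum _ _ _))//.
  (* Every increment is at most [kap * (2 * B)]; with [n * m * kap ^+ 2 = N] and [kap = k^-1] the
     cubes add up to this constant. *)
  have -> : 2 * N%:R * (k^-1 * (4 * B ^+ 3)) =
      \sum_(ij : 'I_n * 'I_m) (kap * (2 * B)) ^+ 3.
    rewrite sumr_const card_prod !card_ord -[RHS]mulr_natl -sqr_kap -kapE; ring.
  apply: ler_sum => ij _; rewrite normrM exprS.
  have DB : `|D v s ij| <= kap * (2 * B).
    rewrite /D normrM ger0_norm// ler_wpM2l// (le_trans (ler_normB _ _))//.
    by have := vB (s (inr ij.2)); have := vB (s (inl ij.1)); lra.
  rewrite ler_pM// mulrDr (le_trans (sin_taylor1 _ _))//.
  rewrite exprMn -[leRHS]mul1r ler_pM ?sqr_ge0 ?expr_le1//.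
  rewrite -real_normK ?num_real// ler_pXn2r ?nnegrE//.
  by rewrite (le_trans _ DB).
(* [S2] is a variance; its sign bounds the integrating factor on [[0, 1]] by its value at [1]. *)
have S20 : 0 <= S2.
  have -> : S2 = avg (fun a => (v a - avg v) ^+ 2).
    rewrite /S2 /avg; under [in RHS]eq_bigr do rewrite sqrrB.
    rewrite big_split sumrB/= sumr_const card_sum !card_ord sumrMnl -mulr_suml.
    by rewrite -mulr_natl; move: NR0 => N'; field.
  by rewrite mulr_ge0 ?invr_ge0 ?sumr_ge0// => a _; rewrite sqr_ge0.
pose G (x : R) := psi x * expR (x ^+ 2 * S2 / 2).
pose dG (x : R) := (dpsi x + x * S2 * psi x) * expR (x ^+ 2 * S2 / 2).
have GE (x : R) : is_derive x 1 G (dG x).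
  have H : is_derive x 1 (fun x => expR (x ^+ 2 * S2 / 2)) (expR (x ^+ 2 * S2 / 2) * (x * S2)).
    by apply: is_derive_eq; rewrite /GRing.scale/=; field.
  apply: (is_derive_eq (is_derive_mulf (psiE x) H)).
  by rewrite /dG /GRing.scale/=; ring.
have eta0 : 0 <= eta.
  by rewrite (le_trans _ (dpsi_le 0 _))// lexx ler01.
have := @derive_le_norm R G dG 0 1 (eta * expR (S2 / 2)) GE ler01.
rewrite subr0 mulr1 => /(_ _)/wrap[x /andP[x0 x1]|].
  rewrite /dG normrM [X in _ * X]ger0_norm ?expR_ge0// ler_pM ?expR_ge0 ?dpsi_le ?x0//.
  rewrite ler_expR ler_wpM2r ?invr_ge0// -[leRHS]mul1r ler_wpM2r// expr_le1//.
rewrite /G expr1n mul1r expr0n !mul0r expR0 mulr1 /psi.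
under [X in `|X * _ - _|]eq_perm_avg do rewrite mul1r.
under [X in `|_ - X|]eq_perm_avg do rewrite mul0r cos0.
rewrite perm_avg_cst => h.
rewrite -(ler_pM2r (expR_gt0 (S2 / 2))) -{1}[expR (S2 / 2)]ger0_norm ?expR_ge0//.
by rewrite -normrM mulrBl -expRD addNr expR0.
Qed.

End two_sample_permutation.

(** * Exchangeability and the law of the ranks *)

Lemma measurable_lower_orthant (R : realType) (p : nat) (x : 'rV[R]_p) :
  measurable [set y : 'rV[R]_p | forall j, y ord0 j <= x ord0 j].
Proof.
rewrite (_ : [set _ | _] = \bigcap_j ((fun y : 'rV[R]_p => y ord0 j) @^-1` `]-oo, x ord0 j])).
  apply: fin_bigcap_measurable => // j _.
  by apply: measurable_preimage => //; exact: measurable_coord.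
apply/seteqP; split => y /= h j; first by move=> _ /=; rewrite in_itv/=.
by have := h j Logic.I; rewrite /= in_itv.
Qed.

Section exchangeable_ranks.
Context (R : realType) (p : nat) (d : measure_display) (Omega : measurableType d)
  (P : probability Omega R) (I : finType) (Z : I -> Omega -> 'rV[R]_p).
Local Notation V := 'rV[R]_p.
Hypothesis mZ : forall i, measurable_fun setT (Z i).
Hypothesis indepZ : mutually_independent P Z.

(** The hypothesis on [S] expresses that it is a function of the variables other than [Z i0], as
    measurability for every sigma-algebra generated by a class that contains their events. As
    functions of the event of [S], both sides are finite measures; they agree on the intersections
    of such events, a class stable under intersection. *)
Lemma indep_from_others (i0 : I) (S : Omega -> R) (A : set V) (B : set (measurableTypeR R)) :
  (forall G : set (set Omega),
    (forall i C, i != i0 -> measurable C -> G (Z i @^-1` C)) ->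
    measurable_fun (T := g_sigma_algebraType G) setT S) ->
  measurable A -> measurable B ->
  P (Z i0 @^-1` A `&` S @^-1` B) = (P (Z i0 @^-1` A) * P (S @^-1` B))%E.
Proof.
move=> mS mA mB.
pose G : set (set Omega) := [set E | exists C : I -> set V,
  [/\ forall i, measurable (C i), C i0 = setT & E = \bigcap_i (Z i @^-1` C i)]].
have mC i C : measurable C -> measurable (Z i @^-1` C).
  exact: measurable_preimage.
have GM : G `<=` measurable.
  move=> E [C [mCi _ ->]]; apply: fin_bigcap_measurable => // i _.
  exact: mC.
have G1 i C : i != i0 -> measurable C -> G (Z i @^-1` C).
  move=> ii0 mC'; exists (fun j => if j == i then C else setT); split.
  - by move=> j; case: ifP.
  - by rewrite eq_sym (negbTE ii0).
  - apply/seteqP; split => om /= h.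
      by move=> j _ /=; case: eqP => [->|].
    by have := h i Logic.I; rewrite /= eqxx.
have SB : <<s G >> (S @^-1` B).
  have := mS G G1 measurableT B mB; rewrite setTI; exact.
pose q : {nonneg R} := NngNum (fine_ge0 (measure_ge0 P (Z i0 @^-1` A))).
have qE : q%:num%:E = P (Z i0 @^-1` A) by rewrite fineK// fin_num_measure//; exact: mC.
rewrite -qE setIC.
apply: (g_sigma_algebra_measure_unique G GM (fun=> setT) _ _
  (mrestr P (mC i0 A mA)) (mscale q P) _ _ _ _ SB).
- move=> _; exists (fun=> setT); split => //.
  by apply/seteqP; split.
- by rewrite bigcup_const.
- move=> E F [C [mC1 C1 ->]] [C' [mC' C1' ->]]; exists (fun i => C i `&` C' i); split.
  + by move=> i; exact: measurableI.
  + by rewrite C1 C1' setTI.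
  + by rewrite -bigcapI.
- move=> E [C [mCi Ci0 ->]]; rewrite -[RHS]/((q%:num)%:E * P _)%E qE /= /mrestr.
  pose C' j := if j == i0 then A else C j.
  have -> : \bigcap_i (Z i @^-1` C i) `&` Z i0 @^-1` A = \bigcap_i (Z i @^-1` C' i).
    apply/seteqP; split => om /= h.
      by move=> j _ /=; rewrite /C'; case: eqP => [->|_]; [exact: h.2|exact: h.1].
    split; last by have := h i0 Logic.I; rewrite /= /C' eqxx.
    move=> j _ /=; have := h j Logic.I; rewrite /= /C'; case: eqP => [-> _|//].
    by rewrite Ci0.
  rewrite !indepZ//; last by move=> i; rewrite /C'; case: ifP.
  rewrite (bigD1 i0)//= [in RHS](bigD1 i0)//= /C' eqxx Ci0 preimage_setT probability_setT mul1e.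
  by congr (_ * _)%E; apply: eq_bigr => i /negbTE ->.
- by move=> _; rewrite /= /mrestr/= setTI -ge0_fin_numE// fin_num_measure//; exact: mC.
Qed.

(** The other terms form a variable [S] independent of [Z i0], so the law of the pair is a product
    measure. At a fixed value of [S] the equation puts [Z i0] in a hyperplane, of probability zero,
    and integrating over that value gives zero. *)
Lemma atomless_tie (a : I -> V) (c : R) (i0 : I) : a i0 != 0 ->
  (forall s, P [set om | dotp (Z i0 om) (a i0) = s] = 0%E) ->
  P [set om | \sum_i dotp (Z i om) (a i) = c] = 0%E.
Proof.
move=> ai0 nullZ.
pose S om : measurableTypeR R := c - \sum_(i | i != i0) dotp (Z i om) (a i).
have mS' (G : set (set Omega)) :
    (forall i C, i != i0 -> measurable C -> G (Z i @^-1` C)) ->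
    measurable_fun (T := g_sigma_algebraType G) setT S.
  move=> GZ; apply: measurable_funB => //; under eq_fun do rewrite big_mkcond.
  apply: measurable_sum => i; case: (boolP (i != i0)) => ii0; last exact: measurable_cst.
  apply: measurable_dotp => // _ C mC; rewrite setTI; apply: sub_sigma_algebra.
  exact: GZ.
have mS : measurable_fun setT S.
  apply: measurable_funB => //; under eq_fun do rewrite big_mkcond.
  apply: measurable_sum => i; case: (boolP (i != i0)) => ii0; last exact: measurable_cst.
  exact: measurable_dotp.
pose SZ om : measurableTypeR R * V := (S om, Z i0 om).
have mSZ : measurable_fun setT SZ by apply/measurable_fun_pairP; split; [exact: mS|exact: mZ].
pose Sm : {mfun _ >-> _} := HB.pack S (isMeasurableFun.Build _ _ _ _ _ mS).
pose Zm : {mfun _ >-> _} := HB.pack (Z i0) (isMeasurableFun.Build _ _ _ _ _ (mZ i0)).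
pose SZm : {mfun _ >-> _} := HB.pack SZ (isMeasurableFun.Build _ _ _ _ _ mSZ).
pose E : set (measurableTypeR R * V) := [set x | dotp x.2 (a i0) = x.1].
have mE : measurable E.
  rewrite (_ : E = (fun x : measurableTypeR R * V => dotp x.2 (a i0) - x.1) @^-1` [set 0]);
    last first.
    apply/seteqP; split => x; rewrite /E/=; first by move=> ->; rewrite subrr.
    by move/eqP; rewrite subr_eq0 => /eqP.
  apply: measurable_preimage; last exact: measurable_set1.
  apply: measurable_funB; last exact: measurable_fst.
  by apply: measurable_dotp => //; exact: measurable_snd.
have -> : [set om | \sum_i dotp (Z i om) (a i) = c] = SZ @^-1` E.
  apply/seteqP; split => om /=; rewrite (bigD1 i0)//= /E /SZ /S/=.
    by move=> <-; rewrite addrK.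
  by move=> ->; rewrite subrK.
have H := @product_measure_unique _ _ _ _ R (distribution P Sm) (distribution P Zm)
  (distribution P SZm) _ E mE.
rewrite -[LHS]/(distribution P SZm E) -H; last first.
  move=> B A mB mA; rewrite /distribution/= /pushforward muleC.
  rewrite -(@indep_from_others i0 S A B mS' mA mB); congr (P _).
  by rewrite setIC; apply/seteqP; split.
rewrite /product_measure1 integral0_eq// => s _ /=.
rewrite -[RHS](nullZ s); congr (P _).
by apply/seteqP; split => om; rewrite /xsection/= inE.
Qed.

Variables (F : V -> \bar R) (g : I -> V).
Hypothesis dfZ : forall i (x : V), P (Z i @^-1` [set y | forall j, y ord0 j <= x ord0 j]) = F x.
Hypothesis nullZ : forall i (b : V) s, b != 0 -> P [set om | dotp (Z i om) b = s] = 0%E.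
Hypothesis g_inj : injective g.

(** Products of lower orthants generate the sigma-algebra on samples: they are stable under
    intersection and, by independence, their probabilities depend only on the distribution
    functions, which is what the null hypothesis equates. *)
Let orthant (x : I -> V) : set (I -> V) :=
  [set z | forall i j, z i ord0 j <= x i ord0 j].
Let orthants : set (set (I -> V)) := range orthant.
Local Notation sample := (g_sigma_algebraType orthants).

Let permuted (s : {perm I}) (om : Omega) : sample := fun i => Z (s i) om.

Let measurable_permuted s : measurable_fun setT (permuted s).
Proof.
apply: (@measurability _ _ _ sample _ _ orthants) => // _ [_ [x _ <-] <-]; rewrite setTI.
rewrite (_ : _ @^-1` _ = \bigcap_i (Z (s i) @^-1` [set y | forall j, y ord0 j <= x i ord0 j])).
  apply: fin_bigcap_measurable => // i _.
  apply: measurable_preimage => //.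
  exact: measurable_lower_orthant.
by apply/seteqP; split => om /= h i; [move=> _ j; exact: h|exact: h].
Qed.

Let permutedM s : {mfun Omega >-> sample} :=
  HB.pack (permuted s) (isMeasurableFun.Build _ _ _ _ _ (measurable_permuted s)).

(** Under every permutation a product of orthants has probability [\prod_i F (x i)], and such sets
    determine the law; those with all corners equal to [k] exhaust the space. *)
Let sample_exchangeable s (E : set sample) : measurable E ->
  P (permuted s @^-1` E) = P (permuted 1%g @^-1` E).
Proof.
move=> mE.
rewrite -[LHS]/(distribution P (permutedM s) E).
rewrite -[RHS]/(distribution P (permutedM 1%g) E).
apply: (@measure_unique _ R sample orthants (fun k => orthant (fun=> const_mx k%:R))) => //.
- move=> _ _ [x _ <-] [y _ <-].
  exists (fun i => \row_j Num.min (x i ord0 j) (y i ord0 j)) => //.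
  apply/seteqP; split => z /=.
    by move=> h; split => i j; have := h i j; rewrite mxE le_min => /andP[].
  by move=> [h1 h2] i j; rewrite mxE le_min h1 h2.
- by move=> k; exists (fun=> const_mx k%:R).
- apply/seteqP; split => // z _.
  exists (Num.bound (\sum_i \sum_j `|z i ord0 j|)) => // i j; rewrite mxE.
  rewrite (le_trans (ler_norm _))//.
  rewrite (le_trans _ (ltW (archi_boundP _)))//; last first.
    by apply: sumr_ge0 => ? _; exact: sumr_ge0.
  rewrite (bigD1 i)//= (bigD1 j)//= -addrA lerDl addr_ge0 ?sumr_ge0// => ? _.
  exact: sumr_ge0.
- move=> _ [x _ <-]; rewrite /distribution/= /pushforward.
  have E1 t : permuted t @^-1` orthant x =
      \bigcap_i (Z i @^-1` [set y | forall j, y ord0 j <= x ((t^-1)%g i) ord0 j]).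
    apply/seteqP; split => om /= h.
      by move=> i _ j /=; have := h (t^-1%g i) j; rewrite /permuted permKV.
    by move=> i j; have := h (t i) Logic.I j; rewrite permK.
  have E2 t : P (permuted t @^-1` orthant x) = (\prod_i F (x i))%E.
    rewrite E1 indepZ; last by move=> i; exact: measurable_lower_orthant.
    under eq_bigr do rewrite dfZ.
    rewrite (reindex_inj (@perm_inj _ t))/=.
    by apply: eq_bigr => i _; rewrite permK.
  exact: etrans (E2 s) (esym (E2 1%g)).
- move=> k; rewrite -ge0_fin_numE// fin_num_measure//.
  by apply: sub_sigma_algebra; exists (fun=> const_mx k%:R).
Qed.

(* Expanding the squares, the assignment [z i |-> g (s i)] has least cost when [corr z s] is
   largest. *)
Let corr (z : I -> V) (s : {perm I}) : R := \sum_i dotp (z i) (g (s i)).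
Let opt s : set (I -> V) := [set z | forall t, t != s -> corr z t < corr z s].

Let measurable_opt s : measurable (opt s : set sample).
Proof.
have mc i j : measurable_fun setT (fun z : sample => z i ord0 j).
  apply: (measurability _ (RGenOInfty.measurableE R)) => _ [_ [a ->] <-].
  rewrite setTI set_itvoy.
  (* The complement, where one coordinate is at most [a], is the union over [k] of the orthants
     whose other corners are [k]. *)
  rewrite (_ : _ @^-1` _ = ~` (\bigcup_k orthant (fun i' => \row_j'
      if (i' == i) && (j' == j) then a else k%:R))).
    apply: measurableC; apply: bigcupT_measurable => k.
    by apply: sub_sigma_algebra;
      exists (fun i' => \row_j' if (i' == i) && (j' == j) then a else k%:R).
  apply/seteqP; split => z /=.
    by move=> az [k _ /(_ i j)]; rewrite mxE !eqxx/= leNgt az.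
  move=> h; rewrite ltNge; apply/negP => za; apply: h.
  exists (Num.bound (\sum_i \sum_j `|z i ord0 j|)) => // i' j'; rewrite mxE.
  case: ifP => [/andP[/eqP-> /eqP->]//|_].
  rewrite (le_trans (ler_norm _))//.
  rewrite (le_trans _ (ltW (archi_boundP _)))//; last first.
    by apply: sumr_ge0 => ? _; exact: sumr_ge0.
  rewrite (bigD1 i')//= (bigD1 j')//= -addrA lerDl addr_ge0 ?sumr_ge0// => ? _.
  exact: sumr_ge0.
have mcorr t : measurable_fun setT (fun z : sample => corr z t).
  apply: measurable_sum => i; apply: measurable_dotp => //.
  by apply: measurable_fun_rV => j; exact: mc.
rewrite (_ : opt s = \bigcap_(t in [set t | t != s])
    ((fun z : sample => corr z s - corr z t) @^-1` `]0, +oo[)).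
  apply: fin_bigcap_measurable => [|t _]; first exact: finite_finset.
  apply: measurable_preimage => //; exact: measurable_funB.
apply/seteqP; split => z /= h t ts.
  by rewrite /= in_itv/= subr_gt0 h.
by have := h t ts; rewrite /= in_itv/= andbT subr_gt0.
Qed.

Let opt_event s : set Omega := permuted 1%g @^-1` opt s.

Let measurable_opt_event s : measurable (opt_event s).
Proof. by apply: measurable_preimage => //; exact: measurable_opt. Qed.

Let opt_eventE s : opt_event s = [set om | opt s (fun i => Z i om)].
Proof.
rewrite /opt_event; apply/seteqP; split => om;
  rewrite /= (_ : permuted 1 om = fun i => Z i om)//;
  by apply/funext => i; rewrite /permuted perm1.
Qed.

(** By exchangeability the sample may be permuted by [s]; the assignment [t] then has the
    correlation that [s^-1 * t] has on the original sample, so optimality of [s] becomes optimality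
    of the identity. *)
Let opt_event_eq s : P (opt_event s) = P (opt_event 1%g).
Proof.
rewrite -[LHS](sample_exchangeable s (measurable_opt s)); congr (P _).
have corrE om t : corr (permuted s om) t = corr (permuted 1 om) (s^-1 * t)%g.
  rewrite /corr [RHS](reindex_inj (@perm_inj _ s))/=.
  by apply: eq_bigr => i _; rewrite permM permK /permuted perm1.
apply/seteqP; split => om /= h t ts.
  have := h (s * t)%g; rewrite !corrE mulKg mulVg; apply.
  by apply: contra ts => /eqP /(congr1 (mulg s^-1)); rewrite mulKg mulVg => ->.
rewrite !corrE mulVg; apply: h.
by apply: contra ts => /eqP /(congr1 (mulg s)); rewrite mulKVg mulg1 => ->.
Qed.

(** A tie between [s] and [t] is a linear equation whose coefficients [g (s i) - g (t i)] do not all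
    vanish, since [g] is injective; [atomless_tie] makes it a null event. Outside finitely many such
    events a maximizer of [corr] is strict. *)
Let opt_event_ae : {ae P, forall om, exists s, opt_event s om}.
Proof.
have : {ae P, forall om, forall st : {perm I} * {perm I}, st.1 != st.2 ->
    corr (Z ^~ om) st.1 != corr (Z ^~ om) st.2}.
  apply: filter_forall => -[s t]/=.
  have [->|st] := eqVneq s t; first by apply: aeW.
  have [i sti] : exists i, g (s i) - g (t i) != 0.
    apply/existsP; apply: contraR st; rewrite negb_exists => /forallP h.
    apply/eqP/permP => i; apply: g_inj.
    by have := h i; rewrite negbK subr_eq0 => /eqP.
  exists [set om | \sum_i dotp (Z i om) (g (s i) - g (t i)) = 0]; split.
  - apply: (@measurable_preimage _ _ _ _
      (fun om => \sum_i dotp (Z i om) (g (s i) - g (t i))) [set 0]) => //.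
    by apply: measurable_sum => j; exact: measurable_dotp.
  - by apply: (atomless_tie (a := fun i => g (s i) - g (t i)) _ sti) => u; exact: nullZ.
  - move=> om /=; apply: contra_notP => h _; apply/eqP => e; apply: h.
    by under eq_bigr do rewrite dotpBr; rewrite sumrB; apply/eqP; rewrite subr_eq0; apply/eqP.
apply: filterS => om h.
have [s _ smax] := @arg_maxP _ _ {perm I} 1%g xpredT (corr (Z ^~ om)) isT.
exists s; rewrite opt_eventE /= => t ts.
by rewrite lt_neqAle; apply/andP; split; [exact: (h (t, s))|exact: smax].
Qed.

(** On the sample points [G] is given by a permutation [s1], and it competes with the bijection
    given by [s]. The squared norms contribute equally to all costs, so [s1] does at least as well
    as [s] for [corr], and strictness forces [s = s1]. *)
Lemma optimal_transport_opt (z : I -> V) (G : V -> V) s :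
  optimal_transport z (range g) G -> opt s z -> forall i, G (z i) = g (s i).
Proof.
move=> [Gbij Gmin] os.
have [s0 s0E] : exists s0 : I -> I, forall i, g (s0 i) = G (z i).
  suff /choice[s0 s0E] : forall i, exists j, g j = G (z i) by exists s0.
  move=> i; have [gz _ _] := Gbij.
  by have [|j _ gj] := gz (z i); [exists i|exists j].
(* Surjectivity of [G] onto the grid makes [s0] surjective, hence injective on the finite [I]; this
   also separates the points [z i]. *)
have s0onto j : exists i, s0 i = j.
  have : range g (g j) by exists j.
  have [_ _ zg] := Gbij.
  move/zg => [_ [i _ <-]] gj; exists i; apply: g_inj.
  by rewrite s0E.
have [r rE] := choice s0onto.
have r_inj : injective r by move=> i j /(congr1 s0); rewrite !rE.
have s0_inj : injective s0.
  have [r' r'K rK'] := injF_bij r_inj.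
  by move=> a b; rewrite -[a]rK' -[b]rK' !rE => ->.
have z_inj : injective z.
  by move=> i j zij; apply: s0_inj; apply: g_inj; rewrite !s0E zij.
(* The assignment [t] as a map on vectors; the value [0] away from the sample is arbitrary. *)
pose H (t : I -> I) x := if pselect (exists i, z i = x) is left e
  then g (t (projT1 (cid e))) else 0.
have HE t i : H t (z i) = g (t i).
  rewrite /H; case: pselect => [e|[]]; last by exists i.
  by case: cid => j /= /z_inj ->.
have Hbij (t : {perm I}) : set_bij (range z) (range g) (H t).
  split.
  - by move=> _ [i _ <-]; rewrite HE; exists (t i).
  - by move=> _ _ /set_mem[i _ <-] /set_mem[j _ <-]; rewrite !HE => /g_inj /perm_inj ->.
  - by move=> _ [i _ <-]; exists (z ((t^-1)%g i)); [exists ((t^-1)%g i)|rewrite HE permKV].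
pose s1 : {perm I} := perm s0_inj.
have s1E i : G (z i) = g (s1 i) by rewrite permE s0E.
suff -> : s = s1 by [].
apply/eqP; rewrite eq_sym; apply: contraT => /os; rewrite ltNge.
suff -> : corr z s <= corr z s1 by [].
have := Gmin _ (Hbij s).
have cost (t : {perm I}) : \sum_i sqnorm (g (t i) - z i) =
    \sum_i sqnorm (g i) - 2 * corr z t + \sum_i sqnorm (z i).
  rewrite /corr mulr_sumr [X in _ = X - _ + _](reindex_inj (@perm_inj _ t))/=.
  rewrite -sumrB -big_split/=; apply: eq_bigr => i _.
  by rewrite sqnormB (dotpC (z i)).
under eq_bigr do rewrite s1E.
under [X in _ <= X -> _]eq_bigr do rewrite HE.
rewrite !cost; lra.
Qed.

Variables (rank : I -> Omega -> V) (G : Omega -> V -> V).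
Hypothesis rankE : forall i om, rank i om = G om (Z i om).
Hypothesis G_opt : {ae P, forall om, optimal_transport (Z ^~ om) (range g) (G om)}.

(** Almost surely exactly one event [opt_event s] occurs, and there the ranks are [g \o s]; all
    these events have the same probability. *)
Let integral_ranks (Phi : (I -> V) -> R) :
  measurable_fun setT (fun om => Phi (rank ^~ om)) ->
  (\int[P]_om (Phi (rank ^~ om))%:E)%E =
  ((\sum_s Phi (g \o (s : {perm I}))) * fine (P (opt_event 1%g)))%:E.
Proof.
move=> mPhi.
transitivity (\int[P]_om (\sum_s Phi (g \o (s : {perm I})) * \1_(opt_event s) om)%:E)%E.
  apply: ae_eq_integral => //.
  - exact/measurable_EFinP.
  - apply/measurable_EFinP; apply: measurable_sum => s.
    by apply: measurable_funM => //; exact: measurable_indic.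
  have : {ae P, forall om, (exists s, opt_event s om) /\
      optimal_transport (Z ^~ om) (range g) (G om)}.
    by apply: filterS2 opt_event_ae G_opt.
  apply: filterS => om [[s os] Gom] _; congr (_%:E).
  rewrite (bigD1 s)//= indicE mem_set// mulr1 big1 ?addr0.
    congr Phi; apply/funext => i; rewrite rankE.
    by apply: (optimal_transport_opt Gom); rewrite opt_eventE in os.
  move=> t ts; rewrite indicE memNset ?mulr0//.
  rewrite opt_eventE; rewrite opt_eventE in os => ot.
  by have := lt_trans (ot s _) (os t ts); rewrite ltxx eq_sym ts => /(_ isT).
under eq_integral do rewrite -sumEFin.
rewrite integral_sum//; last first.
  move=> s; under eq_fun do rewrite EFinM.
  apply: integrableZl => //; exact: integrable_indic.
rewrite mulr_suml -sumEFin; apply: eq_bigr => s _.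
under eq_integral do rewrite EFinM.
rewrite integralZl//; last exact: integrable_indic.
rewrite integral_indic// setIT.
by rewrite EFinM fineK ?fin_num_measure//; congr (_ * _)%E; exact: opt_event_eq.
Qed.

Lemma expectation_ranks (Phi : (I -> V) -> R) :
  measurable_fun setT (fun om => Phi (rank ^~ om)) ->
  (\int[P]_om (Phi (rank ^~ om))%:E)%E = (perm_avg (fun s => Phi (g \o s)))%:E.
Proof.
move=> mPhi; rewrite integral_ranks// /perm_avg mulrC; congr ((_ * _)%:E).
(* The constant functional [1] shows that the common probability is one over the number of
   permutations. *)
have := @integral_ranks (fun=> 1) (measurable_cst _).
rewrite integral_cst// mul1e [X in X = _ -> _]probability_setT sumr_const => -[e].
have c0 : #|{perm I}|%:R != 0 :> R by apply: contra_eq_neq e => ->; rewrite mul0r oner_eq0.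
by apply: (mulfI c0); rewrite divff.
Qed.

End exchangeable_ranks.

Lemma cvg_bigsum (R : realType) (T : Type) (F : set_system T) (FF : Filter F)
    (I : Type) (r : seq I) (u : I -> T -> R) (l : I -> R) :
  (forall i, u i x @[x --> F] --> l i) ->
  \sum_(i <- r) u i x @[x --> F] --> \sum_(i <- r) l i.
Proof.
move=> ul; elim: r => [|i r IH].
  by rewrite big_nil; under eq_fun do rewrite big_nil; exact: cvg_cst.
by rewrite big_cons; under eq_fun do rewrite big_cons; exact: cvgD.
Qed.

(** * Bernstein polynomials and Weierstrass approximation *)

Section bernstein.
Context {R : realType}.
Implicit Types (f : nat -> R) (u : R).

(* [(bernstein f n j).[u]] is the expectation of [f (j + S)] for [S] binomial with
   parameters [n] and [u]. *)
Fixpoint bernstein f n j : {poly R} :=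
  if n is n'.+1 then 'X * bernstein f n' j.+1 + (1 - 'X) * bernstein f n' j
  else (f j)%:P.

(** Induction on the number of trials, conditioning on the first. The right side is the mean of the
    quadratic bound, since [j + S - x] has mean [j + n u - x] and variance [n u (1 - u)]. *)
Lemma bernstein_approx f (a b c x u : R) n j : 0 <= u <= 1 ->
  (forall i, (i <= j + n)%N -> `|f i - c| <= a + b * (i%:R - x) ^+ 2) ->
  `|(bernstein f n j).[u] - c| <=
    a + b * ((j%:R + n%:R * u - x) ^+ 2 + n%:R * (u * (1 - u))).
Proof.
move=> /andP[u0 u1]; elim: n j => [|n IH] j fc /=.
  by rewrite hornerC !mul0r !addr0 fc// addn0.
rewrite !hornerE/=.
set A := (bernstein f n j.+1).[u]; set B := (bernstein f n j).[u].
have -> : u * A + (1 - u) * B - c = u * (A - c) + (1 - u) * (B - c) by ring.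
rewrite (le_trans (ler_normD _ _))// !normrM (ger0_norm u0) [`|1 - u|]ger0_norm ?subr_ge0//.
have hA : `|A - c| <= a + b * ((j.+1%:R + n%:R * u - x) ^+ 2 + n%:R * (u * (1 - u))).
  by apply: IH => i ij; apply: fc; rewrite addnS.
have hB : `|B - c| <= a + b * ((j%:R + n%:R * u - x) ^+ 2 + n%:R * (u * (1 - u))).
  by apply: IH => i ij; apply: fc; rewrite addnS (leq_trans ij).
have u1' : 0 <= 1 - u by rewrite subr_ge0.
rewrite (le_trans (lerD (ler_wpM2l u0 hA) (ler_wpM2l u1' hB)))//.
by rewrite -natr1 -(natr1 n) le_eqVlt; apply/orP; left; apply/eqP; ring.
Qed.

(** Compactness makes the radius of continuity uniform; only [x] is confined to the segment, while
    [y] may lie outside. *)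
Lemma unif_continuous_segment (F : R -> R) (a b : R) : continuous F ->
  forall e : R, 0 < e -> exists2 del, 0 < del &
    forall x y, a <= x <= b -> `|x - y| < del -> `|F x - F y| <= e.
Proof.
move=> cF e e0.
have /compact_near_coveringP := @segment_compact R a b.
move=> /(_ R ((0 : R)^'+) (fun del x => forall y, `|x - y| < del -> `|F x - F y| <= e)).
have H x : `[a, b]%classic x -> \forall x' \near x & del \near ((0 : R)^'+),
    forall y, `|x' - y| < del -> `|F x' - F y| <= e.
  move=> _; have /cvgrPdist_lt/(_ (e / 2)) := cF x.
  rewrite divr_gt0// => /(_ isT)/nbhs_ballP[r /= r0 rF].
  exists (ball x (r / 2), [set del | del < r / 2]) => /=.
    split; first by apply: nbhsx_ballx; rewrite divr_gt0.
    by apply: nbhs_right_lt; rewrite divr_gt0.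
  move=> [x' del]/= [xx' delr] y x'y.
  have h1 : `|F x - F x'| < e / 2.
    by apply: rF; apply: le_ball xx'; rewrite ler_pdivrMr// ler_peMr ?ler1n ?ltW.
  have h2 : `|F x - F y| < e / 2.
    apply: rF; rewrite /ball/= -(subrKA x') (le_lt_trans (ler_normD _ _))// [ltRHS]splitr.
    by rewrite ltrD// (lt_trans x'y).
  by rewrite -(subrKA (F x)) (le_trans (ler_normD _ _))// [leRHS]splitr lerD// ltW// distrC.
move=> /(_ _ H) => K.
near ((0 : R)^'+) => del; exists del; first by near: del; exact: nbhs_right_gt.
move=> x y xab xy.
have KD : `[a, b]%classic `<=` (fun x => forall y, `|x - y| < del -> `|F x - F y| <= e).
  by near: del.
by apply: KD xy; rewrite /= in_itv.
Unshelve. all: by end_near. Qed.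

Lemma weierstrass_approx (F : R -> R) (B : R) : continuous F -> (forall x, `|F x| <= B) ->
  forall e : R, 0 < e -> exists p : {poly R}, forall u, 0 <= u <= 1 -> `|F u - p.[u]| <= e.
Proof.
move=> cF FB e e0.
have [del del0 Fdel] := unif_continuous_segment 0 1 cF (divr_gt0 e0 (ltr0Sn R 1)).
have B0 : 0 <= B by rewrite (le_trans _ (FB 0)).
(* Large enough for the final error [2 * B / (del ^+ 2 * n)] to be at most [e / 2]. *)
pose n := (Num.bound (4 * B / (del ^+ 2 * e))).+1.
have n0 : 0 < n%:R :> R by rewrite ltr0n.
have nB : 4 * B / (del ^+ 2 * e) <= n%:R.
  rewrite (le_trans (ltW (archi_boundP _)))//; last by rewrite ler_nat.
  by rewrite divr_ge0 ?mulr_ge0 ?sqr_ge0// ltW.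
exists (bernstein (fun i => F (i%:R / n%:R)) n 0) => u u01.
rewrite distrC; pose b := 2 * B / (del ^+ 2 * n%:R ^+ 2).
have b0 : 0 <= b by rewrite /b divr_ge0// mulr_ge0// sqr_ge0.
(* Near [u] uniform continuity gives [e / 2]; at distance at least [del] the trivial bound [2 * B]
   is at most [b] times the square, as in Chebyshev's inequality. *)
have hb i : (i <= 0 + n)%N ->
    `|F (i%:R / n%:R) - F u| <= e / 2 + b * (i%:R - n%:R * u) ^+ 2.
  move=> _; have [iu|iu] := ltP `|u - i%:R / n%:R| del.
    by rewrite distrC (le_trans (Fdel _ _ u01 iu))// lerDl mulr_ge0// sqr_ge0.
  apply: (@le_trans _ _ (2 * B)).
    by rewrite (le_trans (ler_normB _ _))//; have := FB (i%:R / n%:R); have := FB u; lra.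
  rewrite -[leLHS]add0r lerD ?divr_ge0 ?(ltW e0)//.
  have -> : i%:R - n%:R * u = - (n%:R * (u - i%:R / n%:R)).
    by rewrite mulrBr mulrCA divff ?gt_eqF// mulr1 opprB.
  rewrite sqrrN exprMn /b.
  have -> : 2 * B / (del ^+ 2 * n%:R ^+ 2) * (n%:R ^+ 2 * (u - i%:R / n%:R) ^+ 2) =
      2 * B * ((u - i%:R / n%:R) ^+ 2 / del ^+ 2).
    by field; rewrite !gt_eqF.
  rewrite ler_peMr ?mulr_ge0// ler_pdivlMr ?exprn_gt0// mul1r.
  by rewrite -[leRHS]real_normK ?num_real// ler_pXn2r ?nnegrE// ltW.
apply: le_trans (bernstein_approx u01 hb) _.
rewrite mulr0n add0r subrr expr0n add0r [leRHS]splitr lerD2l.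
apply: (@le_trans _ _ (b * n%:R)).
  rewrite ler_wpM2l// ler_piMr//; case/andP: u01 => u0 u1.
  by rewrite mulr_ile1// ?subr_ge0// lerBlDr lerDl.
have -> : b * n%:R = 2 * B / (del ^+ 2 * n%:R).
  by rewrite /b; field; rewrite !gt_eqF.
rewrite ler_pdivrMr ?mulr_gt0 ?exprn_gt0//.
move: nB; rewrite ler_pdivrMr ?mulr_gt0 ?exprn_gt0//.
set X := del ^+ 2; rewrite (_ : e / 2 * (X * n%:R) = n%:R * (X * e) / 2); last by ring.
lra.
Qed.

End bernstein.

(** * Integrals against probability measures, and convergence in law from Laplace transforms *)

Section probability_integrals.
Context d (T : measurableType d) (R : realType) (P : probability T R).
Implicit Types (f g X : T -> R).

Lemma integrable_bounded f (B : R) : measurable_fun setT f ->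
  (forall x, `|f x| <= B) -> P.-integrable setT (EFin \o f).
Proof.
move=> mf fB; apply: measurable_bounded_integrable => //.
  by rewrite (le_lt_trans (probability_le1 _ _)) ?ltry.
exists B; split; first exact: num_real.
by move=> M BM x _ /=; rewrite (le_trans (fB x))// ltW.
Qed.

Lemma expectation_bounded f (B : R) : measurable_fun setT f ->
  (forall x, `|f x| <= B) -> 'E_P[f]%E = (\int[P]_x f x)%:E.
Proof.
move=> mf fB; rewrite unlock /Rintegral fineK//.
exact: integrable_fin_num (integrable_bounded mf fB).
Qed.

Lemma norm_Rintegral_le f X (a b C : R) :
  measurable_fun setT f -> measurable_fun setT X -> (forall x, 0 <= X x) ->
  (\int[P]_x (X x)%:E <= C%:E)%E -> 0 <= a -> 0 <= b ->
  (forall x, `|f x| <= a * X x + b) -> `|\int[P]_x f x| <= a * C + b.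
Proof.
move=> mf mX X0 XC a0 b0 fX.
have mEX : measurable_fun setT (EFin \o X) by exact/measurable_EFinP.
have H : (\int[P]_x `|(f x)%:E| <= (a * C + b)%:E)%E.
  apply: (@le_trans _ _ (\int[P]_x (a%:E * (X x)%:E + b%:E))%E).
    apply: ge0_le_integral => //.
    - by apply: measurableT_comp => //; exact/measurable_EFinP.
    - by apply: emeasurable_funD => //; exact: measurable_funeM.
    - by move=> x _; rewrite lee_fin.
  rewrite ge0_integralD//; [|by move=> x _; rewrite mule_ge0// lee_fin|exact: measurable_funeM].
  rewrite ge0_integralZl//; last by move=> x _; rewrite lee_fin.
  rewrite integral_cst// [X in (_ + _ * X <= _)%E]probability_setT mule1.
  by rewrite EFinD EFinM leeD2r// lee_wpmul2l.
have intf : P.-integrable setT (EFin \o f).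
  apply/integrableP; split; first exact/measurable_EFinP.
  by rewrite (le_lt_trans H)// ltry.
rewrite (le_trans (le_normr_Rintegral _ intf))// -lee_fin /Rintegral fineK//.
apply: integrable_fin_num => //.
exact: (integrable_norm intf).
Qed.

Lemma integrable_lincomb (I : Type) (r : seq I) (c : I -> R) (f : I -> T -> R) :
  (forall i, P.-integrable setT (EFin \o f i)) ->
  P.-integrable setT (EFin \o (fun x => \sum_(i <- r) c i * f i x)).
Proof.
move=> fi; elim: r => [|i r IH].
  rewrite (_ : _ \o _ = cst 0%E); first exact: integrable0.
  by apply/funext => x; rewrite /= big_nil.
rewrite (_ : _ \o _ = (fun x => (c i)%:E * (f i x)%:E + (\sum_(j <- r) c j * f j x)%:E)%E).
  by apply: integrableD => //; apply: integrableZl => //; exact: fi.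
by apply/funext => x; rewrite /= big_cons EFinD EFinM.
Qed.

Lemma Rintegral_lincomb (I : Type) (r : seq I) (c : I -> R) (f : I -> T -> R) :
  (forall i, P.-integrable setT (EFin \o f i)) ->
  \int[P]_x (\sum_(i <- r) c i * f i x) = \sum_(i <- r) c i * \int[P]_x f i x.
Proof.
move=> fi; elim: r => [|i r IH].
  rewrite big_nil; under eq_Rintegral do rewrite big_nil.
  by rewrite Rintegral_cst// mul0r.
rewrite big_cons; under eq_Rintegral do rewrite big_cons.
rewrite RintegralD//; [by rewrite IH RintegralZl| |exact: integrable_lincomb].
rewrite (_ : _ \o _ = (fun x => (c i)%:E * (f i x)%:E)%E); last by apply/funext.
by apply: integrableZl => //; exact: fi.
Qed.

End probability_integrals.
Arguments integrable_bounded {d T R P f} B.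
Arguments expectation_bounded {d T R P f} B.
Arguments integrable_lincomb {d T R P I} r c f.
Arguments Rintegral_lincomb {d T R P I} r c f.

Section laplace_continuity.
Context (R : realType) (d_ : nat -> measure_display)
  (Omega_ : forall n, measurableType (d_ n)) (P_ : forall n, probability (Omega_ n) R)
  (X_ : forall n, Omega_ n -> R) d (Omega : measurableType d)
  (P : probability Omega R) (X : Omega -> R) (C : R).
Hypotheses (mX_ : forall n, measurable_fun setT (@X_ n)) (mX : measurable_fun setT X).
Hypotheses (X_0 : forall n om, 0 <= @X_ n om) (X0 : forall om, 0 <= X om).
Hypotheses (X_C : forall n, (\int[P_ n]_om (@X_ n om)%:E <= C%:E)%E)
  (XC : (\int[P]_om (X om)%:E <= C%:E)%E).

(* Bernstein polynomials in [e^-x] approximate [f (min x M)] uniformly, and Markov's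
   inequality controls the event where [x] exceeds [M]. *)
Lemma cvg_in_law_laplace :
  (forall k : nat, \int[P_ n]_om expR (- (k%:R * @X_ n om)) @[n --> \oo] -->
    \int[P]_om expR (- (k%:R * X om))) ->
  cvg_in_law P_ X_ P X.
Proof.
move=> lap f cf [B0 [_ /(_ (`|B0| + 1) _)]].
rewrite (le_lt_trans (ler_norm _)) ?ltrDl// => /(_ isT) fB'.
pose B : R := `|B0| + 1; have fB x : `|f x| <= B by exact: fB'.
have B_gt0 : 0 < B by rewrite ltr_wpDl.
have mf : measurable_fun setT f by exact: continuous_measurable_fun.
under eq_fun => n do rewrite (expectation_bounded B (measurableT_comp mf (@mX_ n)) (fun=> fB _)).
rewrite (expectation_bounded B (measurableT_comp mf mX) (fun=> fB _)).
apply: cvg_EFin; first exact: nearW.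
have C0 : 0 <= C.
  by rewrite -lee_fin (le_trans _ XC)// integral_ge0// => x _; rewrite lee_fin.
apply/cvgrPdist_le => e e0.
(* Chosen so that the tail contributes at most [2 * B / M * C <= e / 4]. *)
pose M := 8 * B * (C + 1) / e.
have M0 : 0 < M by rewrite divr_gt0// mulr_gt0 ?mulr_gt0// ltr_wpDl.
(* In the variable [u = expR (- x)] this is [f (min x M)]; the cut-off makes it continuous on the
   whole line. *)
pose F u := f (- ln (Num.max u (expR (- M)))).
have cF : continuous F.
  move=> u; apply: continuous_comp; last exact: cf.
  apply: continuousN; apply: continuous_comp.
    by apply: continuous_max; [exact: cvg_id|exact: cvg_cst].
  by apply: continuous_ln; rewrite lt_max expR_gt0 orbT.
have e4 : 0 < e / 8 by rewrite divr_gt0.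
have [p pF] := weierstrass_approx cF (fun x => fB _) e4.
have BM0 : 0 <= 2 * B / M by rewrite divr_ge0 ?(ltW M0)// mulr_ge0// ltW.
have fp x : 0 <= x -> `|f x - p.[expR (- x)]| <= 2 * B / M * x + e / 8.
  move=> x0; have := pF (expR (- x)).
  rewrite expR_ge0 -[X in _ <= X]expR0 ler_expR oppr_le0 x0 => /(_ isT) h.
  rewrite -(subrKA (F (expR (- x)))) (le_trans (ler_normD _ _))// lerD//.
  have [xM|Mx] := leP x M.
    rewrite /F max_l ?ler_expR ?lerN2// expRK opprK subrr normr0.
    exact: mulr_ge0.
  rewrite (@le_trans _ _ (2 * B))//.
    by rewrite (le_trans (ler_normB _ _))//; have := fB x;
      have := fB (- ln (Num.max (expR (- x)) (expR (- M)))); rewrite /F; lra.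
  by rewrite -mulrA ler_peMr ?mulr_ge0 ?(ltW B_gt0)// mulrC ler_pdivlMr// mul1r ltW.
(* A polynomial in [expR (- Y)] integrates to a combination of Laplace transforms at natural
   numbers. *)
have pE d' (T : measurableType d') (Q : probability T R) (Y : T -> R) :
    measurable_fun setT Y -> (forall t, 0 <= Y t) ->
    \int[Q]_t p.[expR (- Y t)] = \sum_(k < size p) p`_k * \int[Q]_t expR (- (k%:R * Y t)).
  move=> mY Y0.
  have -> : (fun t => p.[expR (- Y t)]) = (fun t => \sum_(k < size p) p`_k * expR (- (k%:R * Y t))).
    apply/funext => t; rewrite horner_coef; apply: eq_bigr => k _.
    by rewrite -expRM_natl mulrN.
  apply: Rintegral_lincomb => k; apply: (integrable_bounded 1).
    apply: measurableT_comp => //; apply: measurable_funN.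
    by apply: measurable_funM.
  by move=> t; rewrite ger0_norm ?expR_ge0// -expR0 ler_expR oppr_le0 mulr_ge0.
have close d' (T : measurableType d') (Q : probability T R) (Y : T -> R) :
    measurable_fun setT Y -> (forall t, 0 <= Y t) -> (\int[Q]_t (Y t)%:E <= C%:E)%E ->
    `|\int[Q]_t f (Y t) - \int[Q]_t p.[expR (- Y t)]| <= 3 * e / 8.
  move=> mY Y0 YC.
  have mp : measurable_fun setT (fun t => p.[expR (- Y t)]).
    apply: (measurableT_comp (f := fun u => p.[u])).
      by apply: continuous_measurable_fun; exact: continuous_horner.
    by apply: measurableT_comp => //; exact: measurable_funN.
  have pB t : `|p.[expR (- Y t)]| <= B + e / 8.
    have := pF (expR (- Y t)); rewrite expR_ge0 -[X in _ <= X]expR0 ler_expR oppr_le0 Y0.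
    move=> /(_ isT) h; rewrite -[X in `|X|](subrK (F (expR (- Y t)))).
    by rewrite (le_trans (ler_normD _ _))// [leRHS]addrC lerD ?fB// distrC.
  rewrite -RintegralB//; last 2 first.
  - by apply: (integrable_bounded B) => //; exact: measurableT_comp.
  - exact: (integrable_bounded _ mp pB).
  have mfp : measurable_fun setT (fun t => f (Y t) - p.[expR (- Y t)]).
    by apply: measurable_funB => //; exact: measurableT_comp.
  rewrite (le_trans (norm_Rintegral_le mfp mY Y0 YC BM0 (ltW e4) (fun t => fp _ (Y0 t))))//.
  have -> : 2 * B / M * C = e / 4 * (C / (C + 1)).
    by rewrite /M; field; rewrite !gt_eqF// ltr_wpDl.
  have : C / (C + 1) <= 1 by rewrite ler_pdivrMr ?ltr_wpDl// mul1r lerDl.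
  by rewrite -(ler_pM2l (x := e / 4)) ?divr_gt0// => h; lra.
have : \int[P_ n]_om p.[expR (- @X_ n om)] @[n --> \oo] --> \int[P]_om p.[expR (- X om)].
  rewrite pE//; under eq_fun => n do rewrite pE//.
  by apply: cvg_bigsum => k; apply: cvgMl_tmp; exact: lap.
(* The three errors [3 * e / 8], [e / 4] and [3 * e / 8] add up to [e]. *)
move=> /cvgrPdist_le/(_ (e / 4)); rewrite divr_gt0// => /(_ isT); apply: filterS => n h.
rewrite -[leLHS]/(`|\int[P]_x f (X x) - \int[P_ n]_x f (@X_ n x)|).
have := close _ _ _ _ (@mX_ n) (@X_0 n) (@X_C n).
have := close _ _ _ _ mX X0 XC.
move: h; rewrite !ler_norml => /andP[? ?] /andP[? ?] /andP[? ?]; apply/andP; split; lra.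
Qed.

End laplace_continuity.

(** * Normal laws: Stein's identity, moments and characteristic function *)

Lemma integrable_cstM d (T : measurableType d) (R : realType)
    (mu : {measure set T -> \bar R}) (k : R) (h : T -> R) :
  mu.-integrable setT (EFin \o h) -> mu.-integrable setT (EFin \o (fun x => k * h x)).
Proof.
move=> ih; rewrite (_ : _ \o _ = (fun x => k%:E * (h x)%:E)%E); first exact: integrableZl.
by apply/funext => x; rewrite /= EFinM.
Qed.

Section integral_derivative.
Context {R : realType}.
Local Notation mu := (@lebesgue_measure R).

(** Over the interval of half-length [n.+1] about [m] the integral is a difference of two values of
    [F], each at most [K / n.+1] in modulus; by dominated convergence these integrals tend to the
    whole one. *)
Lemma integral_derive_eq0 (F f : R -> R) (m K : R) :
  (forall x : R, is_derive x 1 F (f x)) -> continuous f ->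
  mu.-integrable setT (EFin \o f) -> (forall x, `|F x| * `|x - m| <= K) ->
  \int[mu]_x f x = 0.
Proof.
move=> Ff cf intf FK.
pose A (n : nat) : set R := `[m - n.+1%:R, m + n.+1%:R]%classic.
have An n : m - n.+1%:R < m + n.+1%:R by rewrite ltrD2l gtrN.
have mA n : measurable (A n) by exact: measurable_itv.
have mf : measurable_fun setT f by exact: continuous_measurable_fun.
have H1 : \int[mu]_x (f \_ (A n)) x @[n --> \oo] --> \int[mu]_x f x.
  apply: fine_cvg; rewrite fineK; last exact: integrable_fin_num intf.
  apply: (@dominated_cvg _ _ _ mu setT measurableT _ _ (fun x => `|(f x)%:E|%E)) => //=.
  - move=> n; apply/measurable_EFinP/measurable_restrict => //.
      exact: mA.
    exact: measurable_funTS.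
  - move=> x _; apply: cvg_EFin; first exact: nearW.
    apply: cvg_near_cst; near=> n.
    have h : (Num.bound (`|x - m|)%R <= n)%N by near: n; exact: nbhs_infty_ge.
    rewrite /= patchE mem_set//= /A/= in_itv/= -ler_distlC distrC.
    by rewrite (le_trans (ltW (archi_boundP _)))// ler_nat (leq_trans h).
  - exact: integrable_norm intf.
  - move=> n x _; rewrite lee_fin patchE; case: ifP => // _.
    by rewrite normr0.
have H2 n : \int[mu]_x (f \_ (A n)) x = F (m + n.+1%:R) - F (m - n.+1%:R).
  rewrite -Rintegral_mkcond /Rintegral.
  rewrite (@continuous_FTC2 _ f F)//.
  - exact: continuous_subspaceT.
  - split; first by move=> x _; case: (Ff x).
    + by apply: cvg_at_right_filter; exact: (is_derive_continuous Ff).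
    + by apply: cvg_at_left_filter; exact: (is_derive_continuous Ff).
  - by move=> x _; rewrite derive1E; apply: derive_val.
have K0 : 0 <= K by rewrite (le_trans _ (FK 0)).
have H3 : \int[mu]_x (f \_ (A n)) x @[n --> \oo] --> (0 : R).
  apply/cvgr0Pnorm_le => e e0; near=> n.
  rewrite H2 (le_trans (ler_normB _ _))//.
  have h1 := FK (m + n.+1%:R); have h2 := FK (m - n.+1%:R).
  rewrite addrAC subrr add0r (ger0_norm (ler0n _ _)) -ler_pdivlMr// in h1.
  rewrite addrAC subrr add0r normrN (ger0_norm (ler0n _ _)) -ler_pdivlMr// in h2.
  rewrite (le_trans (lerD h1 h2))// -mulrDl ler_pdivrMr//.
  rewrite mulrC -ler_pdivrMr//.
  have : (Num.bound ((K + K) / e)%R <= n)%N by near: n; exact: nbhs_infty_ge.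
  move=> h; rewrite (le_trans (ltW (archi_boundP _)))//.
    by rewrite divr_ge0 ?addr_ge0 ?(ltW e0).
  by rewrite ler_nat (leq_trans h).
exact: cvg_unique H1 H3.
Unshelve. all: by end_near. Qed.

End integral_derivative.

Lemma normal_pdf_expR (R : realType) (m s x : R) : s != 0 ->
  normal_pdf m s x = normal_peak s * expR (- (x - m) ^+ 2 / (s ^+ 2 *+ 2)).
Proof. by move=> s0; rewrite normal_pdfE. Qed.

Section normal_moments.
Context {R : realType} (m s : R).
Hypothesis s0 : s != 0.
Local Notation mu := (@lebesgue_measure R).
Local Notation phi := (normal_pdf m s).

Let phiE x := normal_pdf_expR m x s0.

Lemma is_derive_normal_pdf (x : R) :
  is_derive x 1 phi (- ((x - m) / s ^+ 2) * phi x).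
Proof.
rewrite phiE; have -> : phi = fun x => normal_peak s * expR (- (x - m) ^+ 2 / (s ^+ 2 *+ 2)).
  by apply/funext => y; rewrite phiE.
have H : is_derive x 1 (fun x => expR (- (x - m) ^+ 2 / (s ^+ 2 *+ 2)))
    (expR (- (x - m) ^+ 2 / (s ^+ 2 *+ 2)) * (- (x - m) / s ^+ 2)).
  by apply: is_derive_eq; rewrite /GRing.scale/=; field.
apply: (is_derive_eq (is_derive_cstM _ H)); ring.
Qed.

Let s2_gt0 : 0 < s ^+ 2. Proof. by rewrite exprn_even_gt0. Qed.

(** Half of the exponent absorbs the square, since [u * expR (- u) <= 1]; the other half is the
    exponent of a normal density with doubled variance. *)
Lemma sqr_normal_pdf_le : exists2 K, 0 <= K & forall x,
  (x - m) ^+ 2 * phi x <= K * normal_pdf m (Num.sqrt 2 * s) x.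
Proof.
have s0' : Num.sqrt 2 * s != 0 by rewrite mulf_neq0// gt_eqF.
exists (4 * s ^+ 2 * normal_peak s / normal_peak (Num.sqrt 2 * s)) => [|x].
  by rewrite divr_ge0 ?normal_peak_ge0// mulr_ge0 ?normal_peak_ge0// mulr_ge0// ltW.
rewrite phiE normal_pdf_expR//.
set P1 := normal_peak s; set P2 := normal_peak _.
have P10 : 0 <= P1 by exact: normal_peak_ge0.
have P20 : P2 != 0 by rewrite gt_eqF// normal_peak_gt0.
set y := x - m.
rewrite [leRHS]mulrA divfK// exprMn sqr_sqrtr// -/y.
pose u := y ^+ 2 / (4 * s ^+ 2).
have -> : - y ^+ 2 / (s ^+ 2 *+ 2) = - u - u by rewrite /u; field.
have -> : - y ^+ 2 / ((2 * s ^+ 2) *+ 2) = - u by rewrite /u; field.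
have -> : y ^+ 2 = 4 * s ^+ 2 * u by rewrite /u; field.
rewrite expRD.
have h : u * expR (- u) <= 1.
  rewrite -(ler_pM2r (expR_gt0 u)) -mulrA -expRD addNr expR0 mulr1 mul1r.
  by rewrite (le_trans _ (expR_ge1Dx u))// lerDr.
rewrite (_ : 4 * s ^+ 2 * u * _ = 4 * s ^+ 2 * P1 * expR (- u) * (u * expR (- u))); last by ring.
by rewrite ler_piMr// mulr_ge0 ?expR_ge0// mulr_ge0// mulr_ge0// ltW.
Qed.

Lemma integrable_sqr_normal_pdf :
  mu.-integrable setT (EFin \o (fun x => (x - m) ^+ 2 * phi x)).
Proof.
have [K K0 HK] := sqr_normal_pdf_le.
apply: (@le_integrable _ _ _ mu setT measurableT _
  (fun x => K%:E * (normal_pdf m (Num.sqrt 2 * s) x)%:E)%E).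
- apply/measurable_EFinP; apply: measurable_funM; last exact: measurable_normal_pdf.
  by apply: measurable_funX; exact: measurable_funB.
- move=> x _; rewrite -EFinM !lee_fin ger0_norm.
    exact: le_trans (HK x) (ler_norm _).
  by rewrite mulr_ge0 ?sqr_ge0 ?normal_pdf_ge0.
- by apply: integrableZl => //; exact: integrable_normal_pdf.
Qed.

Lemma integrable_normal_pdfM (g : R -> R) (c : R) : measurable_fun setT g ->
  (forall x, `|g x| <= c * (1 + (x - m) ^+ 2)) ->
  mu.-integrable setT (EFin \o (fun x => g x * phi x)).
Proof.
move=> mg gc.
apply: (@le_integrable _ _ _ mu setT measurableT _
  (fun x => c%:E * ((phi x)%:E + ((x - m) ^+ 2 * phi x)%:E))%E).
- apply/measurable_EFinP; apply: measurable_funM => //; exact: measurable_normal_pdf.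
- move=> x _; rewrite -EFinD -EFinM /= !lee_fin normrM [`|phi x|]ger0_norm ?normal_pdf_ge0//.
  rewrite (le_trans _ (ler_norm _))// -[X in c * (X + _)]mul1r -mulrDl mulrA.
  by rewrite ler_wpM2r// normal_pdf_ge0.
- apply: integrableZl => //; apply: integrableD => //.
    exact: integrable_normal_pdf.
  exact: integrable_sqr_normal_pdf.
Qed.

(** The derivative of [g * phi] is [dg * phi - (x - m) * g * phi / s ^+ 2], and it integrates to
    zero by [integral_derive_eq0]; the growth bounds provide integrability and decay. *)
Lemma normal_stein (g dg : R -> R) (c : R) :
  (forall x : R, is_derive x 1 g (dg x)) -> continuous dg ->
  (forall x, `|dg x| <= c * (1 + (x - m) ^+ 2)) ->
  (forall x, `|g x| * `|x - m| <= c * (1 + (x - m) ^+ 2)) ->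
  \int[mu]_x ((x - m) * g x * phi x) = s ^+ 2 * \int[mu]_x (dg x * phi x).
Proof.
move=> gdg cdg dgc gc.
have cphi : continuous phi by exact: continuous_normal_pdf.
have cg := is_derive_continuous gdg.
have c0 : 0 <= c.
  by have := gc m; rewrite subrr normr0 mulr0 expr0n addr0 mulr1.
have i1 : mu.-integrable setT (EFin \o (fun x => dg x * phi x)).
  by apply: integrable_normal_pdfM dgc; exact: continuous_measurable_fun.
have i2 : mu.-integrable setT (EFin \o (fun x => (x - m) * g x * phi x)).
  apply: (integrable_normal_pdfM (c := c)); last first.
    by move=> x; rewrite normrM mulrC.
  apply: measurable_funM; first exact: measurable_funB.
  exact: continuous_measurable_fun.
have [K K0 HK] := sqr_normal_pdf_le.
have phi0 x : 0 <= phi x by exact: normal_pdf_ge0.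
pose f x := dg x * phi x - (s ^+ 2)^-1 * ((x - m) * g x * phi x).
have -> : s ^+ 2 * \int[mu]_x (dg x * phi x) =
    \int[mu]_x ((x - m) * g x * phi x) + s ^+ 2 * \int[mu]_x f x.
  rewrite RintegralB//; last exact: integrable_cstM.
  rewrite RintegralZl//; move: (gt_eqF s2_gt0) => s2; field.
  by rewrite s0.
rewrite (_ : \int[mu]_x f x = 0) ?mulr0 ?addr0//.
(* The product of [1 + (x - m) ^+ 2] and [phi] is at most the peak of [phi] plus [K] times the peak
   of the wider density. *)
pose K1 := normal_peak s + K * normal_peak (Num.sqrt 2 * s).
apply: (integral_derive_eq0 (F := fun x => g x * phi x) (m := m) (K := c * K1)).
- move=> x; apply: (is_derive_eq (is_derive_mulf (gdg x) (is_derive_normal_pdf x))).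
  by rewrite /f; ring.
- move=> x; apply: cvgB; first by apply: cvgM; [exact: cdg|exact: cphi].
  apply: cvgMl_tmp; apply: cvgM; last exact: cphi.
  by apply: cvgM; [apply: cvgB; [exact: cvg_id|exact: cvg_cst]|exact: cg].
- rewrite (_ : _ \o _ = (fun x => (dg x * phi x)%:E -
      ((s ^+ 2)^-1)%:E * ((x - m) * g x * phi x)%:E)%E)//.
  by apply: integrableB => //; apply: integrableZl.
- move=> x; rewrite normrM (ger0_norm (phi0 x)) mulrAC.
  rewrite (le_trans (ler_wpM2r (phi0 x) (gc x)))// -mulrA ler_wpM2l//.
  rewrite mulrDl mul1r lerD ?normal_pdf_ub//.
  rewrite (le_trans (HK x))// ler_wpM2l// normal_pdf_ub// mulf_neq0// gt_eqF//.
Qed.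

End normal_moments.

Section normal_integrals.
Context {R : realType} (m s : R).
Hypothesis s0 : s != 0.
Local Notation mu := (@lebesgue_measure R).
Local Notation phi := (normal_pdf m s).

(** The Radon-Nikodym derivative of [normal_prob] agrees almost everywhere with [normal_pdf]; the
    quadratic growth bound makes the integrals finite. *)
Lemma normal_prob_integral (f : R -> R) (c : R) : measurable_fun setT f ->
  (forall x, `|f x| <= c * (1 + (x - m) ^+ 2)) ->
  (normal_prob m s).-integrable setT (EFin \o f) /\
  \int[normal_prob m s]_x f x = \int[mu]_x (f x * phi x).
Proof.
move=> mf fc.
have dom := @normal_prob_dominates R m s.
have aeq : ae_eq mu setT (Radon_Nikodym_SigmaFinite.f (normal_prob m s) mu) (EFin \o phi).
  apply: integral_ae_eq => //.
  - exact: Radon_Nikodym_SigmaFinite.f_integrable.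
  - by apply/measurable_EFinP; exact: measurable_normal_pdf.
  - by move=> E _ mE; rewrite -Radon_Nikodym_SigmaFinite.f_integral.
have mphi : measurable_fun setT (EFin \o phi).
  by apply/measurable_EFinP; exact: measurable_normal_pdf.
have mRN : measurable_fun setT (Radon_Nikodym_SigmaFinite.f (normal_prob m s) mu).
  by apply: (measurable_int mu); exact: Radon_Nikodym_SigmaFinite.f_integrable.
have ge0 (h : R -> \bar R) : (forall x, 0 <= h x)%E -> measurable_fun setT h ->
    (\int[normal_prob m s]_x h x = \int[mu]_x (h x * (phi x)%:E))%E.
  move=> h0 mh; rewrite -(Radon_Nikodym_SigmaFinite.change_of_variables dom)//.
  apply: ae_eq_integral => //; try exact: emeasurable_funM.
  exact: ae_eqe_mul2l.
have ifphi : mu.-integrable setT (EFin \o (fun x => f x * phi x)).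
  exact: integrable_normal_pdfM fc.
have intf : (normal_prob m s).-integrable setT (EFin \o f).
  apply/integrableP; split; first exact/measurable_EFinP.
  rewrite ge0//; last by apply: measurableT_comp => //; exact/measurable_EFinP.
  move/integrableP : ifphi => [_]; congr (_ < _)%E.
  apply: eq_integral => x _ /=.
  by rewrite normrM EFinM [`|phi x|]ger0_norm// normal_pdf_ge0.
split => //; rewrite /Rintegral -(Radon_Nikodym_change_of_variables dom measurableT intf).
have aeq' := ae_eq_trans (ae_eq_sym
  (ae_eq_Radon_Nikodym_SigmaFinite dom measurableT)) aeq.
congr fine; apply: ae_eq_integral => //.
- apply: emeasurable_funM; first exact/measurable_EFinP.
  by apply: (measurable_int mu); exact: Radon_Nikodym_integrable.
- exact: (measurable_int mu).
- exact: ae_eqe_mul2l aeq'.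
Qed.

Lemma normal_mean : (normal_prob m s).-integrable setT (EFin \o id) /\
  \int[normal_prob m s]_x x = m.
Proof.
have b (x : R) : `|x - m| <= 1 + (x - m) ^+ 2.
  have := sqr_ge0 (`|x - m| - 1); rewrite sqrrB1 real_normK ?num_real//.
  by have := normr_ge0 (x - m); lra.
have [//| |i e] := @normal_prob_integral id (1 + `|m|).
  move=> x; rewrite -[X in `|X|](subrK m) (le_trans (ler_normD _ _))//.
  rewrite mulrDl mul1r lerD//.
  by rewrite ler_peMr// lerDl sqr_ge0.
split => //; rewrite e.
have i1 : mu.-integrable setT (EFin \o phi) by exact: integrable_normal_pdf.
have intT : \int[mu]_x phi x = 1 by rewrite /Rintegral integral_normal_pdf.
have -> : \int[mu]_x (x * phi x) = \int[mu]_x ((x - m) * 1 * phi x) + m * \int[mu]_x phi x.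
  rewrite -RintegralZl// -RintegralD//; last exact: integrable_cstM.
    by apply: eq_Rintegral => x _ /=; ring.
  by apply: (integrable_normal_pdfM s0 (c := 1)) => [|x];
    [exact: measurable_funM (measurable_funB _ _) _|rewrite mulr1 mul1r].
rewrite intT mulr1 (@normal_stein R m s s0 (fun=> 1) (fun=> 0) 1).
- by rewrite (_ : (fun x => 0 * phi x) = cst 0) ?Rintegral_cst// ?mul0r ?mulr0 ?add0r//;
    apply/funext => x; rewrite /= mul0r.
- by move=> x; exact: cvg_cst.
- by move=> x; rewrite normr0 mul1r addr_ge0// sqr_ge0.
- by move=> x; rewrite normr1 !mul1r.
Qed.

Lemma normal_variance : \int[normal_prob m s]_x (x - m) ^+ 2 = s ^+ 2.
Proof.
have [| |_ ->] := @normal_prob_integral (fun x => (x - m) ^+ 2) 1.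
- by apply: measurable_funX; exact: measurable_funB.
- by move=> x; rewrite mul1r ger0_norm ?sqr_ge0// lerDr.
under eq_Rintegral do rewrite expr2.
have D (x : R) : is_derive x 1 (fun x => x - m) 1.
  by apply: is_derive_eq; rewrite subr0.
rewrite (@normal_stein R m s s0 (fun x => x - m) (fun=> 1) 1 D).
- under eq_Rintegral do rewrite mul1r.
  by rewrite /Rintegral integral_normal_pdf mulr1.
- by move=> x; exact: cvg_cst.
- by move=> x; rewrite normr1 mul1r lerDl sqr_ge0.
- by move=> x; rewrite mul1r -normrM -expr2 ger0_norm ?sqr_ge0// lerDr.
Qed.

End normal_integrals.

Section normal_characteristic.
Context {R : realType} (s : R).
Hypothesis s0 : s != 0.
Local Notation mu := (@lebesgue_measure R).
Local Notation phi := (normal_pdf 0 s).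

Let psi (t : R) := \int[mu]_x (cos (t * x) * phi x).

Let b (x : R) : `|x| <= 1 + x ^+ 2.
Proof.
have := sqr_ge0 (`|x| - 1); rewrite sqrrB1 real_normK ?num_real//.
by have := normr_ge0 x; lra.
Qed.

(** Differentiation under the integral, dominated by [|y| * phi y], gives the integral of
    [- y * sin (t * y) * phi y], which Stein's identity for [sin (t * y)] evaluates. *)
Let psi_deriv (t : R) : is_derive t 1 psi (- (s ^+ 2 * t * psi t)).
Proof.
have itf (x : R) : mu.-integrable setT (EFin \o (fun y => cos (x * y) * phi y)).
  apply: (integrable_normal_pdfM s0 (c := 1)) => [|y].
    apply: continuous_measurable_fun => y; apply: continuous_comp; last exact: continuous_cos.
    by apply: cvgMl_tmp; exact: cvg_id.
  by rewrite mul1r (le_trans (norm_cos_le1 _))// lerDl sqr_ge0.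
have d1 (x y : R) : is_derive x 1 (fun x => cos (x * y) * phi y) (- (y * sin (x * y) * phi y)).
  by apply: is_derive_eq; rewrite /GRing.scale/=; ring.
have iG : mu.-integrable setT (EFin \o (fun y => `|y| * phi y)).
  apply: (integrable_normal_pdfM s0 (c := 1)) => [|y].
    exact: normr_measurable.
  by rewrite subr0 normr_id mul1r.
have Ia : `](t - 1), (t + 1)[%classic t by rewrite /= in_itv/= ltrDl ltrBlDr ltrDl ltr01.
have bound x y : `](t - 1), (t + 1)[%classic x -> setT y ->
    `|partial1of2 (fun x y => cos (x * y) * phi y) x y| <= `|y| * phi y.
  move=> _ _; rewrite partial1of2E (@derive_val _ _ _ _ _ _ _ (d1 x y)).
  rewrite normrN !normrM [`|phi y|]ger0_norm ?normal_pdf_ge0//.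
  rewrite ler_wpM2r ?normal_pdf_ge0// -[leRHS]mulr1 ler_wpM2l// norm_sin_le1//.
have drv := @derivable_under_integral R _ _ mu (fun x y => cos (x * y) * phi y) setT
  measurableT t (t - 1) (t + 1) Ia (fun x _ => itf x)
  (fun x y _ _ => @ex_derive _ _ _ _ _ _ _ (d1 x y)) (fun y => `|y| * phi y)
  (fun y => mulr_ge0 (normr_ge0 y) (normal_pdf_ge0 _ _ _)) iG bound.
have drvE := @differentiation_under_integral R _ _ mu (fun x y => cos (x * y) * phi y) setT
  measurableT t (t - 1) (t + 1) Ia (fun x _ => itf x)
  (fun x y _ _ => @ex_derive _ _ _ _ _ _ _ (d1 x y)) (fun y => `|y| * phi y)
  (fun y => mulr_ge0 (normr_ge0 y) (normal_pdf_ge0 _ _ _)) iG bound.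
apply: DeriveDef; first exact: drv.
rewrite -derive1E [LHS]drvE.
transitivity (\int[mu]_y (- 1 * ((y - 0) * sin (t * y) * phi y))).
  apply: eq_Rintegral => y _; rewrite partial1of2E (@derive_val _ _ _ _ _ _ _ (d1 t y)).
  by rewrite subr0 mulN1r.
rewrite RintegralZl//; last first.
  apply: (integrable_normal_pdfM s0 (c := 1)) => [|y].
    apply: measurable_funM; first exact: measurable_funB.
    apply: continuous_measurable_fun => y; apply: continuous_comp; last exact: continuous_sin.
    by apply: cvgMl_tmp; exact: cvg_id.
  by rewrite subr0 mul1r normrM (le_trans _ (b y))// ler_piMr// norm_sin_le1.
have D (y : R) : is_derive y 1 (fun y => sin (t * y)) (t * cos (t * y)).
  by apply: is_derive_eq; rewrite /GRing.scale/=; ring.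
rewrite (@normal_stein R 0 s s0 (fun y => sin (t * y)) (fun y => t * cos (t * y)) (1 + `|t|) D).
- rewrite mulN1r -mulrA; congr (- (_ * _)).
  under eq_Rintegral do rewrite -mulrA.
  by rewrite RintegralZl.
- move=> x; apply: cvgMl_tmp; apply: continuous_comp; last exact: continuous_cos.
  by apply: cvgMl_tmp; exact: cvg_id.
- move=> x; rewrite normrM subr0 ler_pM// ?lerDr//.
  by rewrite (le_trans (norm_cos_le1 _))// lerDl sqr_ge0.
- move=> x; rewrite subr0 -[leLHS]mulrC mulrC ler_pM//.
  by rewrite (le_trans (norm_sin_le1 _))// lerDl.
Qed.

(** By [psi_deriv] the product of [psi t] and [expR (s ^+ 2 * t ^+ 2 / 2)] has zero derivative, and
    it is [1] at [0]. *)
Lemma normal_cos (t : R) :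
  \int[normal_prob 0 s]_x cos (t * x) = expR (- (s ^+ 2 * t ^+ 2 / 2)).
Proof.
have [| |_ ->] := @normal_prob_integral R 0 s s0 (fun x => cos (t * x)) 1.
- apply: continuous_measurable_fun => y; apply: continuous_comp; last exact: continuous_cos.
  by apply: cvgMl_tmp; exact: cvg_id.
- by move=> x; rewrite mul1r (le_trans (norm_cos_le1 _))// lerDl sqr_ge0.
pose G (t : R) := psi t * expR (s ^+ 2 * t ^+ 2 / 2).
have GE (x : R) : is_derive x 1 G 0.
  have H : is_derive x 1 (fun t => expR (s ^+ 2 * t ^+ 2 / 2))
      (expR (s ^+ 2 * x ^+ 2 / 2) * (s ^+ 2 * x)).
    by apply: is_derive_eq; rewrite /GRing.scale/=; field.
  by apply: (is_derive_eq (is_derive_mulf (psi_deriv x) H)); ring.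
have G0 : G 0 = 1.
  rewrite /G /psi; under eq_Rintegral do rewrite mul0r cos0 mul1r.
  by rewrite /Rintegral integral_normal_pdf expr0n mulr0 mul0r expR0 mulr1.
have : G t = 1 by rewrite -G0; exact: is_derive_0_is_cst.
have e0 : expR (s ^+ 2 * t ^+ 2 / 2) != 0 by rewrite gt_eqF ?expR_gt0.
rewrite /G => h; apply: (mulIf e0).
by rewrite h -expRD addNr expR0.
Qed.

End normal_characteristic.

(** * Transfer of integrals to the law, and Gaussian variables, possibly degenerate *)

Section has_law_integral.
Context {R : realType} d d' (Omega : measurableType d) (T : measurableType d')
  (P : probability Omega R) (X : Omega -> T) (mu : {measure set T -> \bar R}).
Hypothesis X_law : has_law P X mu.

Lemma has_law_ge0_integral (f : T -> \bar R) : measurable_fun setT f ->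
  (forall x, 0 <= f x)%E -> (\int[P]_om f (X om) = \int[mu]_x f x)%E.
Proof.
have [mX PX] := X_law; move=> mf f0.
rewrite -[LHS]/(\int[P]_(om in X @^-1` setT) (f \o X) om)%E.
rewrite -(ge0_integral_pushforward mX)//.
by apply: eq_measure_integral => A mA _; exact: PX.
Qed.

Lemma has_law_integrable (f : T -> \bar R) : measurable_fun setT f ->
  mu.-integrable setT f -> P.-integrable setT (f \o X).
Proof.
have [mX PX] := X_law; move=> mf /integrableP[_ fi]; apply/integrableP; split.
  exact: measurableT_comp.
by rewrite (has_law_ge0_integral (f := fun x => `|f x|%E))//; exact: measurableT_comp.
Qed.

Lemma has_law_Rintegral (f : T -> R) : measurable_fun setT f ->
  mu.-integrable setT (EFin \o f) -> \int[P]_om f (X om) = \int[mu]_x f x.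
Proof.
have [mX PX] := X_law; move=> mf fi; rewrite /Rintegral; congr fine.
have mEf : measurable_fun setT (EFin \o f) by exact/measurable_EFinP.
rewrite -[LHS]/(\int[P]_(om in X @^-1` setT) ((EFin \o f) \o X) om)%E.
rewrite -(integral_pushforward mX)//; last by rewrite preimage_setT; exact: has_law_integrable.
by apply: eq_measure_integral => A mA _; exact: PX.
Qed.

End has_law_integral.

Section gaussian_law.
Context {R : realType} d (Omega : measurableType d) (P : probability Omega R)
  (L : Omega -> R) (m s : R).
Hypothesis L_law : has_law P L (gaussian_law m s).

Let L_law0 : s = 0 -> has_law P L (@dirac _ R m R).
Proof. by move=> s0; move: L_law; rewrite /gaussian_law s0 eqxx. Qed.

Let L_lawN0 : s != 0 -> has_law P (L : Omega -> measurableTypeR R) (normal_prob m s).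
Proof. by move=> /negbTE s0; move: L_law; rewrite /gaussian_law s0. Qed.

Lemma gaussian_integrable_sqr : P.-integrable setT (EFin \o (fun om => L om ^+ 2)).
Proof.
have msq : measurable_fun setT (fun x : measurableTypeR R => (x ^+ 2)%:E).
  by apply/measurable_EFinP; exact: measurable_funX.
rewrite (_ : EFin \o _ = (fun x : measurableTypeR R => (x ^+ 2)%:E) \o L)//.
have [/L_law0 law|s0] := eqVneq s 0.
  apply: (has_law_integrable law) => //.
  apply/integrableP; split => //.
  by rewrite integral_dirac// ?diracT ?mul1e ?ltry//; exact: measurableT_comp.
apply: (has_law_integrable (L_lawN0 s0)) => //.
have [|x|] := @normal_prob_integral R m s s0 (fun x => x ^+ 2) (2 + 2 * m ^+ 2) => //.
rewrite ger0_norm ?sqr_ge0//.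
have := sqr_ge0 (x - m - m); have := sqr_ge0 (x - m); have := sqr_ge0 m.
have := mulr_ge0 (sqr_ge0 m) (sqr_ge0 (x - m)).
move: (x - m) (subrK m x) => y <-; nra.
Qed.

(** A zero mean forces [m = 0]. If [s = 0], the law is then the point mass at [0] and both sides are
    [1]; otherwise [v = s ^+ 2] and [normal_cos] applies at [1]. *)
Lemma gaussian_centered_cos (v : R) : \int[P]_om L om = 0 ->
  \int[P]_om (L om ^+ 2) = v -> \int[P]_om cos (L om) = expR (- (v / 2)).
Proof.
have mid : measurable_fun setT (fun x : measurableTypeR R => x) by exact: measurable_id.
have msq : measurable_fun setT (fun x : measurableTypeR R => x ^+ 2).
  exact: measurable_funX.
have mcos : measurable_fun setT (cos : measurableTypeR R -> R).
  by apply: continuous_measurable_fun; exact: continuous_cos.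
have [/L_law0 law|s0] := eqVneq s 0.
  have idir (f : measurableTypeR R -> R) : measurable_fun setT f ->
      \int[P]_om f (L om) = f m.
    move=> mf; have mEf : measurable_fun setT (EFin \o f) by exact/measurable_EFinP.
    rewrite (has_law_Rintegral law)//.
      by rewrite /Rintegral integral_dirac// diracT mul1e.
    apply/integrableP; split => //.
    by rewrite integral_dirac// ?diracT ?mul1e ?ltry//; exact: measurableT_comp.
  rewrite (idir (fun x => x))// (idir (fun x => x ^+ 2))// (idir cos)// => -> <-.
  by rewrite cos0 expr0n/= mul0r oppr0 expR0.
have law := L_lawN0 s0.
have [im em] := normal_mean m s0.
rewrite (has_law_Rintegral law (f := fun x => x))// em => m0.
have law0 : has_law P (L : Omega -> measurableTypeR R) (normal_prob 0 s) by rewrite -m0.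
have [|x|i2 _] := @normal_prob_integral R 0 s s0 (fun x => x ^+ 2) 1.
- exact: measurable_funX.
- by rewrite mul1r subr0 ger0_norm ?sqr_ge0// lerDr.
have [|x|ic _] := @normal_prob_integral R 0 s s0 cos 1.
- exact: mcos.
- by rewrite mul1r (le_trans (norm_cos_le1 _))// lerDl sqr_ge0.
rewrite (has_law_Rintegral law0 (f := fun x => x ^+ 2))//.
rewrite (has_law_Rintegral law0 (f := cos))//.
have := normal_variance 0 s0; under eq_Rintegral do rewrite subr0.
move=> -> <-; have := normal_cos s0 1; under eq_Rintegral do rewrite mul1r.
by move=> ->; rewrite expr1n mulr1.
Qed.

End gaussian_law.

(** * Quantization of R^p by nearest rational points *)

Section quantizer.
Context {R : realType} {p : nat}.
Local Notation V := 'rV[R]_p.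

Lemma continuous_measurable_rV (f : V -> R) : continuous f -> measurable_fun setT f.
Proof.
move=> cf; apply: (measurability _ (RGenOpens.measurableE R)) => _ [_ [a [b ->]] <-].
rewrite setTI; apply: sub_sigma_algebra.
by apply: open_comp; [move=> x _; exact: cf|exact: interval_open].
Qed.

Lemma measurable_rVD d (T : measurableType d) (f g : T -> V) :
  measurable_fun setT f -> measurable_fun setT g ->
  measurable_fun setT (fun x => f x - g x).
Proof.
move=> mf mg; apply: measurable_fun_rV => i; under eq_fun do rewrite !mxE.
apply: measurable_funB; first exact: measurableT_comp (measurable_coord i) mf.
exact: measurableT_comp (measurable_coord i) mg.
Qed.

Lemma measurable_rV_norm d (T : measurableType d) (f : T -> V) :
  measurable_fun setT f -> measurable_fun setT (fun x => `|f x|).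
Proof.
move=> mf; apply: (measurableT_comp (f := fun x : V => `|x|)) => //.
by apply: continuous_measurable_rV => x; exact: norm_continuous.
Qed.

Definition rat_point (i : nat) : V :=
  if unpickle i is Some v then \row_j ratr ((v : 'rV[rat]_p) ord0 j) else 0.

Lemma rat_point_dense (t : V) (e : R) : 0 < e -> exists i, `|t - rat_point i| <= e.
Proof.
move=> e0.
have /choice[v vP] : forall j, exists a : rat, ratr a \in `](t ord0 j - e), (t ord0 j + e)[%R.
  by move=> j; apply: rat_in_itvoo; rewrite ltrBlDr -addrA ltrDl addr_gt0.
exists (pickle (\row_j v j)); rewrite /rat_point pickleK.
rewrite [leLHS]/Num.Def.normr /= mx_normrE; apply/bigmax_leP; split => [|[i j] _ /=].
  exact: ltW.
rewrite (ord1 i) !mxE; have := vP j; rewrite in_itv/= => /andP[a b].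
by rewrite distrC ler_distl !ltW.
Qed.

(* A point nearest to [t] among the first [j.+1] rational points. *)
Fixpoint quantizer (j : nat) (t : V) : V :=
  if j is j'.+1 then
    if `|t - rat_point j| < `|t - quantizer j' t| then rat_point j else quantizer j' t
  else rat_point 0.

Lemma quantizer_le i j t : (i <= j)%N -> `|t - quantizer j t| <= `|t - rat_point i|.
Proof.
elim: j => [|j IH]; first by rewrite leqn0 => /eqP ->.
rewrite leq_eqVlt ltnS => /predU1P[->/=|/IH h /=]; case: ltP => // h'.
exact: le_trans (ltW h') h.
Qed.

Lemma quantizer_cvg t : `|t - quantizer j t| @[j --> \oo] --> (0 : R).
Proof.
apply/cvgr0Pnorm_le => e e0; have [i ti] := rat_point_dense t e0.
near=> j; rewrite normr_id (le_trans _ ti)// quantizer_le//.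
by near: j; exact: nbhs_infty_ge.
Unshelve. all: by end_near. Qed.

Let measurable_dist j : measurable_fun setT (quantizer j) ->
  measurable_fun setT (fun t : V => `|t - rat_point j.+1| < `|t - quantizer j t|).
Proof.
move=> mq; apply: measurable_fun_ltr; apply: measurable_rV_norm; apply: measurable_rVD => //.
Qed.

Lemma measurable_quantizer j : measurable_fun setT (quantizer j).
Proof.
elim: j => [|j IH]; first exact: measurable_cst.
by apply: measurable_fun_ifT => //; exact: measurable_dist.
Qed.

Lemma measurable_quantizer_comp j (u : V -> R) :
  measurable_fun setT (fun t => u (quantizer j t)).
Proof.
elim: j => [|j IH]; first exact: (measurable_cst (u (rat_point 0))).
rewrite (_ : (fun t => _) = fun t => if `|t - rat_point j.+1| < `|t - quantizer j t|
    then u (rat_point j.+1) else u (quantizer j t)); last first.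
  by apply/funext => t /=; case: ifP.
by apply: measurable_fun_ifT => //; apply: measurable_dist; exact: measurable_quantizer.
Qed.

Section quantized_integral.
Context (mu : {measure set V -> \bar R}) (w : V -> R).
Hypotheses (mw : measurable_fun setT w) (w0 : forall t, 0 <= w t)
  (iw : (\int[mu]_t (w t)%:E < +oo)%E).

(* Each quantizer takes finitely many values. *)
Lemma quantized_integral j : exists2 l : seq (R * V), (forall x, x \in l -> 0 <= x.1) &
  forall u : V -> R, (forall t, 0 <= u t) ->
    (\int[mu]_t (u (quantizer j t) * w t)%:E = (\sum_(x <- l) x.1 * u x.2)%:E)%E.
Proof.
(* The induction needs arbitrary domains, as each new rational point splits the domain into the part
   where it is nearer than the previous choice and the rest. *)
suff H : forall A : set V, measurable A ->
    exists2 l : seq (R * V), (forall x, x \in l -> 0 <= x.1) &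
      forall u : V -> R, (forall t, 0 <= u t) ->
      (\int[mu]_(t in A) (u (quantizer j t) * w t)%:E = (\sum_(x <- l) x.1 * u x.2)%:E)%E.
  exact: H.
have wA (A : set V) (v : V) (u : V -> R) : measurable A -> (forall t, 0 <= u t) ->
    (\int[mu]_(t in A) (u v * w t)%:E = (fine (\int[mu]_(t in A) (w t)%:E) * u v)%:E)%E.
  move=> mA u0.
  rewrite EFinM fineK; last first.
    rewrite ge0_fin_numE; last by apply: integral_ge0 => t _; rewrite lee_fin.
    apply: le_lt_trans iw; apply: ge0_subset_integral => //.
    - exact/measurable_EFinP.
    - by move=> t _; rewrite lee_fin.
  under eq_integral do rewrite EFinM.
  rewrite ge0_integralZl//; first by rewrite muleC.
  - by apply/measurable_EFinP; exact: measurable_funTS.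
  - by move=> t _; rewrite lee_fin.
  - by rewrite lee_fin.
elim: j => [|j IH] A mA.
  exists [:: (fine (\int[mu]_(t in A) (w t)%:E)%E, rat_point 0)] => [x|u u0].
    rewrite inE => /eqP ->; apply: fine_ge0; apply: integral_ge0 => t _.
    by rewrite lee_fin.
  by rewrite big_seq1 /= wA.
pose B := [set t : V | `|t - rat_point j.+1| < `|t - quantizer j t|].
have mB : measurable B.
  have := measurable_dist (measurable_quantizer j).
  move=> /(_ measurableT [set true]); rewrite setTI; exact.
have [l l0 lE] := IH (A `\` B) (measurableD mA mB).
exists ((fine (\int[mu]_(t in A `&` B) (w t)%:E)%E, rat_point j.+1) :: l) => [x|u u0].
  rewrite inE => /predU1P[->/=|/l0//]; apply: fine_ge0; apply: integral_ge0 => t _.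
  by rewrite lee_fin.
rewrite big_cons/= EFinD -lE// -wA//; last exact: measurableI.
rewrite -[in LHS](setUIDK A B) ge0_integral_setU//; first last.
- by rewrite disj_set2E; apply/eqP/seteqP; split => // t [[_ ?] [_ /(_ _)]].
- by move=> t _; rewrite lee_fin mulr_ge0.
- apply: measurable_funTS; apply/measurable_EFinP; apply: measurable_funM => //.
  exact: (measurable_quantizer_comp j.+1 u).
- exact: measurableD.
- exact: measurableI.
congr (_ + _)%E; apply: eq_integral => t; rewrite inE /B/= => -[_ tB].
  by rewrite tB.
by move/negP : tB => /negbTE ->.
Qed.

End quantized_integral.
End quantizer.

(** * Fubini's theorem for bounded functions on a product of probability spaces *)

Section bounded_fubini.
Context d1 d2 (T1 : measurableType d1) (T2 : measurableType d2) (R : realType)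
  (P : probability T1 R) (Q : probability T2 R) (f : T1 -> T2 -> R) (B : R).
Hypotheses (mf : measurable_fun setT (fun x : T1 * T2 => f x.1 x.2))
  (fB : forall x y, `|f x y| <= B).

Let m1 x : measurable_fun setT (f x).
Proof. exact: (measurableT_comp mf (pair1_measurable x)). Qed.

Let m2 y : measurable_fun setT (f ^~ y).
Proof. exact: (measurableT_comp mf (pair2_measurable y)). Qed.

Let e1 x : ((\int[Q]_y f x y)%:E = \int[Q]_y (f x y)%:E)%E.
Proof.
by rewrite fineK// (integrable_fin_num measurableT (integrable_bounded B (m1 x) (fB x))).
Qed.

Let e2 y : ((\int[P]_x f x y)%:E = \int[P]_x (f x y)%:E)%E.
Proof.
by rewrite fineK// (integrable_fin_num measurableT (integrable_bounded B (m2 y) (fB ^~ y))).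
Qed.

Let intf : (P \x Q)%E.-integrable setT (fun x => (f x.1 x.2)%:E).
Proof.
apply: measurable_bounded_integrable => //.
  rewrite -setXTT [X in (X < _)%E]product_measure1E// lte_mul_pinfty//.
    exact: fin_num_measure.
  by rewrite [X in (X < _)%E]probability_setT ltry.
exists B; split; first exact: num_real.
by move=> M BM [x y] _ /=; rewrite (le_trans (fB x y))// ltW.
Qed.

Lemma Rintegral_bounded_fubini :
  \int[P]_x \int[Q]_y f x y = \int[Q]_y \int[P]_x f x y.
Proof.
rewrite {1}/Rintegral [RHS]/Rintegral; congr fine.
under eq_integral do rewrite e1.
under [RHS]eq_integral do rewrite e2.
exact: (Fubini intf).
Qed.

Lemma measurable_bounded_Rintegral : measurable_fun setT (fun y => \int[P]_x f x y).
Proof.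
by apply/measurable_EFinP; rewrite (_ : _ \o _ = fubini_G P (fun x => (f x.1 x.2)%:E));
  [exact: (measurable_fubini_G intf)|apply/funext => y; exact: e2].
Qed.

End bounded_fubini.

Lemma fine_le_id (R : realType) (x : \bar R) : (0 <= x)%E -> ((fine x)%:E <= x)%E.
Proof. by case: x => //= _; rewrite leey. Qed.

Lemma expRN_lipschitz (R : realType) (a b : R) : 0 <= a -> 0 <= b ->
  `|expR (- a) - expR (- b)| <= `|a - b|.
Proof.
wlog ab : a b / a <= b.
  move=> H a0 b0; have [ab|/ltW ba] := leP a b; first exact: H.
  by rewrite distrC [leRHS]distrC; exact: H.
move=> a0 b0; rewrite distrC [leRHS]distrC [leRHS]ger0_norm ?subr_ge0//.
rewrite -[leRHS]mul1r.
apply: (@derive_le_norm R (fun x => expR (- x)) (fun x => - expR (- x))) => // x.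
  by apply: is_derive_eq; rewrite /GRing.scale/= mulrN1.
move=> /andP[ax _]; rewrite normrN ger0_norm ?expR_ge0//.
by rewrite -expR0 ler_expR oppr_le0 (le_trans a0).
Qed.

(** * Random fields: the energy, its quantization and its convergence in law *)

Section random_field.
Context {R : realType} {p : nat}.
Local Notation V := 'rV[R]_p.
Context (w : V -> R) (w_weight : weight_function w).
Local Notation leb := (lebesgue_rV R p).

Let mw : measurable_fun setT w. Proof. by case: w_weight. Qed.
Let w0 t : 0 <= w t. Proof. by case: w_weight. Qed.
Let iw : (\int[leb]_t (w t)%:E < +oo)%E. Proof. by case: w_weight. Qed.

Let integrable_w : leb.-integrable setT (EFin \o w).
Proof.
apply/integrableP; split; first exact/measurable_EFinP.
by under eq_integral do rewrite /= ger0_norm//.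
Qed.

(** Truncation at [1] keeps the integrand below [w], of which only the total integral is assumed
    finite; it matches the truncation in [sqr_diff_mean_le]. *)
Definition quantization_error (j : nat) : R :=
  \int[leb]_t (Num.min 1 `|t - quantizer j t| * w t).

Let measurable_err j : measurable_fun setT (fun t : V => Num.min 1 `|t - quantizer j t| * w t).
Proof.
apply: measurable_funM => //; apply: measurable_minr => //.
apply: measurable_rV_norm; apply: measurable_rVD => //; exact: measurable_quantizer.
Qed.

Let err_ge0 j t : 0 <= Num.min 1 `|t - quantizer j t| * w t.
Proof. by rewrite mulr_ge0// le_min ler01 normr_ge0. Qed.

Let quantization_errorE j :
  (\int[leb]_t (Num.min 1 `|t - quantizer j t| * w t)%:E = (quantization_error j)%:E)%E.
Proof.
rewrite /quantization_error /Rintegral fineK// ge0_fin_numE; last first.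
  by apply: integral_ge0 => t _; rewrite lee_fin.
apply: le_lt_trans iw; apply: ge0_le_integral => //.
- by move=> t _; rewrite lee_fin.
- exact/measurable_EFinP.
- exact/measurable_EFinP.
- by move=> t _; rewrite lee_fin ler_piMl// ge_min lexx.
Qed.

Lemma quantization_error_cvg0 : quantization_error j @[j --> \oo] --> (0 : R).
Proof.
suff : (\int[leb]_t (Num.min 1 `|t - quantizer j t| * w t)%:E @[j --> \oo] -->
    \int[leb]_t (cst 0%E) t)%E.
  by rewrite integral0 => /fine_cvg.
apply: (@dominated_cvg _ _ _ leb setT measurableT _ _ (fun t => (w t)%:E)) => //.
- by move=> j; exact/measurable_EFinP.
- move=> t _; apply: cvg_EFin; first exact: nearW.
  rewrite (_ : 0 = 0 * w t); last by rewrite mul0r.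
  apply: cvgMr_tmp.
  apply: (@squeeze_cvgr _ _ _ _ (cst 0) (fun j => `|t - quantizer j t|)).
  + by apply: nearW => j; rewrite le_min ler01 normr_ge0/= ge_min lexx orbT.
  + exact: cvg_cst.
  + exact: quantizer_cvg.
- by move=> j t _; rewrite lee_fin ger0_norm// ler_piMl// ge_min lexx.
Qed.

Section one_field.
Context d (T : measurableType d) (P : probability T R) (U : V -> T -> R) (C : R).
Hypothesis mU : measurable_fun setT (fun x : V * T => U x.1 x.2).
Hypothesis U_sqr : forall t, (\int[P]_om (U t om ^+ 2)%:E <= C%:E)%E.
Hypothesis U_incr : forall s t,
  (\int[P]_om ((U t om - U s om) ^+ 2)%:E <= (C * `|t - s| ^+ 2)%:E)%E.

Definition energy (om : T) : R := \int[leb]_t (U t om ^+ 2 * w t).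

Let mUt t : measurable_fun setT (U t).
Proof. exact: (measurableT_comp mU (pair1_measurable t)). Qed.

Let mUo om : measurable_fun setT (U ^~ om).
Proof. exact: (measurableT_comp mU (pair2_measurable om)). Qed.

Let C0 : 0 <= C.
Proof.
rewrite -lee_fin (le_trans _ (U_sqr 0))// integral_ge0// => om _.
by rewrite lee_fin sqr_ge0.
Qed.

Let msqr : measurable_fun setT (fun x : V * T => (U x.1 x.2 ^+ 2 * w x.1)%:E).
Proof.
apply/measurable_EFinP; apply: measurable_funM; first exact: measurable_funX.
by apply: measurableT_comp => //; exact: measurable_fst.
Qed.

Let sqr_ge0' (x : V * T) : (0 <= (U x.1 x.2 ^+ 2 * w x.1)%:E)%E.
Proof. by rewrite lee_fin mulr_ge0// sqr_ge0. Qed.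

Lemma measurable_energy : measurable_fun setT energy.
Proof.
apply: measurableT_comp => //.
exact: (measurable_fun_fubini_tonelli_G _ msqr sqr_ge0').
Qed.

Lemma energy_ge0 om : 0 <= energy om.
Proof. by apply: Rintegral_ge0 => t _; rewrite mulr_ge0// sqr_ge0. Qed.

Lemma energy_mean_le : (\int[P]_om (energy om)%:E <= (C * \int[leb]_t w t)%:E)%E.
Proof.
(* The energy is at most the extended integral: where the latter is infinite, [fine] gives [0]. *)
apply: (@le_trans _ _ (\int[P]_om \int[leb]_t (U t om ^+ 2 * w t)%:E)%E).
  apply: ge0_le_integral => //.
  - by move=> om _; rewrite lee_fin energy_ge0.
  - by apply/measurable_EFinP; exact: measurable_energy.
  - exact: (measurable_fun_fubini_tonelli_G _ msqr sqr_ge0').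
  - by move=> om _; apply: fine_le_id; apply: integral_ge0 => t _; exact: (sqr_ge0' (t, om)).
rewrite -(fubini_tonelli (fun x => (U x.1 x.2 ^+ 2 * w x.1)%:E) msqr sqr_ge0')/=.
have -> : ((C * \int[leb]_t w t)%:E = \int[leb]_t (C%:E * (w t)%:E))%E.
  rewrite ge0_integralZl//; last by move=> t _; rewrite lee_fin.
    by rewrite EFinM /Rintegral fineK// integrable_fin_num.
  exact/measurable_EFinP.
apply: ge0_le_integral => //.
- by move=> t _; apply: integral_ge0 => om _; exact: (sqr_ge0' (t, om)).
- exact: (measurable_fun_fubini_tonelli_F _ msqr sqr_ge0').
- by apply: measurable_funeM; exact/measurable_EFinP.
- move=> t _; under eq_integral do rewrite EFinM.
  rewrite ge0_integralZr//.
  + by rewrite lee_wpmul2r// lee_fin.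
  + by apply/measurable_EFinP; exact: measurable_funX.
  + by move=> om _; rewrite lee_fin sqr_ge0.
  + by rewrite lee_fin.
Qed.

(** From distance [1] on, the second moments suffice. Below it, with [del] the distance, the bound
    [(a - b) ^+ 2 / (2 * del) + del * (a ^+ 2 + b ^+ 2)] on [|a ^+ 2 - b ^+ 2|] has mean at most
    [5 / 2 * C * del]. *)
Let sqr_diff_mean_le s t :
  (\int[P]_om (`|U t om ^+ 2 - U s om ^+ 2|)%:E <= (3 * C * Num.min 1 `|t - s|)%:E)%E.
Proof.
have msq r : measurable_fun setT (fun om => (U r om ^+ 2)%:E).
  by apply/measurable_EFinP; exact: measurable_funX.
have mabs : measurable_fun setT (fun om => (`|U t om ^+ 2 - U s om ^+ 2|)%:E).
  apply/measurable_EFinP; apply: measurableT_comp => //.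
  by apply: measurable_funB; exact: measurable_funX.
have mdiff : measurable_fun setT (fun om => ((U t om - U s om) ^+ 2)%:E).
  by apply/measurable_EFinP; apply: measurable_funX; exact: measurable_funB.
have sum_le (a b : R) : 0 <= a -> 0 <= b ->
    (forall om, `|U t om ^+ 2 - U s om ^+ 2| <=
      a * (U t om - U s om) ^+ 2 + b * (U t om ^+ 2 + U s om ^+ 2)) ->
    (\int[P]_om (`|U t om ^+ 2 - U s om ^+ 2|)%:E <=
      (a * (C * `|t - s| ^+ 2) + b * (C + C))%:E)%E.
  move=> a0 b0 ab.
  apply: (@le_trans _ _ (\int[P]_om (a%:E * ((U t om - U s om) ^+ 2)%:E +
      b%:E * ((U t om ^+ 2)%:E + (U s om ^+ 2)%:E)))%E).
    apply: ge0_le_integral => //.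
    - apply: emeasurable_funD; first exact: measurable_funeM.
      by apply: measurable_funeM; exact: emeasurable_funD.
    - move=> om _; rewrite -[leRHS]/((a * (U t om - U s om) ^+ 2 +
        b * (U t om ^+ 2 + U s om ^+ 2))%:E) lee_fin; exact: ab.
  rewrite ge0_integralD//; last 4 first.
  - by move=> om _; rewrite mule_ge0// lee_fin// sqr_ge0.
  - exact: measurable_funeM.
  - by move=> om _; rewrite mule_ge0 ?adde_ge0// lee_fin// sqr_ge0.
  - by apply: measurable_funeM; exact: emeasurable_funD.
  rewrite !ge0_integralZl//; last 3 first.
  - exact: emeasurable_funD.
  - by move=> om _; rewrite adde_ge0// lee_fin sqr_ge0.
  - by move=> om _; rewrite lee_fin sqr_ge0.
  rewrite ge0_integralD//; last 2 first.
  - by move=> om _; rewrite lee_fin sqr_ge0.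
  - by move=> om _; rewrite lee_fin sqr_ge0.
  by rewrite EFinD !EFinM leeD// lee_wpmul2l// ?EFinD ?leeD// EFinM.
have [ts|ts] := leP 1 `|t - s|.
  apply: (le_trans (sum_le 0 1 _ _ _)) => //.
    move=> om; rewrite mul0r add0r mul1r (le_trans (ler_normB _ _))//.
    by rewrite !ger0_norm ?sqr_ge0.
  by rewrite lee_fin; move: C0; lra.
have [/eqP|ts0] := eqVneq `|t - s| 0.
  rewrite normr_eq0 subr_eq0 => /eqP ->; rewrite subrr normr0 mulr0.
  by rewrite integral0_eq// => om _; rewrite subrr normr0.
have d0 : 0 < `|t - s| by rewrite lt_neqAle eq_sym ts0/=.
move: d0 sum_le ts; set del := `|t - s| => d0 sum_le d1.
apply: (le_trans (sum_le (2 * del)^-1 del _ _ _)); rewrite ?invr_ge0 ?mulr_ge0 ?(ltW d0)//.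
  move=> om; move: (U t om) (U s om) => a b.
  rewrite subr_sqr normrM.
  have -> : (2 * del)^-1 * (a - b) ^+ 2 + del * (a ^+ 2 + b ^+ 2) =
      `|a - b| * `|a + b| + ((`|a - b| - del * `|a + b|) ^+ 2 / (2 * del)
        + del / 2 * (a - b) ^+ 2).
    have hx : `|a - b| ^+ 2 = (a - b) ^+ 2 by rewrite real_normK ?num_real.
    have hy : `|a + b| ^+ 2 = (a + b) ^+ 2 by rewrite real_normK ?num_real.
    have del0 := lt0r_neq0 d0.
    transitivity (`|a - b| ^+ 2 / (2 * del) + del / 2 * `|a + b| ^+ 2 + del / 2 * (a - b) ^+ 2).
      by rewrite hx hy; field.
    by field.
  rewrite lerDl addr_ge0//.
    by apply: divr_ge0; [exact: sqr_ge0|rewrite mulr_ge0// ltW].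
  by rewrite mulr_ge0 ?sqr_ge0// divr_ge0// ltW.
rewrite lee_fin (_ : _ + _ = (5 / 2) * (C * del)); last by field; rewrite gt_eqF.
rewrite -[leRHS]mulrA ler_wpM2r ?mulr_ge0 ?(ltW d0)//; lra.
Qed.

Definition quad_form (l : seq (R * V)) (om : T) : R := \sum_(x <- l) x.1 * U x.2 om ^+ 2.

Definition lin_form (l : seq (R * V)) (om : T) : R := \sum_(x <- l) x.1 * U x.2 om.

Let measurable_quad_form l : measurable_fun setT (quad_form l).
Proof. by apply: measurable_sum => x; apply: measurable_funM => //; exact: measurable_funX. Qed.

Let measurable_lin_form l : measurable_fun setT (lin_form l).
Proof. by apply: measurable_sum => x; apply: measurable_funM. Qed.

(** The quadratic form is the energy of the quantized field, so the distance is at most the integral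
    of [|U t ^+ 2 - U (quantizer j t) ^+ 2| * w t]; Tonelli's theorem and [sqr_diff_mean_le] bound
    its mean. *)
Let energy_quad_form_dist j l :
  (forall u : V -> R, (forall t, 0 <= u t) ->
    (\int[leb]_t (u (quantizer j t) * w t)%:E = (\sum_(x <- l) x.1 * u x.2)%:E)%E) ->
  (\int[P]_om (`|energy om - quad_form l om|)%:E <= (3 * C * quantization_error j)%:E)%E.
Proof.
move=> lE.
pose q (x : V * T) := U (quantizer j x.1) x.2.
have mq : measurable_fun setT q.
  apply: (measurableT_comp (f := fun x : V * T => U x.1 x.2)
    (g := fun x : V * T => (quantizer j x.1, x.2))) => //.
  apply/measurable_fun_pairP; split => /=; last exact: measurable_snd.
  by apply: (measurableT_comp (measurable_quantizer j)); exact: measurable_fst.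
pose h (x : V * T) : \bar R := (`|U x.1 x.2 ^+ 2 - q x ^+ 2| * w x.1)%:E.
have mh : measurable_fun setT h.
  apply/measurable_EFinP; apply: measurable_funM.
    by apply: measurableT_comp => //; apply: measurable_funB; exact: measurable_funX.
  by apply: measurableT_comp => //; exact: measurable_fst.
have h0 x : (0 <= h x)%E by rewrite lee_fin mulr_ge0.
have dist om : ((`|energy om - quad_form l om|)%:E <= \int[leb]_t h (t, om))%E.
  have msq : measurable_fun setT (fun t => (U t om ^+ 2 * w t)%:E).
    by apply/measurable_EFinP; apply: measurable_funM => //; exact: measurable_funX.
  have mqo : measurable_fun setT (fun t => q (t, om)).
    exact: (measurableT_comp mq (pair2_measurable om)).
  have mqsq : measurable_fun setT (fun t => (q (t, om) ^+ 2 * w t)%:E).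
    by apply/measurable_EFinP; apply: measurable_funM => //; exact: measurable_funX.
  have mho : measurable_fun setT (fun t => h (t, om)).
    exact: (measurableT_comp mh (pair2_measurable om)).
  have qE : (\int[leb]_t (q (t, om) ^+ 2 * w t)%:E = (quad_form l om)%:E)%E.
    by rewrite (lE (fun t => U t om ^+ 2))// => t; exact: sqr_ge0.
  (* If this integral is infinite the bound is trivial; otherwise the difference is integrable,
     hence so is [U t om ^+ 2 * w t], and the integrals may be subtracted. *)
  have [hoo|hfin] := eqVneq (\int[leb]_t h (t, om))%E +oo%E; first by rewrite hoo leey.
  have iq : leb.-integrable setT (EFin \o (fun t => q (t, om) ^+ 2 * w t)).
    apply/integrableP; split => //.
    rewrite (_ : (\int[leb]_t _)%E = (quad_form l om)%:E) ?ltry// -qE.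
    by apply: eq_integral => t _; rewrite /= ger0_norm// mulr_ge0// sqr_ge0.
  have ih : leb.-integrable setT (fun t => h (t, om)).
    apply/integrableP; split => //.
    rewrite (_ : (\int[leb]_t _)%E = \int[leb]_t h (t, om))%E ?ltey//.
    by apply: eq_integral => t _; rewrite gee0_abs.
  have idiff : leb.-integrable setT (EFin \o (fun t => U t om ^+ 2 * w t - q (t, om) ^+ 2 * w t)).
    apply: (le_integrable _ _ _ ih) => //.
      by apply/measurable_EFinP; apply: measurable_funB; exact/measurable_EFinP.
    by move=> t _; rewrite /h/= lee_fin -mulrBl normrM (ger0_norm (w0 t))
      [leRHS]ger0_norm// mulr_ge0.
  have iU : leb.-integrable setT (EFin \o (fun t => U t om ^+ 2 * w t)).
    have := integrableD measurableT idiff iq; apply: eq_integrable => // t _ /=.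
    by rewrite -EFinD subrK.
  have -> : quad_form l om = \int[leb]_t (q (t, om) ^+ 2 * w t) by rewrite /Rintegral qE.
  rewrite /energy -RintegralB//.
  rewrite EFin_normr_Rintegral//.
  apply: le_trans (le_abse_integral _ _ _) _ => //; first exact: (measurable_int leb).
  rewrite le_eqVlt; apply/orP; left; apply/eqP; apply: eq_integral => t _.
  by rewrite /h/= -mulrBl normrM (ger0_norm (w0 t)).
apply: (@le_trans _ _ (\int[P]_om \int[leb]_t h (t, om))%E).
  apply: ge0_le_integral => //.
  - apply/measurable_EFinP; apply: measurableT_comp => //.
    by apply: measurable_funB => //; exact: measurable_energy.
  - exact: (measurable_fun_fubini_tonelli_G _ mh h0).
rewrite -(fubini_tonelli h mh h0)/= EFinM -quantization_errorE.
rewrite -ge0_integralZl//; last 3 first.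
- exact/measurable_EFinP.
- by move=> t _; rewrite lee_fin.
- by rewrite lee_fin mulr_ge0.
apply: ge0_le_integral => //.
- by move=> t _; apply: integral_ge0 => om _; exact: h0.
- exact: (measurable_fun_fubini_tonelli_F _ mh h0).
- by apply: measurable_funeM; exact/measurable_EFinP.
- move=> t _; rewrite /h/=; under eq_integral do rewrite EFinM.
  rewrite ge0_integralZr//.
  + rewrite -EFinM mulrA EFinM lee_wpmul2r ?lee_fin//.
    exact: (sqr_diff_mean_le (quantizer j t) t).
  + apply/measurable_EFinP; apply: measurableT_comp => //.
    by apply: measurable_funB; apply: measurable_funX; [exact: mUt|exact: (mUt (quantizer j t))].
  + by rewrite lee_fin.
Qed.

(** On nonnegative arguments [expR (- x)] is 1-Lipschitz, so the mean distance of the exponents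
    controls that of the transforms. *)
Lemma laplace_energy_dist j l (c : R) : 0 <= c -> (forall x, x \in l -> 0 <= x.1) ->
  (forall u : V -> R, (forall t, 0 <= u t) ->
    (\int[leb]_t (u (quantizer j t) * w t)%:E = (\sum_(x <- l) x.1 * u x.2)%:E)%E) ->
  `|\int[P]_om expR (- (c * energy om)) - \int[P]_om expR (- (c * quad_form l om))| <=
  c * (3 * C * quantization_error j).
Proof.
move=> c0 l0 lE.
have q0 om : 0 <= quad_form l om.
  by rewrite /quad_form big_seq sumr_ge0// => x /l0 ?; rewrite mulr_ge0// sqr_ge0.
have expB (Y : T -> R) om : (forall om, 0 <= Y om) -> `|expR (- (c * Y om))| <= 1.
  by move=> Y0; rewrite ger0_norm ?expR_ge0// -expR0 ler_expR oppr_le0 mulr_ge0.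
have mexp (Y : T -> R) : measurable_fun setT Y ->
    measurable_fun setT (fun om => expR (- (c * Y om))).
  move=> mY; apply: measurableT_comp => //; apply: measurable_funN.
  exact: measurable_funM.
have me := measurable_energy; have mq := measurable_quad_form l.
rewrite -RintegralB//; last 2 first.
- by apply: (integrable_bounded 1 (mexp _ me)) => om; apply: expB; exact: energy_ge0.
- by apply: (integrable_bounded 1 (mexp _ mq)) => om; exact: expB.
rewrite -[leRHS]addr0.
apply: (norm_Rintegral_le (X := fun om => `|energy om - quad_form l om|)) => //.
- by apply: measurable_funB; exact: mexp.
- by apply: measurableT_comp => //; exact: measurable_funB.
- exact: energy_quad_form_dist.
move=> om; rewrite addr0.
have -> : c * `|energy om - quad_form l om| = `|c * energy om - c * quad_form l om|.
  by rewrite -mulrBr normrM (ger0_norm c0).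
have h1 : 0 <= c * energy om by rewrite mulr_ge0// energy_ge0.
have h2 : 0 <= c * quad_form l om by rewrite mulr_ge0.
exact: expRN_lipschitz.
Qed.

(** A mixed transform, Laplace in the squares listed in [l] and Fourier in the linear form [b]. It
    joins the Laplace transform of a quadratic form, at [b] empty, to the cosine transforms of
    linear forms, at [l] empty. *)
Definition laplace_fourier (l b : seq (R * V)) : R :=
  \int[P]_om (expR (- quad_form l om) * cos (lin_form b om)).

Let measurable_expN l : measurable_fun setT (fun om => expR (- quad_form l om)).
Proof. by apply: measurableT_comp => //; exact: measurable_funN. Qed.

Let measurable_cos_lin b : measurable_fun setT (fun om => cos (lin_form b om)).
Proof.
apply: (measurableT_comp (f := cos)) => //.
by apply: continuous_measurable_fun; exact: continuous_cos.
Qed.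

Let bounded_term l b om : (forall x, x \in l -> 0 <= x.1) ->
  `|expR (- quad_form l om) * cos (lin_form b om)| <= 1.
Proof.
move=> l0; rewrite normrM mulr_ile1// ?norm_cos_le1//.
rewrite ger0_norm ?expR_ge0// -expR0 ler_expR oppr_le0.
by rewrite /quad_form big_seq sumr_ge0// => x /l0 ?; rewrite mulr_ge0// sqr_ge0.
Qed.

Lemma measurable_laplace_fourier t l b : (forall x, x \in l -> 0 <= x.1) ->
  measurable_fun setT (fun xi : measurableTypeR R => laplace_fourier l ((xi, t) :: b)).
Proof.
move=> l0; pose g (om : T) (xi : measurableTypeR R) : R :=
  expR (- quad_form l om) * cos (lin_form ((xi, t) :: b) om).
apply: (measurable_bounded_Rintegral P (normal_prob 0 1) (f := g) (B := 1)) => [|om xi].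
  apply: measurable_funM.
    exact: (measurableT_comp (measurable_expN l) measurable_fst).
  apply: (measurableT_comp (f := cos)).
    by apply: continuous_measurable_fun; exact: continuous_cos.
  rewrite (_ : (fun x => _) = fun x : T * measurableTypeR R =>
    x.2 * U t x.1 + lin_form b x.1); last first.
    by apply/funext => x; rewrite /lin_form big_cons.
  apply: measurable_funD; first apply: measurable_funM; first exact: measurable_snd.
  - by apply: (measurableT_comp (mUt t)); exact: measurable_fst.
  - by apply: (measurableT_comp (measurable_lin_form b)); exact: measurable_fst.
exact: bounded_term.
Qed.

Lemma laplace_fourier_le1 l b : (forall x, x \in l -> 0 <= x.1) ->
  `|laplace_fourier l b| <= 1.
Proof.
move=> l0; rewrite -[leRHS]add0r -[X in X + _](mul0r 0).
apply: (norm_Rintegral_le (X := cst 0)) => //.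
- exact: measurable_funM.
- by rewrite integral0.
- by move=> om; rewrite mulr0 add0r bounded_term.
Qed.

(* Hubbard-Stratonovich: [exp (- c x ^ 2)] is the average of [cos (xi x)] over a centered
   normal [xi] of variance [2 c]. *)
Lemma laplace_fourier_cons c t l b : 0 < c -> (forall x, x \in l -> 0 <= x.1) ->
  laplace_fourier ((c, t) :: l) b =
  \int[normal_prob 0 (Num.sqrt (2 * c))]_xi
    (2^-1 * (laplace_fourier l ((xi, t) :: b) + laplace_fourier l ((- xi, t) :: b))).
Proof.
move=> c0 l0; have s0 : Num.sqrt (2 * c) != 0 by rewrite gt_eqF// sqrtr_gt0 mulr_gt0.
pose f (om : T) (xi : measurableTypeR R) : R :=
  expR (- quad_form l om) * cos (lin_form b om) * cos (U t om * xi).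
have mf : measurable_fun setT (fun x : T * measurableTypeR R => f x.1 x.2).
  apply: measurable_funM.
    by apply: (measurableT_comp (f := fun om => expR (- quad_form l om) * cos (lin_form b om)));
      [exact: measurable_funM|exact: measurable_fst].
  apply: (measurableT_comp (f := cos)).
    by apply: continuous_measurable_fun; exact: continuous_cos.
  apply: measurable_funM; last exact: measurable_snd.
  by apply: (measurableT_comp (mUt t)); exact: measurable_fst.
have f1 om xi : `|f om xi| <= 1.
  by rewrite /f normrM mulr_ile1// ?norm_cos_le1// bounded_term.
transitivity (\int[P]_om \int[normal_prob 0 (Num.sqrt (2 * c))]_xi f om xi).
  apply: eq_Rintegral => om _.
  rewrite RintegralZl//; last first.
    apply: (integrable_bounded 1) => [|xi]; last exact: norm_cos_le1.
    apply: (measurableT_comp (f := cos)) => //.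
    by apply: continuous_measurable_fun; exact: continuous_cos.
  rewrite (normal_cos s0) sqr_sqrtr; last by rewrite mulr_ge0// ltW.
  rewrite /quad_form big_cons/= opprD expRD.
  rewrite (_ : 2 * c * U t om ^+ 2 / 2 = c * U t om ^+ 2); last by field.
  by ring.
rewrite (Rintegral_bounded_fubini _ (normal_prob 0 (Num.sqrt (2 * c))) mf f1).
apply: eq_Rintegral => xi _.
rewrite -RintegralD//; last 2 first.
- by apply: (integrable_bounded 1) => [|om]; [exact: measurable_funM|exact: bounded_term].
- by apply: (integrable_bounded 1) => [|om]; [exact: measurable_funM|exact: bounded_term].
rewrite -RintegralZl//; last first.
  apply: (integrable_bounded 2) => [|om].
    by apply: measurable_funD; exact: measurable_funM.
  by rewrite (le_trans (ler_normD _ _))// (_ : 2 = 1 + 1)// lerD// bounded_term.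
apply: eq_Rintegral => om _.
(* The product of two cosines is half the sum of the cosines of the sum and of the difference. *)
rewrite /f /lin_form !big_cons/= -/(lin_form b om).
rewrite !cosD mulNr cosN sinN (mulrC xi).
by field.
Qed.

End one_field.

Section field_convergence.
Context (C : R) (d_ : nat -> measure_display) (Omega_ : forall n, measurableType (d_ n))
  (P_ : forall n, probability (Omega_ n) R) (U_ : forall n, V -> Omega_ n -> R)
  d (Omega : measurableType d) (P : probability Omega R) (Z : V -> Omega -> R).
Hypotheses
  (mU_ : forall n, measurable_fun setT (fun x : V * Omega_ n => @U_ n x.1 x.2))
  (U_sqr : forall n t, (\int[P_ n]_om (@U_ n t om ^+ 2)%:E <= C%:E)%E)
  (U_incr : forall n s t,
    (\int[P_ n]_om ((@U_ n t om - @U_ n s om) ^+ 2)%:E <= (C * `|t - s| ^+ 2)%:E)%E)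
  (mZ : measurable_fun setT (fun x : V * Omega => Z x.1 x.2))
  (Z_sqr : forall t, (\int[P]_om (Z t om ^+ 2)%:E <= C%:E)%E)
  (Z_incr : forall s t,
    (\int[P]_om ((Z t om - Z s om) ^+ 2)%:E <= (C * `|t - s| ^+ 2)%:E)%E)
  (lin_cvg : forall b : seq (R * V),
    \int[P_ n]_om cos (lin_form (@U_ n) b om) @[n --> \oo] -->
    \int[P]_om cos (lin_form Z b om)).

(** Induction on [l] for all [b]: each quadratic term becomes one more linear term with a normal
    coefficient, and dominated convergence with bound [1] passes to the limit under the normal
    average. *)
Lemma laplace_fourier_cvg l b : (forall x, x \in l -> 0 <= x.1) ->
  laplace_fourier (P_ n) (@U_ n) l b @[n --> \oo] --> laplace_fourier P Z l b.
Proof.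
elim: l b => [|[c t] l IH] b l0.
  have E d' (T : measurableType d') (Q : probability T R) (U : V -> T -> R) :
      laplace_fourier Q U [::] b = \int[Q]_om cos (lin_form U b om).
    by apply: eq_Rintegral => om _; rewrite /quad_form big_nil oppr0 expR0 mul1r.
  by rewrite E; under eq_fun do rewrite E; exact: lin_cvg.
have l0' x : x \in l -> 0 <= x.1 by move=> xl; apply: l0; rewrite inE xl orbT.
(* A zero coefficient drops out; it is set apart because the normal average needs a nonzero
   deviation. *)
have := l0 (c, t); rewrite inE eqxx => /(_ isT)/=; rewrite le_eqVlt => /predU1P[c0|c0].
  have E d' (T : measurableType d') (Q : probability T R) (U : V -> T -> R) :
      laplace_fourier Q U ((c, t) :: l) b = laplace_fourier Q U l b.
    by apply: eq_Rintegral => om _; rewrite /quad_form big_cons/= -c0 mul0r add0r.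
  by rewrite E; under eq_fun do rewrite E; exact: IH.
rewrite (laplace_fourier_cons _ mZ)//.
under eq_fun => n do rewrite (laplace_fourier_cons _ (@mU_ n))//.
pose h d' (T : measurableType d') (Q : probability T R) (U : V -> T -> R)
  (xi : measurableTypeR R) : R :=
  2^-1 * (laplace_fourier Q U l ((xi, t) :: b) + laplace_fourier Q U l ((- xi, t) :: b)).
have mh d' (T : measurableType d') (Q : probability T R) (U : V -> T -> R) :
    measurable_fun setT (fun x : V * T => U x.1 x.2) -> measurable_fun setT (h _ _ Q U).
  move=> mU; have mF := measurable_laplace_fourier Q mU t b l0'.
  apply: measurable_funM => //; apply: measurable_funD => //.
  exact: (measurableT_comp mF (@oppr_measurable R setT)).
have h1 d' (T : measurableType d') (Q : probability T R) (U : V -> T -> R) xi :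
    measurable_fun setT (fun x : V * T => U x.1 x.2) -> `|h _ _ Q U xi| <= 1.
  move=> mU; rewrite /h normrM ger0_norm// ler_pdivrMl// mulr1.
  rewrite (le_trans (ler_normD _ _))// (_ : 2 = 1 + 1)// lerD//.
    exact: laplace_fourier_le1.
  exact: laplace_fourier_le1.
suff : \int[normal_prob 0 (Num.sqrt (2 * c))]_xi h _ _ (P_ n) (@U_ n) xi @[n --> \oo] -->
    \int[normal_prob 0 (Num.sqrt (2 * c))]_xi h _ _ P Z xi by [].
apply: fine_cvg; rewrite fineK; last first.
  apply: integrable_fin_num => //.
  by apply: (integrable_bounded 1); [exact: mh|move=> xi; exact: h1].
apply: (@dominated_cvg _ _ _ (normal_prob 0 (Num.sqrt (2 * c))) setT measurableT
  _ _ (cst 1%E)) => //.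
- by move=> n; apply/measurable_EFinP; exact: mh.
- move=> xi _; apply: cvg_EFin; first exact: nearW.
  by apply: cvgMl_tmp; apply: cvgD; exact: IH.
- by apply/(integrable_bounded 1) => // x; rewrite normr1.
- by move=> n xi _; rewrite lee_fin; exact: h1.
Qed.

(** Quantization at one fixed level [j] costs at most [e / 3] for every field, as all share the
    constant [C]; the quadratic forms, with coefficients scaled by [k], converge by
    [laplace_fourier_cvg]. *)
Lemma energy_laplace_cvg (k : nat) :
  \int[P_ n]_om expR (- (k%:R * energy (@U_ n) om)) @[n --> \oo] -->
  \int[P]_om expR (- (k%:R * energy Z om)).
Proof.
apply/cvgrPdist_le => e e0.
have [j jE] : exists j, k%:R * (3 * C * quantization_error j) <= e / 3.
  have : k%:R * (3 * C * quantization_error j) @[j --> \oo] --> k%:R * (3 * C * 0).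
    by apply: cvgMl_tmp; apply: cvgMl_tmp; exact: quantization_error_cvg0.
  rewrite !mulr0 => /cvgr0Pnorm_le/(_ (e / 3)); rewrite divr_gt0// => /(_ isT)[N _ NE].
  by exists N; rewrite (le_trans (ler_norm _))// (NE N)//=.
have [l l0 lE] := quantized_integral mw w0 iw j.
pose l' := [seq (k%:R * x.1, x.2) | x <- l].
have l'0 x : x \in l' -> 0 <= x.1.
  by move=> /mapP[y /l0 y0 ->]/=; rewrite mulr_ge0.
have E d' (T : measurableType d') (Q : probability T R) (U : V -> T -> R) :
    \int[Q]_om expR (- (k%:R * quad_form U l om)) = laplace_fourier Q U l' [::].
  apply: eq_Rintegral => om _; rewrite /lin_form big_nil cos0 mulr1.
  rewrite /quad_form big_map mulr_sumr; congr (expR (- _)).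
  by apply: eq_bigr => x _; rewrite mulrA.
have := @laplace_fourier_cvg l' [::] l'0.
move=> /cvgrPdist_le/(_ (e / 3)); rewrite divr_gt0// => /(_ isT).
apply: filterS => n; rewrite -!E => h.
have hZ := le_trans (laplace_energy_dist mZ Z_sqr Z_incr (ler0n _ k) l0 lE) jE.
have hn := le_trans (laplace_energy_dist (@mU_ n) (@U_sqr n) (@U_incr n) (ler0n _ k) l0 lE) jE.
move: h hZ hn; rewrite !ler_norml => /andP[? ?] /andP[? ?] /andP[? ?].
by apply/andP; split; lra.
Qed.

Lemma energy_cvg_in_law :
  cvg_in_law P_ (fun n => energy (@U_ n)) P (energy Z).
Proof.
apply: (@cvg_in_law_laplace _ _ _ _ _ _ _ _ _ (C * \int[leb]_t w t)).
- by move=> n; exact: measurable_energy.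
- exact: measurable_energy.
- by move=> n om; exact: energy_ge0.
- exact: energy_ge0.
- by move=> n; exact: energy_mean_le.
- exact: energy_mean_le.
- exact: energy_laplace_cvg.
Qed.

End field_convergence.
End random_field.

(** * The rank statistic as the energy of a real random field *)

Section rank_statistic_energy.
Context {R : realType} {p : nat}.
Local Notation V := 'rV[R]_p.

Lemma norm_cos_plus_sin_le (t y : V) : `|cos_plus_sin t y| <= 2.
Proof.
rewrite (le_trans (ler_normD _ _))// (_ : 2 = 1 + 1)// lerD//.
  exact: norm_cos_le1.
exact: norm_sin_le1.
Qed.

Lemma cos_plus_sin_lipschitz (s t y : V) :
  `|cos_plus_sin t y - cos_plus_sin s y| <= 2 * `|dotp (t - s) y|.
Proof.
rewrite dotpBl /cos_plus_sin opprD addrACA (le_trans (ler_normD _ _))//.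
rewrite (_ : 2 = 1 + 1)// mulrDl mul1r lerD//.
  exact: cos_lipschitz.
exact: sin_lipschitz.
Qed.

Lemma measurable_cos_plus_sin d (T : measurableType d) (f g : T -> V) :
  measurable_fun setT f -> measurable_fun setT g ->
  measurable_fun setT (fun x => cos_plus_sin (f x) (g x)).
Proof.
move=> mf mg; apply: measurable_funD.
  apply: (measurableT_comp (f := cos)); last exact: measurable_dotp.
  by apply: continuous_measurable_fun; exact: continuous_cos.
apply: (measurableT_comp (f := sin)); last exact: measurable_dotp.
by apply: continuous_measurable_fun; exact: continuous_sin.
Qed.

Lemma continuous_cos_plus_sin (t : V) : continuous (cos_plus_sin t).
Proof.
have cd : continuous (dotp t).
  by move=> y; apply: (cvg_bigsum (nbhs_filter y)) => i; apply: cvgMl_tmp; exact: coord_continuous.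
move=> y; apply: cvgD; first exact: (nbhs_filter y).
  exact: (continuous_comp (cd y) (@continuous_cos R (dotp t y))).
exact: (continuous_comp (cd y) (@continuous_sin R (dotp t y))).
Qed.

Lemma measurable_mean_diff d (T : measurableType d) n m (v : T -> 'I_n + 'I_m -> R) :
  (forall a, measurable_fun setT (fun x => v x a)) ->
  measurable_fun setT (fun x => mean_diff (v x)).
Proof.
move=> mv; apply: measurable_funM => //; apply: measurable_funB;
  by apply: measurable_funM => //; exact: measurable_sum.
Qed.

Lemma mean_diffD n m (u v : 'I_n + 'I_m -> R) (c : R) :
  mean_diff (fun a => c * u a + v a) = c * mean_diff u + mean_diff v.
Proof. by rewrite /mean_diff !big_split/= -!mulr_sumr; ring. Qed.

Let ecfE n (r : 'I_n -> V) (t : V) : ecf r t =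
  ((n%:R^-1 * \sum_j cos (dotp t (r j))) +i* (n%:R^-1 * \sum_j sin (dotp t (r j))))%C.
Proof.
rewrite /ecf; have -> : (n%:R^-1 : R[i]) = (n%:R^-1 : R)%:C%C by rewrite fmorphV rmorph_nat.
have -> : \sum_j expi (dotp t (r j)) =
    ((\sum_j cos (dotp t (r j))) +i* (\sum_j sin (dotp t (r j))))%C.
  by elim: (index_enum _) => [|j s IH]; rewrite ?big_nil// !big_cons IH.
by rewrite /real_complex_def; simpc.
Qed.

Lemma rank_stat_energy n m (w : V -> R) (r : 'I_n -> V) (r0 : 'I_m -> V) :
  weight_function w -> rank_stat w r r0 =
  \int[lebesgue_rV R p]_t (mean_diff (fun a => cos_plus_sin t (pooled r r0 a)) ^+ 2 * w t).
Proof.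
move=> [mw w0 wN iw].
pose A t := n%:R^-1 * \sum_j cos (dotp t (r j)) - m%:R^-1 * \sum_j cos (dotp t (r0 j)).
pose B t := n%:R^-1 * \sum_j sin (dotp t (r j)) - m%:R^-1 * \sum_j sin (dotp t (r0 j)).
have avg1 (l : nat) (u : 'I_l -> R) : (forall j, `|u j| <= 1) -> `|l%:R^-1 * \sum_j u j| <= 1.
  case: l u => [|l] u u1; first by rewrite big_ord0 mulr0 normr0.
  rewrite normrM ger0_norm ?invr_ge0// ler_pdivrMl// mulr1.
  rewrite (le_trans (ler_norm_sum _ _ _))// (le_trans (ler_sum _ (fun j _ => u1 j)))//.
  by rewrite sumr_const card_ord.
have AB2 t : `|A t| <= 2 /\ `|B t| <= 2.
  rewrite (_ : 2 = 1 + 1)//; split; rewrite (le_trans (ler_normB _ _))// lerD// avg1// => j;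
    by [exact: norm_cos_le1|exact: norm_sin_le1].
have mdot (u : R -> R) (y : V) : continuous u -> measurable_fun setT (fun t : V => u (dotp t y)).
  move=> cu; apply: (measurableT_comp (f := u)); last exact: measurable_dotp.
  exact: continuous_measurable_fun.
have mA : measurable_fun setT A.
  by apply: measurable_funB; apply: measurable_funM => //; apply: measurable_sum => j;
    apply: mdot; exact: continuous_cos.
have mB : measurable_fun setT B.
  by apply: measurable_funB; apply: measurable_funM => //; apply: measurable_sum => j;
    apply: mdot; exact: continuous_sin.
have intw (u : V -> R) (K : R) : measurable_fun setT u -> (forall t, `|u t| <= K) ->
    (lebesgue_rV R p).-integrable setT (EFin \o (fun t => u t * w t)).
  move=> mu uK.
  apply: (@le_integrable _ _ _ (lebesgue_rV R p) setT measurableT _ (EFin \o (fun t => K * w t))).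
  - by apply/measurable_EFinP; exact: measurable_funM.
  - move=> t _; rewrite /= lee_fin !normrM ler_wpM2r//.
    by rewrite (le_trans (uK t))// ler_norm.
  - apply: integrable_cstM; apply/integrableP; split; first exact/measurable_EFinP.
    by under eq_integral do rewrite /= ger0_norm//.
have sumE (s : R) : s * \int[lebesgue_rV R p]_t
    (ComplexField.Normc.normc (ecf r t - ecf r0 t) ^+ 2 * w t) =
    \int[lebesgue_rV R p]_t (s * (A t ^+ 2 + B t ^+ 2) * w t).
  rewrite -RintegralZl//.
    apply: eq_Rintegral => t _; rewrite !ecfE/= sqr_sqrtr ?addr_ge0 ?sqr_ge0//.
    by rewrite mulrA.
  rewrite (_ : _ \o _ = EFin \o (fun t => (A t ^+ 2 + B t ^+ 2) * w t)).
    apply: (intw _ 8); first by apply: measurable_funD; exact: measurable_funX.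
    move=> t; have [A2 B2] := AB2 t; rewrite ger0_norm ?addr_ge0 ?sqr_ge0//.
    rewrite -(real_normK (num_real (A t))) -(real_normK (num_real (B t))).
    rewrite (_ : 8 = 2 ^+ 2 + 2 ^+ 2); last by ring.
    by rewrite lerD// ler_pXn2r ?nnegrE.
  by apply/funext => t; rewrite /= !ecfE/= sqr_sqrtr ?addr_ge0 ?sqr_ge0.
rewrite /rank_stat sumE; set s := _ / _.
(* The squared modulus is [A ^+ 2 + B ^+ 2], the square of a sum without its cross term; [A] is even
   and [B] odd in [t], so the cross term times the even weight integrates to zero. *)
have mdE t : mean_diff (fun a => cos_plus_sin t (pooled r r0 a)) ^+ 2 =
    s * (A t ^+ 2 + B t ^+ 2) + 2 * s * (A t * B t).
  rewrite /mean_diff/= exprMn sqr_two_sample_scale -/s /cos_plus_sin !big_split/=.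
  by rewrite /A /B; ring.
under [RHS]eq_Rintegral do rewrite mdE mulrDl.
rewrite RintegralD//.
- rewrite [X in _ = _ + X]integral_odd_eq0 ?addr0//.
    by apply: measurable_funM => //; apply: measurable_funM => //; exact: measurable_funM.
  move=> t; rewrite wN; have -> : A (- t) = A t.
    by congr (_ * _ - _ * _); apply: eq_bigr => j _; rewrite dotpNl cosN.
  have -> : B (- t) = - B t.
    by rewrite /B; under eq_bigr do rewrite dotpNl sinN;
      under [X in _ - _ * X]eq_bigr do rewrite dotpNl sinN; rewrite !sumrN; ring.
  by ring.
- apply: (intw _ (`|s| * 8)).
    by apply: measurable_funM => //; apply: measurable_funD; exact: measurable_funX.
  move=> t; have [A2 B2] := AB2 t; rewrite normrM ler_wpM2l// ger0_norm ?addr_ge0 ?sqr_ge0//.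
  rewrite -(real_normK (num_real (A t))) -(real_normK (num_real (B t))).
  rewrite (_ : 8 = 2 ^+ 2 + 2 ^+ 2); last by ring.
  by rewrite lerD// ler_pXn2r ?nnegrE.
- apply: (intw _ (`|2 * s| * (2 * 2))).
    by apply: measurable_funM => //; exact: measurable_funM.
  by move=> t; have [A2 B2] := AB2 t; rewrite normrM ler_wpM2l// normrM ler_pM.
Qed.

End rank_statistic_energy.

(** * Linear combinations of the functions [cos_plus_sin t], and the Gaussian limit field *)

Definition trig_comb {R : realType} {p : nat} (b : seq (R * 'rV[R]_p)) (y : 'rV[R]_p) : R :=
  \sum_(x <- b) x.1 * cos_plus_sin x.2 y.

Section trig_combinations.
Context {R : realType} {p : nat}.
Implicit Types b : seq (R * 'rV[R]_p).

Definition trig_bound b : R := \sum_(x <- b) `|x.1| * 2.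

Lemma trig_comb_le b y : `|trig_comb b y| <= trig_bound b.
Proof.
rewrite (le_trans (ler_norm_sum _ _ _))//; apply: ler_sum => x _.
by rewrite normrM ler_wpM2l// norm_cos_plus_sin_le.
Qed.

Lemma continuous_trig_comb b : continuous (trig_comb b).
Proof.
move=> y; apply: (cvg_bigsum (nbhs_filter y)) => x; apply: cvgMl_tmp.
exact: continuous_cos_plus_sin.
Qed.

Lemma measurable_trig_comb b : measurable_fun setT (trig_comb b).
Proof. by apply: continuous_measurable_rV; exact: continuous_trig_comb. Qed.

End trig_combinations.

Section gaussian_field.
Context (R : realType) (p : nat) (nu : probability 'rV[R]_p R)
  (dY : measure_display) (OmegaY : measurableType dY)
  (PY : probability OmegaY R) (Y : OmegaY -> 'rV[R]_p)
  (Y_law : has_law PY Y nu)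
  (dZ : measure_display) (OmegaZ : measurableType dZ)
  (PZ : probability OmegaZ R) (Z : 'rV[R]_p -> OmegaZ -> R)
  (Z_measurable : measurable_fun setT
     (fun tom : 'rV[R]_p * OmegaZ => Z tom.1 tom.2))
  (Z_gaussian : gaussian_process PZ Z)
  (Z_centered : forall t, 'E_PZ[Z t]%E = 0%E)
  (Z_cov : forall t1 t2,
     'E_PZ[fun om => (Z t1 om * Z t2 om)%R]%E =
     covariance PY (fun om => cos_plus_sin t1 (Y om))
                   (fun om => cos_plus_sin t2 (Y om))).
Local Notation V := 'rV[R]_p.
Implicit Types b : seq (R * V).

Definition trig_variance b : R :=
  \int[nu]_y (trig_comb b y ^+ 2) - (\int[nu]_y trig_comb b y) ^+ 2.

Let mZ t : measurable_fun setT (Z t).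
Proof. exact: (measurableT_comp Z_measurable (pair1_measurable t)). Qed.

Let lin_law b : exists m s, has_law PZ (lin_form Z b) (gaussian_law m s).
Proof.
have [m [s H]] := Z_gaussian (fun j : 'I_(size b) => (nth (0, 0) b j).2)
  (fun j => (nth (0, 0) b j).1).
exists m, s; rewrite (_ : lin_form Z b = fun om => \sum_(j < size b)
  (nth (0, 0) b j).1 * Z (nth (0, 0) b j).2 om)//.
by apply/funext => om; rewrite /lin_form (big_nth (0, 0)) big_mkord.
Qed.

Let Z_integrable_sqr t : PZ.-integrable setT (EFin \o (fun om => Z t om ^+ 2)).
Proof.
have [m [s /gaussian_integrable_sqr]] := lin_law [:: (1, t)].
by apply: eq_integrable => // om _; rewrite /= /lin_form big_seq1 mul1r.
Qed.

Let Z_integrableM s t : PZ.-integrable setT (EFin \o (fun om => Z s om * Z t om)).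
Proof.
apply: (le_integrable _ _ _
  (integrableD measurableT (Z_integrable_sqr s) (Z_integrable_sqr t))) => //.
  by apply/measurable_EFinP; exact: measurable_funM.
move=> om _; rewrite /= lee_fin [leRHS]ger0_norm ?addr_ge0 ?sqr_ge0//.
rewrite normrM -(real_normK (num_real (Z s om))) -(real_normK (num_real (Z t om))).
have := sqr_ge0 (`|Z s om| - `|Z t om|); rewrite sqrrB.
have := mulr_ge0 (normr_ge0 (Z s om)) (normr_ge0 (Z t om)).
lra.
Qed.

Let Z_integrable t : PZ.-integrable setT (EFin \o Z t).
Proof.
have i1 : PZ.-integrable setT (EFin \o (cst 1 : OmegaZ -> R)).
  by apply: (integrable_bounded 1) => // om; rewrite normr1.
apply: (le_integrable _ _ _
  (integrableD measurableT i1 (Z_integrable_sqr t))) => //.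
  exact/measurable_EFinP.
move=> om _; rewrite /= lee_fin [leRHS]ger0_norm ?addr_ge0 ?sqr_ge0//.
have := sqr_ge0 (`|Z t om| - 1); rewrite sqrrB1 real_normK ?num_real//.
by have := normr_ge0 (Z t om); lra.
Qed.

Let h_int t : nu.-integrable setT (EFin \o (cos_plus_sin t : V -> R)).
Proof.
apply: (integrable_bounded 2) => [|y]; last exact: norm_cos_plus_sin_le.
by apply: continuous_measurable_rV; exact: continuous_cos_plus_sin.
Qed.

Let hh_le s t (y : V) : `|cos_plus_sin s y * cos_plus_sin t y| <= 4.
Proof.
rewrite normrM (_ : 4 = 2 * 2); last by ring.
by rewrite ler_pM// norm_cos_plus_sin_le.
Qed.

Let mh t : measurable_fun setT (cos_plus_sin t : V -> R).
Proof. by apply: continuous_measurable_rV; exact: continuous_cos_plus_sin. Qed.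

Let hh_int s t : nu.-integrable setT (EFin \o (fun y : V => cos_plus_sin s y * cos_plus_sin t y)).
Proof. by apply: (integrable_bounded 4) => //; exact: measurable_funM. Qed.

Let Z_mean t : \int[PZ]_om Z t om = 0.
Proof. by have := Z_centered t; rewrite unlock /Rintegral => ->. Qed.

Let Z_covE s t : \int[PZ]_om (Z s om * Z t om) =
  \int[nu]_y (cos_plus_sin s y * cos_plus_sin t y) -
  (\int[nu]_y cos_plus_sin s y) * \int[nu]_y cos_plus_sin t y.
Proof.
have [mY _] := Y_law.
have mhY r : measurable_fun setT (fun om => cos_plus_sin r (Y om)).
  exact: (measurableT_comp (mh r) mY).
have hYint r : PY.-integrable setT (EFin \o (fun om => cos_plus_sin r (Y om))).
  by apply: (integrable_bounded 2) => // om; exact: norm_cos_plus_sin_le.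
have hhYint : PY.-integrable setT
    (EFin \o (fun om => cos_plus_sin s (Y om) * cos_plus_sin t (Y om))).
  by apply: (integrable_bounded 4) => //; exact: measurable_funM.
have := Z_cov s t; rewrite covarianceE;
  [|exact/Lfun1_integrable|exact/Lfun1_integrable|exact/Lfun1_integrable].
rewrite (expectation_bounded (P := PY) 2 (mhY s))//; last by move=> om; exact: norm_cos_plus_sin_le.
rewrite (expectation_bounded (P := PY) 2 (mhY t))//; last by move=> om; exact: norm_cos_plus_sin_le.
rewrite (expectation_bounded (P := PY) 4
  (f := fun om => cos_plus_sin s (Y om) * cos_plus_sin t (Y om))) => [|//|om];
  [|exact: measurable_funM|exact: hh_le].
rewrite unlock => H; rewrite {1}/Rintegral H /=.
rewrite (has_law_Rintegral Y_law (f := fun y => cos_plus_sin s y * cos_plus_sin t y))//;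
  last exact: measurable_funM.
by rewrite !(has_law_Rintegral Y_law (f := cos_plus_sin _)).
Qed.

Let lin_sqrE (om : OmegaZ) b : lin_form Z b om ^+ 2 =
  \sum_(x <- b) x.1 * \sum_(x' <- b) x'.1 * (Z x.2 om * Z x'.2 om).
Proof.
rewrite expr2 {1}/lin_form mulr_suml; apply: eq_bigr => x _.
rewrite -mulrA; congr (_ * _); rewrite /lin_form mulr_sumr.
by apply: eq_bigr => x' _; rewrite mulrCA.
Qed.

Let lin_sqr_int b : PZ.-integrable setT (EFin \o (fun om => lin_form Z b om ^+ 2)).
Proof.
have [m [s]] := lin_law b; exact: gaussian_integrable_sqr.
Qed.

(** Both sides expand into double sums over [b], which the covariance hypothesis identifies term by
    term. *)
Lemma gaussian_field_variance b :
  \int[PZ]_om (lin_form Z b om ^+ 2) = trig_variance b.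
Proof.
under eq_Rintegral do rewrite lin_sqrE.
rewrite (Rintegral_lincomb _ _
  (fun x om => \sum_(x' <- b) x'.1 * (Z x.2 om * Z x'.2 om))); last first.
  by move=> x; apply: (integrable_lincomb _ _ (fun x' om => Z x.2 om * Z x'.2 om)).
under eq_bigr => x _ do rewrite (Rintegral_lincomb _ _ (fun x' om => Z x.2 om * Z x'.2 om))//.
under eq_bigr do under eq_bigr do rewrite Z_covE.
rewrite /trig_variance.
have -> : \int[nu]_y trig_comb b y = \sum_(x <- b) x.1 * \int[nu]_y cos_plus_sin x.2 y.
  by rewrite -Rintegral_lincomb.
have -> : \int[nu]_y (trig_comb b y ^+ 2) = \sum_(x <- b) x.1 *
    \sum_(x' <- b) x'.1 * \int[nu]_y (cos_plus_sin x.2 y * cos_plus_sin x'.2 y).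
  have E (y : V) : trig_comb b y ^+ 2 = \sum_(x <- b) x.1 *
      \sum_(x' <- b) x'.1 * (cos_plus_sin x.2 y * cos_plus_sin x'.2 y).
    rewrite expr2 {1}/trig_comb mulr_suml; apply: eq_bigr => x _.
    rewrite -mulrA; congr (_ * _); rewrite /trig_comb mulr_sumr.
    by apply: eq_bigr => x' _; rewrite mulrCA.
  under eq_Rintegral do rewrite E.
  rewrite (Rintegral_lincomb _ _
    (fun x y => \sum_(x' <- b) x'.1 * (cos_plus_sin x.2 y * cos_plus_sin x'.2 y))); last first.
    by move=> x; apply: (integrable_lincomb _ _
      (fun x' y => cos_plus_sin x.2 y * cos_plus_sin x'.2 y)).
  apply: eq_bigr => x _; congr (_ * _).
  by rewrite (Rintegral_lincomb _ _ (fun x' y => cos_plus_sin x.2 y * cos_plus_sin x'.2 y)).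
rewrite expr2 mulr_suml -sumrB; apply: eq_bigr => x _.
rewrite -mulrA -mulrBr; congr (_ * _); rewrite mulr_sumr -sumrB.
by apply: eq_bigr => x' _; ring.
Qed.

Lemma gaussian_field_sqr_mean b :
  (\int[PZ]_om (lin_form Z b om ^+ 2)%:E = (trig_variance b)%:E)%E.
Proof.
rewrite -gaussian_field_variance /Rintegral fineK//.
exact: integrable_fin_num (lin_sqr_int b).
Qed.

(** A linear combination of values of the process has a Gaussian law, centered because each [Z t]
    is. *)
Lemma gaussian_field_cos b :
  \int[PZ]_om cos (lin_form Z b om) = expR (- (trig_variance b / 2)).
Proof.
have [m [s law]] := lin_law b.
apply: (gaussian_centered_cos law); last exact: gaussian_field_variance.
rewrite (Rintegral_lincomb _ _ (fun x om => Z x.2 om))//.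
by rewrite big1// => x _; rewrite Z_mean mulr0.
Qed.

End gaussian_field.

(** * The rank field: moments, increments and characteristic functions *)

Lemma integral_uniform_on (R : realType) (p : nat) (s : seq 'rV[R]_p) (f : 'rV[R]_p -> R) :
  measurable_fun setT f ->
  \int[uniform_on s]_x f x = (size s)%:R^-1 * \sum_(k < size s) f s`_k.
Proof.
move=> mf.
have ge0 (h : 'rV[R]_p -> R) : measurable_fun setT h -> (forall x, 0 <= h x) ->
    (\int[uniform_on s]_x (h x)%:E = ((size s)%:R^-1 * \sum_(k < size s) h s`_k)%:E)%E.
  move=> mh h0; have mEh : measurable_fun setT (EFin \o h) by exact/measurable_EFinP.
  rewrite /uniform_on ge0_integral_mscale//=; last by move=> x _; rewrite lee_fin.
  rewrite ge0_integral_measure_sum//; last by move=> x _; rewrite lee_fin.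
  rewrite EFinM -sumEFin; congr (_ * _)%E; apply: eq_bigr => k _.
  by rewrite integral_dirac// diracT mul1e.
rewrite /Rintegral integralE.
rewrite [X in fine (X - _)](_ : _ = (\int[uniform_on s]_x (Num.max (f x) 0)%:E)%E); last first.
  by apply: eq_integral => x _; rewrite funeposE/= EFin_max.
rewrite [X in fine (_ - X)](_ : _ = (\int[uniform_on s]_x (Num.max (- f x) 0)%:E)%E); last first.
  by apply: eq_integral => x _; rewrite funenegE/= EFin_max.
rewrite !ge0//; last 4 first.
- by apply: measurable_maxr => //; exact: measurable_funN.
- by move=> x; rewrite le_max lexx orbT.
- by apply: measurable_maxr.
- by move=> x; rewrite le_max lexx orbT.
rewrite -EFinB/= -mulrBr -sumrB; congr (_ * _); apply: eq_bigr => k _.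
move: (f s`_k) => x; have [x0|x0] := leP 0 x.
  by rewrite (max_r (x := - x)) ?oppr_le0// subr0.
by rewrite max_l ?oppr_ge0 ?ltW// sub0r opprK.
Qed.

Section rank_field.
Context (R : realType) (p n m : nat) (n0 : (0 < n)%N) (m0 : (0 < m)%N)
  (gr : (n + m).-tuple 'rV[R]_p) (gr_uniq : uniq gr)
  (muX mu0 : probability 'rV[R]_p R)
  (muX_ac : muX `<< lebesgue_rV R p) (mu0_ac : mu0 `<< lebesgue_rV R p)
  (d : measure_display) (Omega : measurableType d) (P : probability Omega R)
  (X : 'I_n -> Omega -> 'rV[R]_p) (X0 : 'I_m -> Omega -> 'rV[R]_p)
  (X_law : forall i, has_law P (X i) muX) (X0_law : forall j, has_law P (X0 j) mu0)
  (indep : mutually_independent P (pooled X X0))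
  (Ghat : Omega -> 'rV[R]_p -> 'rV[R]_p)
  (Ghat_optimal : {ae P, forall om,
     optimal_transport (fun i => pooled X X0 i om) [set` gr] (Ghat om)})
  (Ghat_measurable : forall i,
     measurable_fun setT (fun om => Ghat om (pooled X X0 i om)))
  (null_hypothesis : forall x, df muX x = df mu0 x).
Local Notation V := 'rV[R]_p.
Local Notation I := ('I_n + 'I_m)%type.

(** The grid is indexed by the labels of the pooled sample, so that its arrangements are
    permutations of one finite type. *)
Definition grid_point (a : I) : V := tnth gr (unsplit a).

Let g := grid_point.

Let unsplit_inj : injective (@unsplit n m).
Proof. exact: can_inj (@fintype.unsplitK n m). Qed.

Let g_inj : injective g.
Proof. by move=> a b /(tuple_uniqP _ gr_uniq) /unsplit_inj. Qed.

Let range_g : range g = [set` gr].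
Proof.
apply/seteqP; split => [_ [a _ <-]|y /=]; first exact: mem_tnth.
by move=> /tnthP[i ->]; exists (fintype.split i) => //; rewrite /g /grid_point fintype.splitK.
Qed.

Definition ranks (om : Omega) (a : I) : V := Ghat om (pooled X X0 a om).

Let mZ a : measurable_fun setT (pooled X X0 a).
Proof. by case: a => [i|j] /=; [case: (X_law i)|case: (X0_law j)]. Qed.

Let measurable_hyperplane (b : V) s : measurable [set v | dotp v b = s].
Proof.
apply: (@measurable_preimage _ _ _ _ (fun v => dotp v b) [set s]) => //.
exact: measurable_dotp.
Qed.

(** The requirements of [expectation_ranks] are met: absolute continuity makes hyperplanes null, and
    the null hypothesis gives all observations the same distribution function. *)
Lemma expectation_rank_functional (Phi : (I -> V) -> R) :
  measurable_fun setT (fun om => Phi (ranks om)) ->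
  (\int[P]_om (Phi (ranks om))%:E)%E =
  (perm_avg (fun s : {perm I} => Phi (grid_point \o s)))%:E.
Proof.
move=> mPhi.
have dfZ a (x : V) :
    P (pooled X X0 a @^-1` [set y : V | forall j, y ord0 j <= x ord0 j]) = df muX x.
  case: a => [i|j] /=.
    by have [_ ->] := X_law i => //; exact: measurable_lower_orthant.
  have [_ ->] := X0_law j; last exact: measurable_lower_orthant.
  exact: (esym (null_hypothesis x)).
have nullZ a b s : b != 0 -> P [set om | dotp (pooled X X0 a om) b = s] = 0%E.
  move=> b0.
  have hyp0 (mu : probability V R) : mu `<< lebesgue_rV R p -> mu [set v | dotp v b = s] = 0%E.
    by move=> /null_content_dominatesP; apply => //; exact: lebesgue_rV_hyperplane.
  case: a => [i|j] /=.
    have [_ H] := X_law i.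
    by rewrite -[LHS]/(P (X i @^-1` [set v | dotp v b = s])) H// hyp0.
  have [_ H] := X0_law j.
  by rewrite -[LHS]/(P (X0 j @^-1` [set v | dotp v b = s])) H// hyp0.
have opt : {ae P, forall om, optimal_transport (pooled X X0 ^~ om) (range g) (Ghat om)}.
  by rewrite range_g.
exact: (expectation_ranks mZ indep dfZ nullZ g_inj (rank := fun a om => ranks om a) _ opt).
Qed.

Definition rank_field (t : V) (om : Omega) : R :=
  mean_diff (fun a => cos_plus_sin t (ranks om a)).

Let measurable_ranks a : measurable_fun setT (ranks ^~ a).
Proof. exact: Ghat_measurable. Qed.

Lemma measurable_rank_field : measurable_fun setT (fun x : V * Omega => rank_field x.1 x.2).
Proof.
apply: measurable_mean_diff => a; apply: measurable_cos_plus_sin.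
  exact: measurable_fst.
exact: (measurableT_comp (measurable_ranks a) measurable_snd).
Qed.

(** Values between [-2] and [2] oscillate by at most [4], and [4 ^+ 2 / 2 = 8]. *)
Lemma rank_field_sqr t : (\int[P]_om (rank_field t om ^+ 2)%:E <= 8%:E)%E.
Proof.
rewrite (expectation_rank_functional
  (Phi := fun z => mean_diff (fun a => cos_plus_sin t (z a)) ^+ 2)); last first.
  apply: measurable_funX; apply: measurable_mean_diff => a.
  by apply: measurable_cos_plus_sin => //; exact: measurable_ranks.
rewrite lee_fin (_ : 8 = 4 ^+ 2 / 2); last by field.
apply: (@perm_avg_sqr_le _ _ _ n0 m0 (fun a => cos_plus_sin t (grid_point a))) => a b.
rewrite (le_trans (ler_normB _ _))// (_ : 4 = 2 + 2); last by ring.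
by rewrite lerD// norm_cos_plus_sin_le.
Qed.

(** The increment is the mean difference of [cos_plus_sin t - cos_plus_sin s]. At grid points this
    function is at most [2 * (p * M) * |t - s|] in modulus, so it oscillates by at most twice that,
    and half of the square is the bound. *)
Lemma rank_field_incr (M : R) s t : (forall a, `|grid_point a| <= M) ->
  (\int[P]_om ((rank_field t om - rank_field s om) ^+ 2)%:E <=
   (8 * (p%:R * M) ^+ 2 * `|t - s| ^+ 2)%:E)%E.
Proof.
move=> gM.
pose v (y : V) := - 1 * cos_plus_sin s y + cos_plus_sin t y.
have E (z : I -> V) : mean_diff (fun a => cos_plus_sin t (z a)) -
    mean_diff (fun a => cos_plus_sin s (z a)) = mean_diff (fun a => v (z a)).
  by rewrite mean_diffD; ring.
under eq_integral do rewrite /rank_field E.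
rewrite (expectation_rank_functional
  (Phi := fun z => mean_diff (fun a => v (z a)) ^+ 2)); last first.
  apply: measurable_funX; apply: measurable_mean_diff => a; apply: measurable_funD.
    by apply: measurable_funM => //; apply: measurable_cos_plus_sin => //; exact: measurable_ranks.
  by apply: measurable_cos_plus_sin => //; exact: measurable_ranks.
rewrite lee_fin (_ : 8 * _ * _ = (4 * (p%:R * M) * `|t - s|) ^+ 2 / 2); last by field.
apply: (@perm_avg_sqr_le _ _ _ n0 m0 (fun a => v (grid_point a))) => a b.
have vle c : `|v (grid_point c)| <= 2 * (p%:R * M) * `|t - s|.
  rewrite /v mulN1r addrC (le_trans (cos_plus_sin_lipschitz _ _ _))//.
  rewrite -mulrA ler_wpM2l// (le_trans (dotp_le _ _))// -mulrA ler_wpM2l//.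
  by rewrite mulrC ler_wpM2r.
rewrite (le_trans (ler_normB _ _))//; have := vle a; have := vle b; lra.
Qed.

Lemma lin_form_rank_field b om :
  lin_form rank_field b om = mean_diff (fun a => trig_comb b (ranks om a)).
Proof.
elim: b => [|x b IH]; rewrite /lin_form ?big_nil ?big_cons.
  by rewrite /mean_diff /trig_comb; under eq_bigr do rewrite big_nil;
    under [X in _ - _ * X]eq_bigr do rewrite big_nil; rewrite !big1_eq; ring.
rewrite -/(lin_form rank_field b om) IH /rank_field -mean_diffD.
by congr mean_diff; apply/funext => a; rewrite /trig_comb big_cons.
Qed.

Definition grid_mean (f : V -> R) : R := \int[uniform_on gr]_y f y.

Lemma grid_meanE f : measurable_fun setT f -> grid_mean f = avg (f \o grid_point).
Proof.
move=> mf; rewrite /grid_mean integral_uniform_on// size_tuple /avg; congr (_ * _).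
rewrite big_sumType/= big_split_ord/=.
by congr (_ + _); apply: eq_bigr => i _; rewrite /grid_point/= (tnth_nth 0).
Qed.

Lemma rank_field_cos (b : seq (R * V)) :
  `|\int[P]_om cos (lin_form rank_field b om) -
    expR (- ((grid_mean (fun y => trig_comb b y ^+ 2) - grid_mean (trig_comb b) ^+ 2) / 2))| <=
  clt_error (trig_bound b) (two_sample_scale R n m)^-1.
Proof.
have mb := measurable_trig_comb b.
rewrite /Rintegral.
under eq_integral do rewrite lin_form_rank_field.
rewrite (expectation_rank_functional
  (Phi := fun z => cos (mean_diff (fun a => trig_comb b (z a)))))/=; last first.
  apply: (measurableT_comp (f := cos)).
    by apply: continuous_measurable_fun; exact: continuous_cos.
  by apply: measurable_mean_diff => a; exact: (measurableT_comp mb (measurable_ranks a)).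
rewrite !grid_meanE//; last exact: measurable_funX.
exact: (perm_clt n0 m0 (v := trig_comb b \o grid_point) (fun a => trig_comb_le b _)).
Qed.

End rank_field.

(** * Passage to the limit along the grids *)

Lemma two_sample_scale_cvg (R : realType) (m : nat -> nat) (lambda : R) :
  (forall n, (0 < m n)%N) -> n%:R / (m n)%:R @[n --> \oo] --> lambda ->
  (two_sample_scale R n.+1 (m n.+1))^-1 @[n --> \oo] --> (0 : R).
Proof.
move=> m0 ratio.
(* In terms of the sample sizes the inverse scale is the root of [1 / n * (1 + n / m)], which
   vanishes in the limit since the ratio converges. *)
have -> : (fun n => (two_sample_scale R n.+1 (m n.+1))^-1) =
    (fun n => Num.sqrt (n.+1%:R^-1 * (1 + n.+1%:R / (m n.+1)%:R))) :> (nat -> R).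
  apply/funext => n; rewrite /two_sample_scale -sqrtrV; last by rewrite divr_ge0.
  congr Num.sqrt; have := m0 n.+1; rewrite -(ltr0n R) natrM natrD => mn.
  have : (0 : R) < n.+1%:R by [].
  move: n.+1%:R (m n.+1)%:R mn => x y y0 x0.
  by field; rewrite !gt_eqF// addr_gt0.
rewrite -[X in _ --> X](sqrtr0 R); apply: continuous_cvg; first exact: sqrt_continuous.
rewrite -[X in _ --> X](mul0r (1 + lambda)); apply: cvgM.
  exact: cvg_harmonic.
apply: cvgD; first exact: cvg_cst.
by rewrite -(cvg_shiftS (fun n => (n%:R / (m n)%:R : R))) in ratio.
Qed.

Lemma clt_error_cvg (R : realType) (B : R) (k : nat -> R) :
  k n @[n --> \oo] --> (0 : R) -> clt_error B (k n) @[n --> \oo] --> (0 : R).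
Proof.
move=> k0; rewrite /clt_error.
rewrite -[X in _ --> X](mul0r ((1 + B ^+ 4 / 2) / 4 + B * (1 + 2 * B ^+ 2) / 2 +
  0 * (2 * B ^+ 2) + 4 * B ^+ 3)).
apply: cvgM => //; apply: cvgD; last exact: cvg_cst.
by apply: cvgD; [exact: cvg_cst|apply: cvgMr_tmp].
Qed.

Lemma integral_uniform_on_le (R : realType) (p : nat) (s : seq 'rV[R]_p)
    (f : 'rV[R]_p -> R) (c : R) :
  measurable_fun setT f -> (0 < size s)%N -> (forall y, y \in s -> f y <= c) ->
  \int[uniform_on s]_y f y <= c.
Proof.
move=> mf s0 fc; rewrite integral_uniform_on// ler_pdivrMl ?ltr0n//.
rewrite mulr_natl (_ : c *+ size s = \sum_(k < size s) c).
  by apply: ler_sum => k _; apply: fc; exact: mem_nth.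
by rewrite sumr_const card_ord.
Qed.

Section limit_field.
Context (R : realType) (p : nat) (nu : probability 'rV[R]_p R)
  (m : nat -> nat) (grid : forall n, (n + m n).-tuple 'rV[R]_p)
  (grid_cvg : weak_cvg (fun n => uniform_on (grid n)) nu).
Local Notation V := 'rV[R]_p.
Implicit Types b : seq (R * V).

Let bounded_trig b : bounded_fun (trig_comb b).
Proof.
exists (trig_bound b); split; first exact: num_real.
by move=> M bM y _ /=; rewrite (le_trans (trig_comb_le _ _))// ltW.
Qed.

Let sqr_trig_le b (y : V) : `|trig_comb b y ^+ 2| <= trig_bound b ^+ 2.
Proof. by rewrite normrX lerXn2r ?nnegrE ?(le_trans _ (trig_comb_le b y)) ?trig_comb_le. Qed.

Lemma trig_mean_cvg b :
  \int[uniform_on (grid n)]_y trig_comb b y @[n --> \oo] --> \int[nu]_y trig_comb b y.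
Proof. by apply: grid_cvg => //; exact: continuous_trig_comb. Qed.

Lemma trig_sqr_mean_cvg b :
  \int[uniform_on (grid n)]_y (trig_comb b y ^+ 2) @[n --> \oo] -->
  \int[nu]_y (trig_comb b y ^+ 2).
Proof.
apply: grid_cvg.
  move=> y; apply: (continuous_comp (f := trig_comb b) (g := fun x => x ^+ 2)).
    exact: continuous_trig_comb.
  exact: exprn_continuous.
exists (trig_bound b ^+ 2); split; first exact: num_real.
by move=> M bM y _ /=; rewrite (le_trans (sqr_trig_le _ _))// ltW.
Qed.

Lemma trig_variance_cvg b :
  \int[uniform_on (grid n)]_y (trig_comb b y ^+ 2) -
  (\int[uniform_on (grid n)]_y trig_comb b y) ^+ 2 @[n --> \oo] --> trig_variance nu b.
Proof.
apply: cvgB; first exact: trig_sqr_mean_cvg.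
by rewrite /= expr2; under eq_fun do rewrite expr2; apply: cvgM; exact: trig_mean_cvg.
Qed.

(** A variance is at most the second moment, and the latter is the limit of the second moments over
    the grids; so bounds valid on the grids pass to [nu]. *)
Lemma trig_variance_le b (c : R) :
  (forall n y, y \in grid n -> `|trig_comb b y| <= c) -> trig_variance nu b <= c ^+ 2.
Proof.
move=> bc; rewrite /trig_variance lerBlDr ler_wpDr ?sqr_ge0//.
rewrite -(cvg_lim _ (@trig_sqr_mean_cvg b))//.
apply: limr_le; first by apply/cvg_ex; eexists; exact: trig_sqr_mean_cvg.
near=> n; apply: integral_uniform_on_le.
- by apply: measurable_funX; exact: measurable_trig_comb.
- by rewrite size_tuple addn_gt0; apply/orP; left; near: n; exists 1%N.
- move=> y /bc yc; rewrite -(real_normK (num_real _)) lerXn2r ?nnegrE//.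
  exact: le_trans yc.
Unshelve. all: by end_near. Qed.

End limit_field.

(** * Convergence in law of the rank statistic from that of the rank fields *)

Theorem theorem2 (R : realType) (p : nat)
  (nu : probability 'rV[R]_p R)
  (nu_ac : nu `<< lebesgue_rV R p)
  (nu_compact : compact (msupport nu))
  (w : 'rV[R]_p -> R) (w_weight : weight_function w)
  (m : nat -> nat) (m_gt0 : forall n, (0 < m n)%N)
  (grid : forall n, (n + m n).-tuple 'rV[R]_p)
  (grid_uniq : forall n, uniq (grid n))
  (grid_supp : forall n, [set` grid n] `<=` msupport nu)
  (grid_cvg : weak_cvg (fun n => uniform_on (grid n)) nu)
  (lambda : R) (lambda_gt0 : 0 < lambda)
  (ratio_cvg : n%:R / (m n)%:R @[n --> \oo] --> lambda)
  (muX mu0 : probability 'rV[R]_p R)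
  (muX_ac : muX `<< lebesgue_rV R p)
  (mu0_ac : mu0 `<< lebesgue_rV R p)
  (d_ : nat -> measure_display) (Omega_ : forall n, measurableType (d_ n))
  (P_ : forall n, probability (Omega_ n) R)
  (X : forall n, 'I_n -> Omega_ n -> 'rV[R]_p)
  (X0 : forall n, 'I_(m n) -> Omega_ n -> 'rV[R]_p)
  (X_law : forall n i, has_law (P_ n) (X n i) muX)
  (X0_law : forall n j, has_law (P_ n) (X0 n j) mu0)
  (samples_indep :
     forall n, mutually_independent (P_ n) (pooled (X n) (X0 n)))
  (Ghat : forall n, Omega_ n -> 'rV[R]_p -> 'rV[R]_p)
  (Ghat_optimal : forall n, {ae P_ n, forall om,
     optimal_transport (fun i => pooled (X n) (X0 n) i om)
       [set` grid n] (Ghat n om)})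
  (Ghat_measurable : forall n i,
     measurable_fun setT (fun om => Ghat n om (pooled (X n) (X0 n) i om)))
  (null_hypothesis : forall x, df muX x = df mu0 x)
  (dY : measure_display) (OmegaY : measurableType dY)
  (PY : probability OmegaY R) (Y : OmegaY -> 'rV[R]_p)
  (Y_law : has_law PY Y nu)
  (dZ : measure_display) (OmegaZ : measurableType dZ)
  (PZ : probability OmegaZ R) (Z : 'rV[R]_p -> OmegaZ -> R)
  (Z_measurable : measurable_fun setT
     (fun tom : 'rV[R]_p * OmegaZ => Z tom.1 tom.2))
  (Z_gaussian : gaussian_process PZ Z)
  (Z_centered : forall t, 'E_PZ[Z t]%E = 0%E)
  (Z_cov : forall t1 t2,
     'E_PZ[fun om => (Z t1 om * Z t2 om)%R]%E =
     covariance PY (fun om => cos_plus_sin t1 (Y om))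
                   (fun om => cos_plus_sin t2 (Y om))) :
  cvg_in_law P_
    (fun n om => rank_stat w (fun i => Ghat n om (X n i om))
                             (fun j => Ghat n om (X0 n j om)))
    PZ (fun om => \int[lebesgue_rV R p]_t (Z t om ^+ 2 * w t)).
Proof.
move=> f cf bf.
have [M0 [_ M0P]] := compact_bounded nu_compact.
(* A common bound for all grid points, from the compactness of the support; the maximum keeps it
   nonnegative. *)
pose M := Num.max 0 (M0 + 1).
have gM n y : y \in grid n -> `|y| <= M.
  move=> /grid_supp yS; rewrite (M0P M)// lt_max; apply/orP; right.
  by rewrite ltrDl.
have M_ge0 : 0 <= M by rewrite le_max lexx.
(* The first [8] bounds second moments and the other term bounds increments, for the rank fields and
   for [Z] alike. *)
pose C : R := 8 + 8 * (p%:R * M) ^+ 2.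
have C_ge0 : 0 <= 8 * (p%:R * M) ^+ 2 :> R by rewrite mulr_ge0// sqr_ge0.
pose U n := rank_field (X n.+1) (X0 n.+1) (Ghat n.+1).
(* The term [n = 0] is dropped, since the bounds on the rank field need both samples nonempty. *)
rewrite -cvg_shiftS.
have E n om : rank_stat w (fun i => Ghat n.+1 om (X n.+1 i om))
    (fun j => Ghat n.+1 om (X0 n.+1 j om)) = energy w (U n) om.
  exact: rank_stat_energy.
rewrite (_ : (fun n => _) = fun n => ('E_(P_ n.+1)[f \o energy w (U n)])%E); last first.
  by apply/funext => n; congr expectation; apply/funext => om; rewrite /= E.
apply: (energy_cvg_in_law w_weight (C := C) (P_ := fun n => P_ n.+1) (U_ := U)) => //.
- by move=> n; exact: measurable_rank_field.
- move=> n t; apply: le_trans (rank_field_sqr (ltn0Sn n) (m_gt0 _) (grid_uniq _) muX_ac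
    mu0_ac (X_law _) (X0_law _) (samples_indep _)
    (Ghat_optimal _) (Ghat_measurable _) null_hypothesis t) _.
  by rewrite lee_fin lerDl.
- move=> n s t; apply: le_trans (rank_field_incr (M := M) (ltn0Sn n) (m_gt0 _)
    (grid_uniq _) muX_ac mu0_ac (X_law _) (X0_law _) (samples_indep _)
    (Ghat_optimal _) (Ghat_measurable _) null_hypothesis s t _) _.
    by move=> a; apply: gM; exact: mem_tnth.
  by rewrite lee_fin ler_wpM2r// lerDr.
- move=> t;
    have := gaussian_field_sqr_mean Y_law Z_measurable Z_gaussian Z_cov [:: (1, t)].
  under eq_integral do rewrite /lin_form big_seq1 mul1r.
  move=> ->; rewrite lee_fin.
  rewrite (le_trans (trig_variance_le grid_cvg (c := 2) _))//.
    move=> n y _; rewrite /trig_comb big_seq1 mul1r; exact: norm_cos_plus_sin_le.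
  by rewrite /C; lra.
(* Opposite coefficients give the increment of [Z], whose variance inherits the Lipschitz bound from
   the grids. *)
- move=> s t;
    have := gaussian_field_sqr_mean Y_law Z_measurable Z_gaussian Z_cov [:: (1, t); (-1, s)].
  under eq_integral do rewrite /lin_form big_cons big_seq1 mul1r mulN1r.
  move=> ->; rewrite lee_fin.
  rewrite (le_trans (trig_variance_le grid_cvg (c := 2 * (p%:R * M) * `|t - s|) _))//.
    move=> n y /gM yM; rewrite /trig_comb big_cons big_seq1 mul1r mulN1r.
    rewrite (le_trans (cos_plus_sin_lipschitz _ _ _))//.
    rewrite -!mulrA ler_wpM2l// (le_trans (dotp_le _ _))// ler_wpM2l//.
    by rewrite mulrC ler_wpM2r.
  rewrite exprMn ler_wpM2r ?sqr_ge0// /C exprMn; lra.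
move=> b.
rewrite (gaussian_field_cos Y_law Z_measurable Z_gaussian Z_centered Z_cov b).
pose v n := \int[uniform_on (grid n)]_y (trig_comb b y ^+ 2) -
  (\int[uniform_on (grid n)]_y trig_comb b y) ^+ 2.
have vcvg : expR (- (v n.+1 / 2)) @[n --> \oo] --> expR (- (trig_variance nu b / 2)).
  apply: (continuous_cvg); first exact: continuous_expR.
  apply: cvgN; apply: cvgMr_tmp; rewrite (cvg_shiftS v).
  exact: trig_variance_cvg.
(* The cosine transform is split into the Gaussian value with the variance over the grid and an
   error bounded by [clt_error]. *)
rewrite -[X in _ --> X]addr0.
have dcvg : \int[P_ n.+1]_om cos (lin_form (U n) b om) -
    expR (- (v n.+1 / 2)) @[n --> \oo] --> (0 : R).
  apply/norm_cvg0P.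
  apply: (squeeze_cvgr (f := cst 0)
    (h := fun n => clt_error (trig_bound b) (two_sample_scale R n.+1 (m n.+1))^-1)).
  - near=> n; rewrite normr_ge0/=.
    exact: (rank_field_cos (ltn0Sn n) (m_gt0 _) (grid_uniq _) muX_ac mu0_ac (X_law _) (X0_law _)
      (samples_indep _) (Ghat_optimal _) (Ghat_measurable _) null_hypothesis b).
  - exact: cvg_cst.
  - by apply: clt_error_cvg; exact: two_sample_scale_cvg ratio_cvg.
apply: cvg_trans (cvgD vcvg dcvg); apply: near_eq_cvg.
by near=> n; rewrite /= subrKC.
Unshelve. all: by end_near. Qed.
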